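(* Let $K:\mathbb{R}^d\times\mathbb{R}^d\to\mathbb{R}$ be a kernel which is shift-invariant (normalized so $K(0)=1$) and analytic at the origin, with feature mapping $\varphi:\mathbb{R}^d\to\mathcal{H}$, and let $p\ge1$, $k\in\mathbb{N}$, $0<\epsilon,\delta<1$. For every finite data set $P\subset\mathbb{R}^d$, the RFF mapping $\pi:\mathbb{R}^d\to\mathbb{R}^D$ with target dimension $D=\Omega\big(p^2\log^3\frac{k}{\delta}+p^5\log^3\frac1\epsilon+p^8\big)/\epsilon^2$ satisfies \[\Pr\big[\forall\ k\text{-partitions }\mathcal{C}\text{ of }P:\ \mathrm{cost}_p^\pi(P,\mathcal{C})\in(1\pm\epsilon)\cdot\mathrm{cost}_p^\varphi(P,\mathcal{C})\big]\ge1-\delta.\]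
   Context: $K$ analytic at the origin means analytic on $\{x:\|x\|_1<r\}$ for some $r>0$. RFF mapping with target dimension $D$: $\pi(x)=\sqrt{1/D}\,(\sin\langle\omega_j,x\rangle,\cos\langle\omega_j,x\rangle)_{j=1}^D$ with $\omega_j$ i.i.d. from the density $p_K$ satisfying $K(x)=\int p_K(\omega)e^{\mathrm{i}\langle\omega,x\rangle}d\omega$. For a mapping $f$ into a Hilbert space $\mathcal{H}'$ and a partition $\mathcal{C}=\{C_1,\dots,C_k\}$ of $P$, the kernel $k$-clustering cost with $\ell_2^p$-objective is $\mathrm{cost}_p^f(P,\mathcal{C})=\sum_{i=1}^k\min_{c_i\in\mathcal{H}'}\sum_{x\in C_i}\|f(x)-c_i\|_2^p$ (for $p=2$ this is kernel $k$-means). The constant hidden in $\Omega(\cdot)$ depends on $K$. *)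

(* Defs.v *)
From HB Require Import structures.
From mathcomp Require Import all_boot all_order all_algebra.
From mathcomp Require Import all_classical all_reals all_analysis.
Set Implicit Arguments. Unset Strict Implicit. Unset Printing Implicit Defensive.
Import Order.TTheory GRing.Theory Num.Theory.
Import numFieldNormedType.Exports.
Local Open Scope classical_set_scope.
Local Open Scope ring_scope.

Definition Rd (R : realType) (d : nat) := g_sigma_algebraType (@open 'rV[R]_d).

Section Defs.
Variables (R : realType) (d : nat).

Definition dotv (w x : 'rV[R]_d) : R := \sum_(i < d) w 0 i * x 0 i.

Definition l1norm (x : 'rV[R]_d) : R := \sum_(i < d) `|x 0 i|.

Definition ps_term (c : ('I_d -> nat) -> R) (a x : 'rV[R]_d) (al : 'I_d -> nat) : R :=
  c al * \prod_(i < d) (x 0 i - a 0 i) ^+ al i.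

Definition ps_partial (F : ('I_d -> nat) -> R) (n : nat) : R :=
  \sum_(al : {ffun 'I_d -> 'I_n.+1} | (\sum_(i < d) (al i : nat) <= n)%N)
     F (fun i => (al i : nat)).

Definition analytic_on (K : 'rV[R]_d -> R) (U : set 'rV[R]_d) : Prop :=
  forall a, U a -> exists rho : R, 0 < rho /\
    exists c : ('I_d -> nat) -> R,
      forall x : 'rV[R]_d, (forall i, `|x 0 i - a 0 i| < rho) ->
        (exists M : R, forall n, ps_partial (fun al => `|ps_term c a x al|) n <= M) /\
        (ps_partial (ps_term c a x) @ \oo --> K x).

Definition is_lebesgue_Rd (lam : {measure set (Rd R d) -> \bar R}) : Prop :=
  forall a b : 'rV[R]_d, (forall i, a 0 i <= b 0 i) ->
    lam [set x : Rd R d | forall i, a 0 i <= (x : 'rV[R]_d) 0 i <= b 0 i]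
    = (\prod_(i < d) (b 0 i - a 0 i))%:E.

Definition is_inner_product (H : lmodType R) (ip : H -> H -> R) : Prop :=
  [/\ forall u v, ip u v = ip v u,
      forall (a : R) u v w, ip (a *: u + v) w = a * ip u w + ip v w
    & forall u, u != 0 -> 0 < ip u u].

Definition hnorm (H : lmodType R) (ip : H -> H -> R) (u : H) : R := Num.sqrt (ip u u).

Definition hdist (H : lmodType R) (ip : H -> H -> R) (u v : H) : R := hnorm ip (u - v).

Definition hilbert_complete (H : lmodType R) (ip : H -> H -> R) : Prop :=
  forall u : nat -> H,
    (forall e : R, 0 < e -> exists N, forall m n, (N <= m)%N -> (N <= n)%N ->
        hdist ip (u m) (u n) < e) ->
    exists l : H, forall e : R, 0 < e -> exists N, forall n, (N <= n)%N ->
        hdist ip (u n) l < e.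

Definition feature_map (K : 'rV[R]_d -> R) (H : lmodType R) (ip : H -> H -> R)
    (phi : 'rV[R]_d -> H) : Prop :=
  forall x y, ip (phi x) (phi y) = K (x - y).

(* kernel k-clustering cost with l_2^p objective of the partition of P given
   by the cluster assignment sigma (cluster i = points of P mapped to i) *)
Definition cost (V : Type) (dist : V -> V -> R) (f : 'rV[R]_d -> V) (k : nat)
    (P : seq 'rV[R]_d) (sigma : 'rV[R]_d -> 'I_k) (p : R) : R :=
  \sum_(i < k) inf [set (\sum_(x <- P | sigma x == i) (dist (f x) c) `^ p)
                    | c in [set: V]].

(* R^{2D}, written as D pairs (sin-coordinate, cos-coordinate), with the
   Euclidean (l2) distance *)
Definition l2dist2D (D : nat) (u v : 'I_D -> R * R) : R :=
  Num.sqrt (\sum_(j < D) (((u j).1 - (v j).1) ^+ 2 + ((u j).2 - (v j).2) ^+ 2)).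

Definition rff (D : nat) (om : 'I_D -> 'rV[R]_d) (x : 'rV[R]_d) : 'I_D -> R * R :=
  fun j => (Num.sqrt (D%:R^-1) * sin (dotv (om j) x),
            Num.sqrt (D%:R^-1) * cos (dotv (om j) x)).

Definition iid_with_density (dT : measure_display) (T : measurableType dT)
    (Pr : probability T R) (D : nat) (om : 'I_D -> T -> Rd R d)
    (lam : {measure set (Rd R d) -> \bar R}) (pK : Rd R d -> R) : Prop :=
  [/\ forall j, measurable_fun setT (om j),
      forall j (A : set (Rd R d)), measurable A ->
        Pr (om j @^-1` A) = (\int[lam]_(w in A) (pK w)%:E)%E
    & forall A : 'I_D -> set (Rd R d), (forall j, measurable (A j)) ->
        Pr (\bigcap_(j in [set: 'I_D]) (om j @^-1` A j))
        = (\prod_(j < D) fine (Pr (om j @^-1` A j)))%:E].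

End Defs.

(* Main.v *)
(* For a pair of points at difference [z], the relative error of the squared distance
   after the mapping is the mean of D independent copies of
   [(1 - cos <w, z>) / (1 - K z) - 1]. Analyticity of [K] at the origin bounds the
   moments of [1 - cos <w, z>] by [(B a^2 (1 - K z))^a], uniformly in [z], so for
   D >= C m^3 p^2 / eps^2 the 2m-th moment of the error is at most
   [exp (- m) * (eps / (100 p))^(2m)].

   A union bound over pairs is impossible since the data set is unbounded. Fix instead
   k optimal medoids and group the points by closest medoid and by the scale of their
   distance to it. By Markov's inequality, with probability at least [1 - delta] the
   pairs of medoids are undistorted and, outside a set of points with negligible cost,
   every point has undistorted distances to the medoids and few distorted distances to
   each group of comparable scale. This holds for all partitions at once: given one, move
   the remaining points, and those in cells too small to inherit the sparsity, to their
   medoids. The cost of the change is negligible, and the distorted pairs are now sparse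
   in every cluster.

   The optimal center of a cluster within the convex hull is a weighted mean of the
   cluster, and a weighted sum of squared distances to the mean is a sum over pairs of
   points. Hence sparse distorted pairs change little, and centers can be transferred
   between the two spaces in both directions. *)

Require Import Defs.
From HB Require Import structures.
From mathcomp Require Import all_boot all_order all_algebra.
From mathcomp Require Import all_classical all_reals all_analysis.
From mathcomp Require Import measurable_realfun.
From mathcomp Require Import ring lra zify.
Set Implicit Arguments.
Unset Strict Implicit.
Unset Printing Implicit Defensive.
Import Order.TTheory GRing.Theory Num.Theory.
Import numFieldNormedType.Exports.
Local Open Scope classical_set_scope.
Local Open Scope ring_scope.

(** * Power inequalities and inner products *)

(** The good event concerns only the data, the medoids and the sample; a partition enters
    afterwards. Every additive error is measured against the medoid cost, which is at most [2 ^ p]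
    times the cost of any partition, so it becomes a relative error for all partitions at once.

    The losses are powers of [H = (100 p / eps) ^ p], and Markov's inequality needs
    [5 k^2 H^36 exp (- m) <= delta]. Hence [m] is of the order of
    [ln (k / delta) + p ln (1 / eps) + p^2], and [p^2 m^3 / eps^2] yields the three terms of the
    target dimension.

    The pair identity needs squares while the cost has exponent [p]. Squared distances are therefore
    raised to the power [p / 2] and linearized by a tangent, which gives weights [t ^ (p / 2 - 1)].
    These are singular at 0 for [p < 2] and differ from point to point. A positive summand [s],
    built from a small multiple of the distance to the medoid, is added to each squared distance: it
    makes the weights finite and comparable within a group, and the cost of distorted pairs is paid
    in multiples of it. *)

Section PowerInequalities.
Variable R : realType.
Implicit Types (r s t x p : R).

(** Young's inequality for [x] and 1 with the conjugate exponents [r] and [r / (r - 1)]. *)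
Lemma powR_bernoulli r x : 1 <= r -> 0 <= x -> 1 + r * (x - 1) <= x `^ r.
Proof.
move=> r1 x0; have r0 : 0 < r by lra.
have [->|rn1] := eqVneq r 1; first by rewrite powRr1 //; lra.
have r11 : 0 < r - 1 by rewrite subr_gt0 lt_neqAle eq_sym rn1.
have := @conjugate_powR R x 1 r (r / (r - 1)) x0 ler01 r0 (divr_gt0 r0 r11).
rewrite invf_div powR1 => /(_ _)/wrap[].
  by field; rewrite gt_eqF.
rewrite mulr1 mul1r => /(ler_wpM2l (ltW r0)).
rewrite mulrDr mulrCA mulfV ?gt_eqF// mulrCA mulfV ?gt_eqF//; lra.
Qed.

Lemma powRB1 a r : 0 < a -> a `^ (r - 1) = a `^ r / a.
Proof.
by move=> a0; rewrite powRB ?powRr1 ?(ltW a0)//; apply/implyP => _; rewrite gt_eqF.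
Qed.

Lemma powR_tangent_ge r a b : 1 <= r -> 0 < a -> 0 <= b ->
  a `^ r + r * a `^ (r - 1) * (b - a) <= b `^ r.
Proof.
move=> r1 a0 b0; have := @powR_bernoulli r (b / a) r1 (divr_ge0 b0 (ltW a0)).
rewrite powRM ?invr_ge0 ?(ltW a0)//.
have -> : a^-1 `^ r = (a `^ r)^-1.
  by rewrite -(powR_inv1 (ltW a0)) -powRrM mulN1r powRN.
have ar0 : 0 < a `^ r by rewrite powR_gt0.
rewrite ler_pdivlMr// => h; apply: le_trans h.
rewrite powRB1//.
by rewrite le_eqVlt; apply/orP; left; apply/eqP; field; rewrite gt_eqF.
Qed.

(** The convex inequality for the exponent [r^-1] at the points [a ^ r] and [b ^ r], solved for
    [b ^ r]. *)
Lemma powR_tangent_le r a b : 0 < r -> r <= 1 -> 0 < a -> 0 <= b ->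
  b `^ r <= r * a `^ (r - 1) * b + (1 - r) * a `^ r.
Proof.
move=> r0 r1 a0 b0.
have a'0 : 0 < a `^ r by rewrite powR_gt0.
have := @powR_tangent_ge r^-1 (a `^ r) (b `^ r) _ a'0 (powR_ge0 _ _).
rewrite invf_ge1// => /(_ r1).
have er : r * (r^-1 - 1) = 1 - r by rewrite mulrBr mulfV ?gt_eqF// mulr1.
rewrite -!powRrM er mulfV ?gt_eqF// !powRr1 ?(ltW a0)//.
have -> : a `^ (1 - r) = a / a `^ r by rewrite powRB ?powRr1 ?(ltW a0)//; apply/implyP => _; rewrite gt_eqF.
rewrite powRB1// => h.
rewrite -subr_ge0 in h; rewrite -subr_ge0.
have -> : r * (a `^ r / a) * b + (1 - r) * a `^ r - b `^ r =
  (r * a `^ r / a) * (b - (a + r^-1 * (a / a `^ r) * (b `^ r - a `^ r))).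
  by field; rewrite !gt_eqF.
by rewrite mulr_ge0// divr_ge0 ?mulr_ge0 ?ltW.
Qed.

(* no convexity: the larger of [t a] and [b] absorbs the other *)
Lemma powR_add_le p t a b : 0 <= p -> 0 < t -> 0 <= a -> 0 <= b ->
  (a + b) `^ p <= (1 + t) `^ p * a `^ p + (1 + t^-1) `^ p * b `^ p.
Proof.
move=> p0 t0 a0 b0; have ti0 : 0 < t^-1 by rewrite invr_gt0.
rewrite -!powRM ?addr_ge0 ?(ltW t0) ?(ltW ti0)//.
have [bta|tab] := leP b (t * a).
  rewrite -[leLHS]addr0 lerD ?powR_ge0// ge0_ler_powR// ?nnegrE ?addr_ge0 ?mulr_ge0 ?addr_ge0 ?(ltW t0)//.
  by rewrite mulrDl mul1r lerD2l.
rewrite -[leLHS]add0r lerD ?powR_ge0// ge0_ler_powR// ?nnegrE ?addr_ge0 ?mulr_ge0 ?addr_ge0 ?(ltW ti0)//.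
by rewrite mulrDl mul1r addrC lerD2l ler_pdivlMl// ltW.
Qed.

End PowerInequalities.

Section InnerProduct.
Variables (R : realType) (V : lmodType R) (ip : V -> V -> R).
Hypothesis ipP : is_inner_product ip.
Implicit Types (u v w : V).

Lemma ipC u v : ip u v = ip v u. Proof. by case: ipP. Qed.

Lemma ipDl u v w : ip (u + v) w = ip u w + ip v w.
Proof. by case: ipP => _ h _; rewrite -[u]scale1r h mul1r scale1r. Qed.

Lemma ip0l w : ip 0 w = 0.
Proof. by apply: (addrI (ip 0 w)); rewrite -ipDl !addr0. Qed.

Lemma ipZl a u w : ip (a *: u) w = a * ip u w.
Proof. by case: ipP => _ h _; rewrite -[a *: u]addr0 h ip0l addr0. Qed.

Lemma ipNl u w : ip (- u) w = - ip u w.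
Proof. by rewrite -scaleN1r ipZl mulN1r. Qed.

Lemma ipDr u v w : ip w (u + v) = ip w u + ip w v.
Proof. by rewrite !(ipC w) ipDl. Qed.

Lemma ipZr a u w : ip w (a *: u) = a * ip w u.
Proof. by rewrite !(ipC w) ipZl. Qed.

Lemma ipNr u w : ip w (- u) = - ip w u.
Proof. by rewrite !(ipC w) ipNl. Qed.

Lemma ip0r w : ip w 0 = 0. Proof. by rewrite ipC ip0l. Qed.

Lemma ip_suml (I : finType) (P : pred I) (F : I -> V) w :
  ip (\sum_(i | P i) F i) w = \sum_(i | P i) ip (F i) w.
Proof. by apply: (big_morph (ip^~ w)) => [x y|]; rewrite ?ipDl ?ip0l. Qed.

Lemma ip_sumr (I : finType) (P : pred I) (F : I -> V) w :
  ip w (\sum_(i | P i) F i) = \sum_(i | P i) ip w (F i).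
Proof. by rewrite ipC ip_suml; apply: eq_bigr => i _; rewrite ipC. Qed.

Lemma ip_ge0 u : 0 <= ip u u.
Proof. by have [->|u0] := eqVneq u 0; rewrite ?ip0l //; case: ipP => _ _ h; apply/ltW/h. Qed.

Lemma ipDD u v : ip (u + v) (u + v) = ip u u + 2 * ip u v + ip v v.
Proof. by rewrite ipDl !ipDr (ipC v u); ring. Qed.

Lemma ipBB u v : ip (u - v) (u - v) = ip u u - 2 * ip u v + ip v v.
Proof. by rewrite ipDD ipNr ipNl ipNr; ring. Qed.

Lemma ip_distC u v : ip (u - v) (u - v) = ip (v - u) (v - u).
Proof. by rewrite -opprB ipNl ipNr opprK. Qed.

Lemma ip_CS u v : ip u v ^+ 2 <= ip u u * ip v v.
Proof.
have [->|v0] := eqVneq v 0; first by rewrite !ip0r expr0n mulr0.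
have vv : 0 < ip v v by case: ipP => _ _ h; apply: h.
have := ip_ge0 (ip v v *: u - ip u v *: v).
rewrite ipBB !ipZl !ipZr => h.
have {}h : 0 <= ip v v * (ip u u * ip v v - ip u v ^+ 2) by apply: le_trans h _; rewrite le_eqVlt; apply/orP; left; apply/eqP; ring.
by rewrite -subr_ge0 -(pmulr_rge0 _ vv).
Qed.

Lemma hdist_sqr u v : hdist ip u v ^+ 2 = ip (u - v) (u - v).
Proof. by rewrite sqr_sqrtr ?ip_ge0. Qed.

Lemma hdist_ge0 u v : 0 <= hdist ip u v. Proof. exact: sqrtr_ge0. Qed.

Lemma hdistC u v : hdist ip u v = hdist ip v u.
Proof. by rewrite /hdist /hnorm ip_distC. Qed.

Lemma hdist_tri u v w : hdist ip u w <= hdist ip u v + hdist ip v w.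
Proof.
rewrite -ler_sqr ?nnegrE ?addr_ge0 ?hdist_ge0// sqrrD !hdist_sqr.
have -> : u - w = (u - v) + (v - w) by rewrite addrA subrK.
rewrite ipDD lerD2r lerD2l -[leRHS]mulr_natl ler_pM2l//.
apply: le_trans (ler_norm _) _.
rewrite -ler_sqr ?nnegrE ?mulr_ge0 ?hdist_ge0 ?normr_ge0//.
by rewrite exprMn !hdist_sqr real_normK ?num_real// ip_CS.
Qed.

Lemma hdist_powR u v p : hdist ip u v `^ p = ip (u - v) (u - v) `^ (p / 2).
Proof. by rewrite /hdist /hnorm -powR12_sqrt ?ip_ge0// -powRrM mulrC. Qed.

Lemma ip_dist_le2 u v w :
  ip (u - w) (u - w) <= 2 * ip (v - w) (v - w) + 2 * ip (u - v) (u - v).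
Proof.
have -> : u - w = (u - v) + (v - w) by rewrite addrA subrK.
have := ip_ge0 ((u - v) - (v - w)); rewrite ipBB (ipDD (u - v)); lra.
Qed.

Section Barycenter.
Variables (I : finType) (C : pred I) (q : I -> R) (X : I -> V).
Hypothesis Q0 : 0 < \sum_(i | C i) q i.

Definition barycenter := (\sum_(i | C i) q i)^-1 *: \sum_(i | C i) q i *: X i.

Lemma sum_barycenter : \sum_(i | C i) q i *: (X i - barycenter) = 0.
Proof.
under eq_bigr do rewrite scalerBr.
rewrite sumrB -scaler_suml /barycenter scalerA mulfV ?gt_eqF// scale1r.
exact: subrr.
Qed.

Lemma barycenter_dist c : \sum_(i | C i) q i * ip (X i - c) (X i - c) =
  \sum_(i | C i) q i * ip (X i - barycenter) (X i - barycenter) +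
  (\sum_(i | C i) q i) * ip (barycenter - c) (barycenter - c).
Proof.
set b := barycenter.
have h i : ip (X i - c) (X i - c) =
    ip (X i - b) (X i - b) + 2 * ip (X i - b) (b - c) + ip (b - c) (b - c).
  by rewrite -ipDD addrA subrK.
under eq_bigr do rewrite h !mulrDr.
rewrite !big_split/= -mulr_suml -addrA; congr (_ + _).
rewrite -[RHS]add0r; congr (_ + _).
under eq_bigr do rewrite mulrCA -ipZl.
by rewrite -mulr_sumr -ip_suml sum_barycenter ip0l mulr0.
Qed.

(** The identity [barycenter_dist] with [c = X i], averaged over [i]. The left side mentions no
    center, so it can be compared between two spaces pair by pair. *)
Lemma barycenter_pairs :
  \sum_(i | C i) \sum_(j | C j) q i * q j * ip (X i - X j) (X i - X j) =
  2 * (\sum_(i | C i) q i) *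
  \sum_(i | C i) q i * ip (X i - barycenter) (X i - barycenter).
Proof.
set b := barycenter; set S := \sum_(i | C i) q i * _; set Q := \sum_(i | C i) q i.
have h i : \sum_(j | C j) q i * q j * ip (X i - X j) (X i - X j) =
   q i * (S + Q * ip (X i - b) (X i - b)).
  rewrite ip_distC -barycenter_dist mulr_sumr; apply: eq_bigr => j _.
  by rewrite mulrA [ip (X j - _) _]ip_distC.
under eq_bigr do rewrite h mulrDr mulrCA.
by rewrite big_split/= -mulr_suml -mulr_sumr -/S -/Q; ring.
Qed.

End Barycenter.

End InnerProduct.

(** * Cluster costs under sparse distortion *)

Lemma cvg_fsum (R : realType) (T : Type) (F : set_system T) {FF : Filter F}
    (J : Type) (r : seq J) (P : pred J) (f : J -> T -> R) (l : J -> R) :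
  (forall j, P j -> f j x @[x --> F] --> l j) ->
  \sum_(j <- r | P j) f j x @[x --> F] --> \sum_(j <- r | P j) l j.
Proof.
move=> fl; elim: r => [|j r ih].
  by rewrite big_nil; under eq_fun do rewrite big_nil; exact: cvg_cst.
rewrite big_cons; under eq_fun do rewrite big_cons.
by case: ifPn => // Pj; apply: cvgD => //; exact: fl.
Qed.

Lemma continuous_fsum (R : realType) (T : topologicalType) (J : Type) (r : seq J)
    (P : pred J) (f : J -> T -> R) x :
  (forall j, P j -> {for x, continuous (f j)}) ->
  {for x, continuous (fun y => \sum_(j <- r | P j) f j y)}.
Proof. by move=> fx; apply: (@cvg_fsum _ _ (nbhs x)). Qed.

Lemma cvg_powR (R : realType) (T : Type) (F : set_system T) {FF : Filter F}
    (f : T -> R) (a r : R) : 0 < a ->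
  f x @[x --> F] --> a -> (f x) `^ r @[x --> F] --> a `^ r.
Proof.
move=> a0 fa.
have : {for a, continuous (fun b : R => b `^ r)}.
  apply: differentiable_continuous; apply/derivable1_diffP.
  by apply: derivable_powR; rewrite in_itv/= a0.
move=> h; exact: (cvg_comp _ _ fa h).
Qed.

Section Minimizer.
Variables (R : realType) (V : lmodType R) (ip : V -> V -> R).
Hypothesis ipP : is_inner_product ip.
Variables (I : finType) (C : pred I) (X : I -> V) (s : I -> R) (r : R).
Hypotheses (s_gt0 : forall i, 0 < s i) (r_ge1 : 1 <= r).

Let n := #|I|.
(** Centers are parametrized by weight vectors, so that compactness of the simplex yields a
    minimizer whatever the dimension of [V]. Coordinates outside [C] do not affect the center and
    are confined to [0, 1] only for compactness. *)
Let hull (la : 'rV[R]_n) := \sum_(i | C i) la 0 (enum_rank i) *: X i.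
Let dist2 (c : V) i := ip (X i - c) (X i - c) + s i.
Let simplex : set 'rV[R]_n :=
  [set la | forall j, `[0, 1]%classic (la ord0 j)] `&`
  (fun la => \sum_(i | C i) la 0 (enum_rank i)) @^-1` [set 1].

Let dist2_gt0 c i : 0 < dist2 c i.
Proof. by rewrite ltr_wpDl ?ip_ge0. Qed.

Let simplex_compact : compact simplex.
Proof.
apply: compact_closedI.
  by apply: (@rV_compact R n (fun=> `[0, 1]%classic)) => j; exact: segment_compact.
apply: (@preimage_closed _ R (fun la : 'rV[R]_n => \sum_(i | C i) la 0 (enum_rank i))).
  by move=> la _; apply: continuous_fsum => i _; exact: coord_continuous.
exact: closed_eq.
Qed.

Let hull_dist2_continuous i : continuous (fun la => dist2 (hull la) i).
Proof.
pose g (la : 'rV[R]_n) := ip (X i) (X i)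
  - 2 * (\sum_(j | C j) la 0 (enum_rank j) * ip (X j) (X i))
  + \sum_(j | C j) la 0 (enum_rank j) *
      (\sum_(h | C h) la 0 (enum_rank h) * ip (X h) (X j)) + s i.
have -> : (fun la => dist2 (hull la) i) = g.
  apply/funext => la; rewrite /dist2 /g /hull ipBB// (ipC ipP (X i)) !ip_suml//.
  congr (_ - 2 * _ + _ + _); first by apply: eq_bigr => j _; rewrite ipZl.
  apply: eq_bigr => j _; rewrite ipZl// ip_sumr//; congr (_ * _).
  by apply: eq_bigr => h _; rewrite ipZr// (ipC ipP (X j)).
have coordc la j : {for la, continuous (fun la : 'rV[R]_n => la 0 (enum_rank j))}.
  exact: coord_continuous.
have cc (a : R) (la : 'rV[R]_n) : {for la, continuous (fun _ : 'rV[R]_n => a)}.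
  exact: cst_continuous.
move=> la; rewrite /g.
apply: (@continuousD R R _ _ _ la); last exact: cc.
apply: (@continuousD R R _ _ _ la); last first.
  apply: continuous_fsum => j _; apply: continuousM; first exact: coordc.
  by apply: continuous_fsum => h _; apply: continuousM; [exact: coordc|exact: cc].
apply: continuousB; first exact: cc.
apply: continuousM; first exact: cc.
by apply: continuous_fsum => h _; apply: continuousM; [exact: coordc|exact: cc].
Qed.

(* A minimizer over the convex hull of the points is its own weighted mean, since
   moving towards the mean would decrease the objective to first order. *)
Lemma minimizer_barycenter : (exists i, C i) -> exists c,
  c = barycenter C (fun i => dist2 c i `^ (r - 1)) X.
Proof.
case=> i0 Ci0.
have simplex_of (q : I -> R) : (forall i, 0 <= q i) -> 0 < \sum_(i | C i) q i ->
    exists2 la, simplex la & hull la = barycenter C q X.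
  move=> q0 Q0; set Q := \sum_(i | C i) q i in Q0.
  pose la : 'rV[R]_n := \row_j (if C (enum_val j) then Q^-1 * q (enum_val j) else 0).
  have laE i : C i -> la 0 (enum_rank i) = Q^-1 * q i.
    by move=> Ci; rewrite mxE enum_rankK Ci.
  exists la.
    split => [j|]/=.
      rewrite in_itv/= mxE; case: ifP => [Cj|_]; last by rewrite lexx ler01.
      rewrite mulr_ge0 ?invr_ge0 ?(ltW Q0)//= mulrC ler_pdivrMr// mul1r.
      by rewrite /Q (bigD1 (enum_val j))//= lerDl sumr_ge0.
    rewrite (eq_bigr (fun i => Q^-1 * q i)); last by move=> i Ci; exact: laE.
    by rewrite -mulr_sumr mulVf ?gt_eqF.
  rewrite /hull /barycenter scaler_sumr; apply: eq_bigr => i Ci.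
  by rewrite laE// scalerA.
pose f la := \sum_(i | C i) dist2 (hull la) i `^ r.
have [la0 s0 la0min] : exists2 la0, simplex la0 & forall la, simplex la -> f la0 <= f la.
  have ne : simplex !=set0.
    have [||la sla _] := simplex_of (fun=> 1).
    - by move=> _; exact: ler01.
    - by rewrite (bigD1 i0)//= ltr_pwDl// sumr_ge0.
    by exists la.
  have [|la0 /set_mem s0 h] := EVT_min_rV (f := f) ne simplex_compact.
    apply: continuous_subspaceT => la; apply: continuous_fsum => i _.
    by apply: (@cvg_powR _ _ (nbhs la)); [exact: dist2_gt0|exact: hull_dist2_continuous].
  by exists la0 => // la sla; apply: h; exact: mem_set.
pose c := hull la0; exists c.
pose q i := dist2 c i `^ (r - 1).
have q0 i : 0 < q i by rewrite powR_gt0.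
have Q0 : 0 < \sum_(i | C i) q i.
  by rewrite (bigD1 i0)//= ltr_pwDl// sumr_ge0// => i _; exact: ltW.
have [|la1 s1 la1E] := simplex_of q _ Q0; first by move=> i; exact: ltW.
rewrite -/q; set v := barycenter C q X in la1E *.
pose w := v - c.
have hullt t : hull ((1 - t) *: la0 + t *: la1) = c + t *: w.
  rewrite /hull; under eq_bigr do rewrite !mxE scalerDl -!scalerA.
  rewrite big_split/= -!scaler_sumr -/(hull la0) -/(hull la1) la1E -/c.
  by rewrite /w scalerBl scale1r scalerBr addrAC addrA.
have simplext t : 0 < t -> t <= 1 -> simplex ((1 - t) *: la0 + t *: la1).
  move=> t0 t1; case: s0 => a0 b0; case: s1 => a1 b1; split => [j|]/=.
    have := a0 j; have := a1 j; rewrite /= !in_itv/= !mxE => /andP[x0 x1] /andP[y0 y1].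
    apply/andP; split; first by rewrite addr_ge0// mulr_ge0// ?subr_ge0// ltW.
    have h1 : (1 - t) * la0 ord0 j <= (1 - t) * 1 by rewrite ler_wpM2l// subr_ge0.
    have h2 : t * la1 ord0 j <= t * 1 by rewrite ler_wpM2l// ltW.
    lra.
  under eq_bigr do rewrite !mxE.
  by rewrite big_split/= -!mulr_sumr b0 b1 !mulr1 subrK.
have dt t i : dist2 (c + t *: w) i =
    dist2 c i - 2 * t * ip (X i - c) w + t ^+ 2 * ip w w.
  rewrite /dist2 opprD addrA (ipBB ipP (X i - c)) !(ipZr ipP) !(ipZl ipP); ring.
(* By the tangent inequality at [c + t *: w], the objective grows by at most [r * t * g t] from [c]
   to [c + t *: w], so minimality gives [0 <= g t] for small positive [t]. But [g] is continuous at
   0 with value a negative multiple of [ip w w], which forces [w = 0]; the objective itself is never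
   differentiated. *)
pose g t := \sum_(i | C i) dist2 (c + t *: w) i `^ (r - 1) *
  (- 2 * ip (X i - c) w + t * ip w w).
have g_ge0 t : 0 < t -> t <= 1 -> 0 <= g t.
  move=> t0 t1; have r0 : 0 < r by move: r_ge1; lra.
  rewrite -(@pmulr_rge0 _ (r * t)) ?mulr_gt0//.
  have := la0min _ (simplext t t0 t1); rewrite /f hullt -/c -subr_ge0 -sumrB.
  move=> /le_trans; apply; rewrite /g mulr_sumr; apply: ler_sum => i _.
  have := powR_tangent_ge r_ge1 (dist2_gt0 (c + t *: w) i) (ltW (dist2_gt0 c i)).
  rewrite dt => h; rewrite lerBlDr -lerBlDl; apply: le_trans h.
  rewrite le_eqVlt; apply/orP; left; apply/eqP; ring.
have g0 : g 0 = - 2 * (\sum_(i | C i) q i) * ip w w.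
  rewrite /g; under eq_bigr do rewrite mul0r addr0 scale0r addr0 mulrCA -(ipZl ipP).
  rewrite -mulr_sumr -(ip_suml ipP) -mulrA; congr (_ * _).
  have -> : \sum_(i | C i) q i *: (X i - c) = (\sum_(i | C i) q i) *: w.
    under eq_bigr do rewrite scalerBr.
    rewrite sumrB -scaler_suml /w scalerBr /v /barycenter scalerA mulfV ?gt_eqF//.
    by rewrite scale1r.
  by rewrite ipZl.
suff w0 : ip w w <= 0.
  have : w == 0.
    apply/contraT => wn0; case: ipP => _ _ /(_ _ wn0).
    by rewrite ltNge w0.
  by rewrite subr_eq0 => /eqP.
rewrite leNgt; apply/negP => w0.
have gneg : g 0 < 0 by rewrite g0 -mulrA mulNr oppr_lt0 !mulr_gt0.
have gc : {for 0, continuous g}.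
  apply: cvg_fsum => i _; apply: cvgM.
    apply: cvg_powR; first exact: dist2_gt0.
    rewrite dt; under eq_fun do rewrite dt.
    apply: cvgD; last first.
      by apply: cvgM; [exact: exprn_continuous|exact: cvg_cst].
    apply: cvgB; first exact: cvg_cst.
    apply: cvgM; last exact: cvg_cst.
    by apply: cvgM; [exact: cvg_cst|exact: cvg_id].
  apply: cvgD; first exact: cvg_cst.
  by apply: cvgM; [exact: cvg_id|exact: cvg_cst].
have gn : nbhs (0 : R) [set t | g t < 0] by exact: (@cvgr_lt R R (nbhs (0 : R)) _ g _ gc 0 gneg).
have [e /= e0 he] := (@nbhs_ballP R R _ _).1 gn.
pose t := Num.min (e / 2) 1.
have t0 : 0 < t by rewrite lt_min ltr01 divr_gt0.
have : g t < 0.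
  apply: he; rewrite /ball/= sub0r normrN gtr0_norm//.
  by rewrite /t gt_min ltr_pdivrMr// ltr_pMr// ltr1n.
by rewrite ltNge g_ge0// /t ge_min lexx orbT.
Qed.

End Minimizer.

Section RobustTransfer.
Variables (R : realType) (V V' : lmodType R) (ip : V -> V -> R) (ip' : V' -> V' -> R).
Hypotheses (ipP : is_inner_product ip) (ipP' : is_inner_product ip').
Variables (I : finType) (C : pred I) (X : I -> V) (X' : I -> V') (s : I -> R).
Variables (bad : rel I) (al B : R).
Hypotheses (s_gt0 : forall i, 0 < s i) (al_ge1 : 1 <= al) (B_ge0 : 0 <= B).
Hypothesis good_le : forall i j, C i -> C j -> ~~ bad i j ->
  ip' (X' i - X' j) (X' i - X' j) <= al * ip (X i - X j) (X i - X j).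
Hypothesis bad_le : forall i j, C i -> C j -> bad i j ->
  ip' (X' i - X' j) (X' i - X' j) <= B * s i.

(** On the source side any [c] may stand for the mean, since the mean minimizes the weighted sum of
    squares. Bad pairs with first member [i] cost at most [B * s i * q i] times the weight of the
    bad partners of [i], hence a small multiple of the regularizing sum. *)
Lemma weighted_transfer (q : I -> R) (kap : R) c :
  (forall i, C i -> 0 < q i) -> 0 < \sum_(i | C i) q i ->
  (forall i, C i -> \sum_(j | C j && bad i j) q j <= kap * \sum_(j | C j) q j) ->
  forall b, b = barycenter C q X' ->
  \sum_(i | C i) q i * ip' (X' i - b) (X' i - b) <=
  al * (\sum_(i | C i) q i * ip (X i - c) (X i - c)) +
  kap * B * \sum_(i | C i) q i * s i.
Proof.
move=> q0 Q0 sparse; set Q := \sum_(i | C i) q i in Q0 sparse * => b bE.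
have kap0 i : C i -> 0 <= kap.
  move=> Ci; rewrite -(pmulr_lge0 _ Q0); apply: le_trans (sparse _ Ci).
  by apply: sumr_ge0 => j /andP[Cj _]; rewrite ltW ?q0.
set S := \sum_(i | C i) q i * ip (X i - c) (X i - c); set T := \sum_(i | C i) q i * s i.
rewrite -(@ler_pM2l _ (2 * Q)) ?mulr_gt0//.
rewrite bE -(barycenter_pairs ipP' X' Q0).
have -> : 2 * Q * (al * S + kap * B * T) = al * (2 * Q * S) + 2 * (kap * B * Q * T) by ring.
apply: (@le_trans _ _ (\sum_(i | C i) \sum_(j | C j)
   (al * (q i * q j * ip (X i - X j) (X i - X j)) +
    (if bad i j then q i * q j * (B * s i) else 0)))).
  apply: ler_sum => i Ci; apply: ler_sum => j Cj.
  have qq : 0 < q i * q j by rewrite mulr_gt0 ?q0.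
  case: ifPn => bij; last first.
    by rewrite addr0 mulrCA ler_pM2l// good_le.
  rewrite -[leLHS]add0r lerD//; last by rewrite ler_pM2l// bad_le.
  apply: mulr_ge0; first exact: le_trans ler01 al_ge1.
  by rewrite mulr_ge0 ?ip_ge0// ltW.
under eq_bigr do rewrite big_split/= -mulr_sumr.
rewrite big_split/= -mulr_sumr; apply: lerD.
  rewrite ler_pM2l ?(lt_le_trans ltr01)// barycenter_pairs// ler_pM2l ?mulr_gt0//.
  rewrite /S (barycenter_dist ipP X Q0 c) lerDl mulr_ge0 ?ip_ge0//; exact: ltW.
have T0 : 0 <= T by apply: sumr_ge0 => i Ci; rewrite mulr_ge0 ?ltW ?q0.
apply: (@le_trans _ _ (kap * B * Q * T)); last first.
  rewrite mulr_natl mulr2n lerDl.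
  have [/existsP[i Ci]|/existsPn nC] := boolP [exists i, C i].
    by rewrite !mulr_ge0 ?(kap0 i)// ltW.
  by rewrite /T big1 ?mulr0// => i Ci; move: (nC i); rewrite Ci.
rewrite /T mulr_sumr; apply: ler_sum => i Ci.
rewrite -big_mkcondr/=.
have -> : \sum_(j | C j && bad i j) q i * q j * (B * s i) =
   (q i * (B * s i)) * \sum_(j | C j && bad i j) q j.
  by rewrite mulr_sumr; apply: eq_bigr => j _; ring.
have -> : kap * B * Q * (q i * s i) = (q i * (B * s i)) * (kap * Q) by ring.
by rewrite ler_wpM2l ?sparse// mulr_ge0 ?(ltW (q0 _ Ci))// mulr_ge0// ltW.
Qed.

Variables (G : eqType) (cls : I -> option G) (Gam k0 p : R).
Hypotheses (p_ge1 : 1 <= p) (Gam_ge0 : 0 <= Gam) (k0_ge0 : 0 <= k0).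
Hypothesis bad_cls : forall i j, C i -> C j -> bad i j -> cls j != None.
Hypothesis cls_le : forall i j, C i -> C j -> cls i != None -> cls i = cls j ->
  [/\ ip (X i - X j) (X i - X j) <= Gam * s j,
      ip' (X' i - X' j) (X' i - X' j) <= Gam * s j & s i <= Gam * s j].
Hypothesis cls_sparse : forall i j, C i -> C j -> bad i j ->
  (#|[pred h | C h && (cls h == cls j) && bad i h]|)%:R <=
   k0 * (#|[pred h | C h && (cls h == cls j)]|)%:R.

(* The weights [t i ^ (p/2 - 1)] of two members of a class differ at most by the
   factor [A], so sparsity by counting gives sparsity by weight. *)
Let A := (2 + 3 * Gam) `^ p.

(** The weight of each bad partner [j] of [i] is spread evenly over the class of [j], at the price
    of the factor [A]. After exchanging the sums, [q h] is charged for the fraction of its class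
    that is bad for [i], at most [k0]. The class [None] is for points that are never the second
    member of a bad pair. *)
Lemma class_weights (q : I -> R) :
  (forall i, C i -> 0 < q i) ->
  (forall i j, C i -> C j -> cls i != None -> cls i = cls j -> q i <= A * q j) ->
  forall i, C i -> \sum_(j | C j && bad i j) q j <= k0 * A * \sum_(j | C j) q j.
Proof.
move=> q0 qA i Ci.
pose cell j := [pred h | C h && (cls h == cls j)].
have cell_gt0 j : C j -> 0 < (#|cell j|)%:R :> R.
  by move=> Cj; rewrite ltr0n; apply/card_gt0P; exists j; rewrite inE/= Cj eqxx.
apply: (@le_trans _ _ (\sum_(j | C j && bad i j)
    \sum_(h | C h && (cls h == cls j)) (#|cell j|)%:R^-1 * (A * q h))).
  apply: ler_sum => j /andP[Cj bij]; rewrite -mulr_sumr ler_pdivlMl ?cell_gt0//.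
  rewrite mulr_natl -sumr_const; apply: ler_sum => h /andP[Ch /eqP hj].
  by apply: qA => //; apply: bad_cls bij.
rewrite (exchange_big_dep C)/=; last by move=> j h _ /andP[].
rewrite mulr_sumr; apply: ler_sum => h Ch.
have [/existsP[j0 /and3P[Cj0 bj0 /eqP h0]]|/existsPn none] :=
   boolP [exists j, [&& C j, bad i j & cls h == cls j]]; last first.
  rewrite big_pred0 ?mulr_ge0 ?powR_ge0 ?(ltW (q0 _ Ch))// => j.
  move: (none j); rewrite Ch/= eq_sym; case: (C j) => //; case: (bad i j) => //=.
  by move/negbTE; rewrite eq_sym.
rewrite (eq_bigr (fun=> (#|cell h|)%:R^-1 * (A * q h))); last first.
  move=> j /andP[_ /andP[_ /eqP hj]]; congr (_%:R^-1 * _).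
  by apply: eq_card => l; rewrite !inE hj.
rewrite sumr_const -[leLHS]mulr_natl mulrA -[k0 * A * q h]mulrA.
rewrite ler_wpM2r ?mulr_ge0 ?powR_ge0 ?(ltW (q0 _ Ch))//.
rewrite ler_pdivrMr ?cell_gt0//.
have := cls_sparse Ci Cj0 bj0.
have -> : #|[pred h0 | C h0 && (cls h0 == cls j0)]| = #|cell h|.
  by apply: eq_card => l; rewrite !inE h0.
apply: le_trans; rewrite ler_nat; apply: subset_leq_card; apply/fintype.subsetP => l.
by rewrite !inE Ch h0/= eq_sym => /andP[/andP[-> ->] ->].
Qed.

(** The exponent [p / 2 - 1] may have either sign, so the ratio of two values of [t] in a class is
    bounded both ways, by [2 + 3 * Gam]. It is stated for a general space because the weights come
    from the source for [p <= 2] and from the target for [p >= 2]. *)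
Lemma class_t (W : lmodType R) (ipw : W -> W -> R) (Y : I -> W) (c : W) :
  is_inner_product ipw ->
  (forall i j, C i -> C j -> cls i != None -> cls i = cls j ->
     ipw (Y i - Y j) (Y i - Y j) <= Gam * s j) ->
  let t i := ipw (Y i - c) (Y i - c) + s i in
  (forall i, 0 < t i) /\
  forall i j, C i -> C j -> cls i != None -> cls i = cls j ->
     t i `^ (p / 2 - 1) <= A * t j `^ (p / 2 - 1).
Proof.
move=> ipwP YG t.
have t0 i : 0 < t i by rewrite ltr_wpDl ?ip_ge0.
split=> // i j Ci Cj iN ij.
have tt i1 j1 : C i1 -> C j1 -> cls i1 != None -> cls i1 = cls j1 ->
    t i1 <= (2 + 3 * Gam) * t j1.
  move=> Ci1 Cj1 iN1 ij1.
  have := ip_dist_le2 ipwP (Y i1) (Y j1) c.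
  have [_ _ sij] := cls_le Ci1 Cj1 iN1 ij1.
  have h := YG _ _ Ci1 Cj1 iN1 ij1.
  have := ip_ge0 ipwP (Y j1 - c); have := s_gt0 j1; rewrite /t => ? a0 ?.
  have : 0 <= Gam * ipw (Y j1 - c) (Y j1 - c) by rewrite mulr_ge0.
  lra.
have G1 : 1 <= 2 + 3 * Gam by move: Gam_ge0; lra.
have G0 : 0 < 2 + 3 * Gam by move: Gam_ge0; lra.
have [r0|r0] := leP 0 (p / 2 - 1).
  apply: (@le_trans _ _ (((2 + 3 * Gam) * t j) `^ (p / 2 - 1))).
    by apply: ge0_ler_powR; rewrite ?nnegrE ?mulr_ge0 ?(ltW (t0 _)) ?(ltW G0) ?tt.
  rewrite powRM ?(ltW (t0 _)) ?(ltW G0)// ler_wpM2r ?powR_ge0//.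
  by rewrite /A ler_powR//; move: p_ge1; lra.
have tji : t j <= (2 + 3 * Gam) * t i by apply: tt => //; rewrite -?ij.
have -> : p / 2 - 1 = - (1 - p / 2) by rewrite opprB.
rewrite !powRN ler_pdivlMr ?powR_gt0// mulrC ler_pdivrMr ?powR_gt0//.
apply: (@le_trans _ _ (((2 + 3 * Gam) * t i) `^ (1 - p / 2))).
  by apply: ge0_ler_powR; rewrite ?nnegrE ?mulr_ge0 ?(ltW (t0 _)) ?(ltW G0)//; move: p_ge1; lra.
rewrite powRM ?(ltW (t0 _)) ?(ltW G0)// ler_wpM2r ?powR_ge0//.
by rewrite /A ler_powR//; move: p_ge1; lra.
Qed.

Let kap := k0 * A.
Let al' := al + kap * B.

Lemma al'_ge1 : 1 <= al'.
Proof. by apply: (le_trans al_ge1); rewrite lerDl !mulr_ge0 ?powR_ge0. Qed.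

(** The power [p / 2] is concave, so its tangent at the source value [t i] bounds the target cost
    from above by a weighted sum of squares. The weights are known before the target center is
    chosen, and that center is simply their barycenter. *)
Lemma robust_le2 c : p <= 2 -> exists c',
  \sum_(i | C i) (ip' (X' i - c') (X' i - c') + s i) `^ (p / 2) <=
  al' `^ p * \sum_(i | C i) (ip (X i - c) (X i - c) + s i) `^ (p / 2).
Proof.
move=> p2; pose t i := ip (X i - c) (X i - c) + s i.
have [/existsP[i0 Ci0]|/existsPn nC] := boolP [exists i, C i]; last first.
  by exists 0; rewrite !big_pred0 ?mulr0// => i; apply/negbTE/nC.
have [t0 tA] := class_t c ipP (fun i j Ci Cj iN ij => let: And3 h _ _ := cls_le Ci Cj iN ij in h).
pose q i := t i `^ (p / 2 - 1).
have q0 i : C i -> 0 < q i by move=> _; rewrite powR_gt0// t0.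
have Q0 : 0 < \sum_(i | C i) q i.
  rewrite (bigD1 i0)//= ltr_pwDl ?q0// sumr_ge0// => i /andP[Ci _]; exact/ltW/q0.
have W := weighted_transfer c q0 Q0 (class_weights q0 tA) (erefl _).
set b' := barycenter C q X' in W; exists b'.
have r0 : 0 < p / 2 by move: p_ge1; lra.
have r1 : p / 2 <= 1 by lra.
apply: (@le_trans _ _ (\sum_(i | C i) (p / 2 * q i * (ip' (X' i - b') (X' i - b') + s i) + (1 - p / 2) * t i `^ (p / 2)))).
  apply: ler_sum => i Ci; apply: powR_tangent_le => //; first exact: t0.
  by rewrite addr_ge0 ?ip_ge0// ltW.
rewrite big_split/= -mulr_sumr.
set T := \sum_(i | C i) t i `^ (p / 2).
have qt i : q i * t i = t i `^ (p / 2).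
  by rewrite /q powRB1 ?t0// mulfVK// gt_eqF ?t0.
have TE : T = \sum_(i | C i) q i * ip (X i - c) (X i - c) + \sum_(i | C i) q i * s i.
  by rewrite -big_split; apply: eq_bigr => i _; rewrite -qt mulrDr.
have T1 : \sum_(i | C i) (p / 2 * q i * (ip' (X' i - b') (X' i - b') + s i)) <= p / 2 * (al' * T).
  under eq_bigr do rewrite -mulrA mulrDr.
  rewrite -mulr_sumr ler_pM2l// big_split/=.
  have S0 : 0 <= \sum_(i | C i) q i * s i.
    by apply: sumr_ge0 => i Ci; rewrite mulr_ge0 ?ltW ?q0.
  have N0 : 0 <= \sum_(i | C i) q i * ip (X i - c) (X i - c).
    by apply: sumr_ge0 => i Ci; rewrite mulr_ge0 ?ip_ge0// ltW ?q0.
  rewrite TE /al'; have := W.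
  set S1 := \sum_(i | C i) q i * ip' _ _; set S2 := \sum_(i | C i) q i * ip _ _ in N0 *.
  set S3 := \sum_(i | C i) q i * s i in S0 *.
  have h1 : 0 <= kap * B * S2 by rewrite !mulr_ge0 ?powR_ge0.
  have h2 : S3 <= al * S3 by rewrite ler_peMl.
  move: h1; rewrite /kap; lra.
have T0 : 0 <= T by apply: sumr_ge0 => i _; rewrite powR_ge0.
have a1 := al'_ge1.
apply: (@le_trans _ _ (al' * T)); last first.
  by rewrite ler_wpM2r//; apply: le1r_powR.
have : (1 - p / 2) * T <= (1 - p / 2) * (al' * T) by rewrite ler_wpM2l ?subr_ge0// ler_peMl.
lra.
Qed.

(** The power [p / 2] is convex, so the tangent has to be taken at the target values, whose weights
    depend on the target center. The center must thus be the barycenter for its own weights, which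
    [minimizer_barycenter] provides. The target cost then appears on both sides and is cancelled. *)
Lemma robust_ge2 c : 2 <= p -> exists c',
  \sum_(i | C i) (ip' (X' i - c') (X' i - c') + s i) `^ (p / 2) <=
  al' `^ p * \sum_(i | C i) (ip (X i - c) (X i - c) + s i) `^ (p / 2).
Proof.
move=> p2; pose t i := ip (X i - c) (X i - c) + s i.
have [/existsP[i0 Ci0]|/existsPn nC] := boolP [exists i, C i]; last first.
  by exists 0; rewrite !big_pred0 ?mulr0// => i; apply/negbTE/nC.
have r1 : 1 <= p / 2 by lra.
have r0 : 0 < p / 2 by lra.
have [c' c'E] := minimizer_barycenter ipP' X' s_gt0 r1 (ex_intro _ i0 Ci0).
have [t'0 t'A] := class_t c' ipP' (fun i j Ci Cj iN ij => let: And3 _ h _ := cls_le Ci Cj iN ij in h).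
pose t' i := ip' (X' i - c') (X' i - c') + s i.
have {}t'0 i : 0 < t' i by exact: t'0.
have t0 i : 0 <= t i by rewrite addr_ge0 ?ip_ge0// ltW.
pose q i := t' i `^ (p / 2 - 1).
have q0 i : C i -> 0 < q i by move=> _; rewrite powR_gt0// t'0.
have Q0 : 0 < \sum_(i | C i) q i.
  rewrite (bigD1 i0)//= ltr_pwDl ?q0// sumr_ge0// => i /andP[Ci _]; exact/ltW/q0.
have W := weighted_transfer c q0 Q0 (class_weights q0 t'A) c'E.
exists c'.
have a1 := al'_ge1; have a0 : 0 < al' by apply: lt_le_trans a1.
set T' := \sum_(i | C i) _; set T := \sum_(i | C i) t i `^ (p / 2).
have T'E : T' = \sum_(i | C i) q i * t' i.
  by apply: eq_bigr => i _; rewrite /q powRB1 ?t'0// mulfVK// gt_eqF ?t'0.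
have T'1 : T' <= \sum_(i | C i) q i * (al' * t i).
  rewrite T'E /t' /t; under eq_bigr do rewrite mulrDr.
  under [leRHS]eq_bigr do rewrite mulrCA mulrDr.
  rewrite -mulr_sumr !big_split/=.
  have S0 : 0 <= \sum_(i | C i) q i * s i.
    by apply: sumr_ge0 => i Ci; rewrite mulr_ge0 ?ltW ?q0.
  have N0 : 0 <= \sum_(i | C i) q i * ip (X i - c) (X i - c).
    by apply: sumr_ge0 => i Ci; rewrite mulr_ge0 ?ip_ge0// ltW ?q0.
  have := W.
  set S1 := \sum_(i | C i) q i * ip' _ _; set S2 := \sum_(i | C i) q i * ip _ _ in N0 *.
  set S3 := \sum_(i | C i) q i * s i in S0 *.
  have h1 : 0 <= kap * B * S2 by rewrite !mulr_ge0 ?powR_ge0.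
  have h2 : S3 <= al * S3 by rewrite ler_peMl.
  move: h1; rewrite /al' /kap; lra.
have T'2 : p / 2 * \sum_(i | C i) q i * (al' * t i) <=
    (p / 2 - 1) * T' + al' `^ (p / 2) * T.
  rewrite /T' /T !mulr_sumr -big_split/=; apply: ler_sum => i Ci.
  rewrite -(powRM _ (ltW a0) (t0 i)).
  have := powR_tangent_ge r1 (t'0 i) (mulr_ge0 (ltW a0) (t0 i)).
  have : q i * t' i = t' i `^ (p / 2).
    by rewrite /q powRB1 ?t'0// mulfVK// gt_eqF ?t'0.
  rewrite -/(t' i) -/(q i) => <-; lra.
have T'3 : T' <= al' `^ (p / 2) * T.
  have := ler_wpM2l (ltW r0) T'1; lra.
apply: (le_trans T'3); rewrite ler_wpM2r ?sumr_ge0// => [i _|]; first exact: powR_ge0.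
by rewrite ler_powR//; lra.
Qed.

Lemma robust_transfer c : exists c',
  \sum_(i | C i) (ip' (X' i - c') (X' i - c') + s i) `^ (p / 2) <=
  al' `^ p * \sum_(i | C i) (ip (X i - c) (X i - c) + s i) `^ (p / 2).
Proof. by have [/robust_le2|/ltW/robust_ge2] := leP p 2; exact. Qed.

End RobustTransfer.

Section ClusterStep.
Variables (R : realType) (W W' : lmodType R) (ip : W -> W -> R) (ip' : W' -> W' -> R).
Hypotheses (ipP : is_inner_product ip) (ipP' : is_inner_product ip').
Variables (I : finType) (G : eqType) (C : pred I) (Y : I -> W) (Y' : I -> W').
Variables (hat : I -> I) (surv : pred I) (rho : I -> R) (g : I -> G) (bad : rel I).
Variables (p e k0 : R).

Let h := e^-1.
Let d x y := hdist ip (Y x) (Y y).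
Let d' x y := hdist ip' (Y' x) (Y' y).

Hypotheses (p_ge1 : 1 <= p) (e_gt0 : 0 < e) (e_small : e <= 100^-1).
Hypotheses (rho_ge0 : forall x, 0 <= rho x) (k0_ge0 : 0 <= k0).
Hypothesis k0_le : k0 * (2 + 3 * h ^+ 11) `^ p * h ^+ 13 <= e.
Hypothesis hat_surv : forall x, surv x -> hat x = x.
Hypothesis bad_surv : forall x y, bad x y -> surv x && surv y.
Hypothesis good_pair : forall x y, C x -> C y -> ~~ bad x y ->
  d' (hat x) (hat y) <= (1 + 4 * e) * d (hat x) (hat y).
Hypothesis bad_pair : forall x y, bad x y -> d' x y <= 2 * h ^+ 2 * rho x.
Hypothesis class_pair : forall x y, surv x -> surv y -> g x = g y ->
  [/\ d x y <= 2 * h * rho y, d' x y <= 2 * h * rho y & rho x <= h * rho y].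
Hypothesis class_sparse : forall x y, C x -> C y -> bad x y ->
  (#|[pred z | [&& C z, surv z, g z == g y & bad x z]]|)%:R <=
   k0 * (#|[pred z | [&& C z, surv z & g z == g y]]|)%:R.

Let P1 := (1 + e) `^ p.
Let P2 := (1 + h) `^ p.
Let al := (1 + 10 * e) `^ p.

(** The points are moved along [hat] in the source, transferred by [robust_transfer], and moved back
    in the target. The unbalanced inequality [powR_add_le] puts the large factor [P2] on the moving
    costs and the regularizer only; the main term gets powers of [1 + e] and [1 + 10 * e]. *)
Lemma cluster_step c xi : 0 < xi -> exists c',
  \sum_(x | C x) hdist ip' (Y' x) c' `^ p <=
  P1 ^+ 3 * al * (\sum_(x | C x) hdist ip (Y x) c `^ p) +
  P1 ^+ 2 * P2 * al * (\sum_(x | C x && ~~ surv x) d x (hat x) `^ p +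
    \sum_(x | C x && ~~ surv x) d' x (hat x) `^ p +
    \sum_(x | C x) (e ^+ 4 * rho x) `^ p) + xi.
Proof.
move=> xi0.
have es := e_small; have eg := e_gt0; have pg := p_ge1; have kg := k0_ge0.
have h_ge : 100 <= h by rewrite -[100]invrK lef_pV2 ?posrE ?invr_gt0.
have h0 : 0 < h by lra.
have he : h * e = 1 by rewrite mulVf ?gt_eqF.
have p0 : 0 <= p by lra.
have P1_ge1 : 1 <= P1 by rewrite -[leLHS](powRr0 (1 + e)) ler_powR; lra.
have P2_ge1 : 1 <= P2 by rewrite -[leLHS](powRr0 (1 + h)) ler_powR; lra.
have al_ge1 : 1 <= al by rewrite -[leLHS](powRr0 (1 + 10 * e)) ler_powR; lra.
pose M := P1 * P2 ^+ 2 * al * (#|[pred x | C x]|)%:R.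
have M0 : 0 <= M by rewrite !mulr_ge0 ?exprn_ge0 ?ler0n//; lra.
(* [vs] only keeps the regularizer positive where [rho] gives nothing. Its total contribution is
   [M * vs ^ p], and the cap at 1 gives [vs ^ p <= vs]. *)
pose vs := Num.min 1 (xi / (M + 1)).
have vs0 : 0 < vs by rewrite lt_min ltr01 divr_gt0//; lra.
have vsM : M * vs `^ p <= xi.
  have vs1 : vs `^ p <= vs.
    by apply: ge1r_powR => //; rewrite vs0 /vs ge_min lexx.
  apply: (@le_trans _ _ (M * (xi / (M + 1)))).
    by rewrite ler_wpM2l// (le_trans vs1)// /vs ge_min lexx orbT.
  rewrite mulrCA ger_pMr// ler_pdivrMr; lra.
pose srho x := if surv x then rho x else 0.
(* The multiple [e ^+ 4] of [rho] is negligible in the cost, yet up to powers of [h] it dominates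
   the distances in bad pairs and in classes. *)
pose sq x := e ^+ 4 * srho x + vs.
have srho0 x : 0 <= srho x by rewrite /srho; case: ifP.
have e40 : 0 < e ^+ 4 by rewrite exprn_gt0.
have sq0 x : 0 < sq x by rewrite ltr_wpDl// mulr_ge0// ltW.
have sqrho x : surv x -> rho x <= h ^+ 4 * sq x.
  move=> sx; rewrite /sq /srho sx mulrDr mulrA -exprMn he expr1n mul1r lerDl.
  by rewrite mulr_ge0 ?exprn_ge0// ltW.
pose cls x := if surv x then Some (g x) else None.
have clsE x y : (cls x != None) && (cls x == cls y) = [&& surv x, surv y & g x == g y].
  by rewrite /cls; case: (surv x); case: (surv y).
have dsq (T : lmodType R) (i : T -> T -> R) u w b : is_inner_product i -> 0 <= b ->
    hdist i u w <= b -> i (u - w) (u - w) <= b ^+ 2.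
  by move=> iP b0 ub; rewrite -hdist_sqr// ler_sqr ?nnegrE ?hdist_ge0.
have aE : 1 <= (1 + 4 * e) ^+ 2 by apply: exprn_ege1; lra.
(* Survivors satisfy [rho x <= h ^+ 4 * sq x]. A bad pair thus has squared target distance at most
   [(2 h^6 sq)^2 = 4 h^12 sq^2 <= h^13 sq^2], and two members of a class have squared distances at
   most [(2 h^5 sq)^2 <= h^11 sq^2]. *)
have [||||||||c' c'P] := @robust_transfer R W W' ip ip' ipP ipP' I C (Y \o hat) (Y' \o hat)
  (fun x => sq x ^+ 2) bad ((1 + 4 * e) ^+ 2) (h ^+ 13) _ aE _ _ _ _ cls (h ^+ 11) k0 p p_ge1
   _ k0_ge0 _ _ _ c.
- by move=> x; rewrite exprn_gt0.
- by rewrite exprn_ge0// ltW.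
- move=> x y Cx Cy nb /=; rewrite -(hdist_sqr ipP) -exprMn; apply: dsq => //.
    by rewrite mulr_ge0 ?hdist_ge0//; lra.
  exact: good_pair.
- move=> x y Cx Cy bxy /=; have /andP[sx sy] := bad_surv bxy.
  rewrite !hat_surv//; apply: (@le_trans _ _ ((h ^+ 6 * 2 * sq x) ^+ 2)).
    apply: dsq => //; first by rewrite !mulr_ge0 ?exprn_ge0 ?ltW.
    apply: (le_trans (bad_pair bxy)).
    have := ler_wpM2l (exprn_ge0 2 (ltW h0)) (sqrho x sx).
    by rewrite mulrA -exprD; lra.
  have -> : (h ^+ 6 * 2 * sq x) ^+ 2 = h ^+ 12 * (4 * sq x ^+ 2) by ring.
  rewrite (exprSr h 12) -[leRHS]mulrA ler_wpM2l ?exprn_ge0 ?(ltW h0)//.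
  by rewrite ler_wpM2r ?sqr_ge0//; lra.
- by rewrite exprn_ge0// ltW.
- by move=> x y Cx Cy /bad_surv/andP[_ sy]; rewrite /cls sy.
- move=> x y Cx Cy xN /eqP xy.
  have /and3P[sx sy /eqP gxy] : [&& surv x, surv y & g x == g y] by rewrite -clsE xN xy.
  have [h1 h2 h3] := class_pair sx sy gxy; rewrite /= !hat_surv//.
  have hh : (h ^+ 5 * 2 * sq y) ^+ 2 <= h ^+ 11 * sq y ^+ 2.
    have -> : (h ^+ 5 * 2 * sq y) ^+ 2 = h ^+ 10 * (4 * sq y ^+ 2) by ring.
    rewrite (exprSr h 10) -[leRHS]mulrA ler_wpM2l ?exprn_ge0 ?(ltW h0)//.
    by rewrite ler_wpM2r ?sqr_ge0//; lra.
  have hb : 2 * h * rho y <= h ^+ 5 * 2 * sq y.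
    by have := ler_wpM2l (ltW h0) (sqrho y sy); rewrite mulrA -exprS; lra.
  have hb0 : 0 <= h ^+ 5 * 2 * sq y by rewrite !mulr_ge0 ?exprn_ge0 ?ltW.
  split; first by apply: le_trans hh; apply: dsq => //; exact: le_trans hb.
    by apply: le_trans hh; apply: dsq => //; exact: le_trans hb.
  have : sq x <= h * sq y.
    rewrite /sq /srho sx sy mulrDr lerD//; last by rewrite ler_peMl ?ltW//; lra.
    by rewrite mulrCA ler_pM2l.
  move=> sxy; apply: (@le_trans _ _ ((h * sq y) ^+ 2)).
    by rewrite ler_sqr ?nnegrE ?mulr_ge0 ?(ltW h0) ?(ltW (sq0 _)).
  rewrite exprMn ler_wpM2r ?sqr_ge0// ler_weXn2l//; lra.
- move=> x y Cx Cy bxy; have /andP[sx sy] := bad_surv bxy.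
  have E z : (cls z == cls y) = surv z && (g z == g y).
    by rewrite /cls sy; case: (surv z).
  have -> : #|[pred z | C z && (cls z == cls y) & bad x z]| =
            #|[pred z | [&& C z, surv z, g z == g y & bad x z]]|.
    by apply: eq_card => z; rewrite !inE E -!andbA.
  have -> : #|[pred z | C z & cls z == cls y]| = #|[pred z | [&& C z, surv z & g z == g y]]|.
    by apply: eq_card => z; rewrite !inE E.
  exact: class_sparse Cx Cy bxy.
exists c'.
have alle : ((1 + 4 * e) ^+ 2 + k0 * (2 + 3 * h ^+ 11) `^ p * h ^+ 13) `^ p <= al.
  apply: ge0_ler_powR; rewrite ?nnegrE//.
  - by rewrite addr_ge0 ?sqr_ge0// !mulr_ge0 ?powR_ge0 ?exprn_ge0// ltW.
  - by lra.
  - by apply: (le_trans (lerD (lexx _) k0_le)); rewrite expr2; nra.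
set S := \sum_(x | C x) hdist ip (Y x) c `^ p.
set Rm := \sum_(x | C x && ~~ surv x) d x (hat x) `^ p.
set Rm' := \sum_(x | C x && ~~ surv x) d' x (hat x) `^ p.
set Tau := \sum_(x | C x) (e ^+ 4 * rho x) `^ p.
have move_le (T : lmodType R) (i : T -> T -> R) (Z : I -> T) (f f' : I -> I) u :
    is_inner_product i -> (forall x, surv x -> f x = f' x) ->
    \sum_(x | C x) hdist i (Z (f x)) u `^ p <=
    P1 * (\sum_(x | C x) hdist i (Z (f' x)) u `^ p) +
    P2 * (\sum_(x | C x && ~~ surv x) hdist i (Z (f x)) (Z (f' x)) `^ p).
  move=> iP ff'; rewrite [X in _ + P2 * X]big_mkcondr/= !mulr_sumr -big_split/=.
  apply: ler_sum => x Cx; case: ifPn => sx; last first.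
    rewrite mulr0 addr0 ff'; last by rewrite -[surv x]negbK.
    by rewrite ler_peMl ?powR_ge0.
  apply: (@le_trans _ _ ((hdist i (Z (f' x)) u + hdist i (Z (f x)) (Z (f' x))) `^ p)).
    apply: ge0_ler_powR; rewrite ?nnegrE ?addr_ge0 ?hdist_ge0//.
    by rewrite addrC hdist_tri.
  by have := powR_add_le p0 e_gt0 (hdist_ge0 i (Z (f' x)) u) (hdist_ge0 i (Z (f x)) (Z (f' x))).
have S1 : \sum_(x | C x) hdist ip (Y (hat x)) c `^ p <= P1 * S + P2 * Rm.
  have := move_le _ ip Y hat id c ipP hat_surv.
  have -> // : Rm = \sum_(x | C x && ~~ surv x) hdist ip (Y (hat x)) (Y x) `^ p.
  by apply: eq_bigr => x _; rewrite /d (hdistC ipP).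
have S2 : \sum_(x | C x) hdist ip' (Y' x) c' `^ p <=
    P1 * (\sum_(x | C x) hdist ip' (Y' (hat x)) c' `^ p) + P2 * Rm'.
  exact: (move_le _ ip' Y' id hat c' ipP' (fun x sx => esym (hat_surv sx))).
have S3 : \sum_(x | C x) (ip (Y (hat x) - c) (Y (hat x) - c) + sq x ^+ 2) `^ (p / 2) <=
   P1 * (\sum_(x | C x) hdist ip (Y (hat x)) c `^ p) + P2 * (P1 * Tau + P2 *
     ((#|[pred x | C x]|)%:R * vs `^ p)).
  rewrite /Tau mulr_natl -sumr_const !mulr_sumr -!big_split/= mulr_sumr -big_split/=.
  apply: ler_sum => x Cx.
  apply: (@le_trans _ _ ((hdist ip (Y (hat x)) c + sq x) `^ p)).
    have D0 := hdist_ge0 ip (Y (hat x)) c.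
    have -> : (hdist ip (Y (hat x)) c + sq x) `^ p =
       ((hdist ip (Y (hat x)) c + sq x) ^+ 2) `^ (p / 2).
      rewrite -(@powR_mulrn _ _ 2 (addr_ge0 D0 (ltW (sq0 x)))) -powRrM.
      by rewrite mulrCA mulfV// mulr1.
    apply: ge0_ler_powR; rewrite ?nnegrE ?addr_ge0 ?sqr_ge0 ?ip_ge0//; first by lra.
    rewrite [leRHS]sqrrD (hdist_sqr ipP) lerD2r lerDl mulrn_wge0// mulr_ge0// ltW//.
  apply: (le_trans (powR_add_le p0 e_gt0 (hdist_ge0 _ _ _) (ltW (sq0 x)))).
  rewrite lerD2l ler_wpM2l ?powR_ge0//.
  apply: (le_trans (powR_add_le p0 e_gt0 (mulr_ge0 (ltW e40) (srho0 x)) (ltW vs0))).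
  rewrite lerD2r ler_wpM2l ?powR_ge0//; apply: ge0_ler_powR; rewrite ?nnegrE//.
  - exact: mulr_ge0 (ltW e40) (srho0 x).
  - exact: mulr_ge0 (ltW e40) (rho_ge0 x).
  - by rewrite ler_pM2l// /srho; case: ifP.
have S4 : \sum_(x | C x) hdist ip' (Y' (hat x)) c' `^ p <=
    al * \sum_(x | C x) (ip (Y (hat x) - c) (Y (hat x) - c) + sq x ^+ 2) `^ (p / 2).
  apply: (@le_trans _ _ (\sum_(x | C x) (ip' (Y' (hat x) - c') (Y' (hat x) - c') + sq x ^+ 2) `^ (p / 2))).
    apply: ler_sum => x Cx; rewrite hdist_powR//.
    apply: ge0_ler_powR; rewrite ?nnegrE; [lra|exact: ip_ge0| |by rewrite lerDl sqr_ge0].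
    exact: addr_ge0 (ip_ge0 ipP' _) (sqr_ge0 _).
  apply: (le_trans c'P); rewrite ler_wpM2r// sumr_ge0// => x _; exact: powR_ge0.
apply: (le_trans S2).
have Rm'0 : 0 <= Rm' by apply: sumr_ge0 => x _; exact: powR_ge0.
have P10 : 0 <= P1 := le_trans ler01 P1_ge1.
have al0 : 0 <= al := le_trans ler01 al_ge1.
have P20 : 0 <= P2 := le_trans ler01 P2_ge1.
have S5 := ler_wpM2l P10 (le_trans S4 (ler_wpM2l al0 (le_trans S3 (lerD (ler_wpM2l P10 S1) (lexx _))))).
have S6 : P2 * Rm' <= P1 ^+ 2 * P2 * al * Rm'.
  rewrite ler_wpM2r// mulrAC ler_peMl// -[1]mulr1 ler_pM// expr_ge1//.
apply: (le_trans (lerD S5 S6)).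
rewrite -[leRHS]addrA.
have -> : P1 ^+ 3 * al * S + (P1 ^+ 2 * P2 * al * (Rm + Rm' + Tau) + xi) =
  P1 * (al * (P1 * (P1 * S + P2 * Rm) + P2 * (P1 * Tau + P2 *
     ((#|[pred x | C x]|)%:R * vs `^ p)))) + P1 ^+ 2 * P2 * al * Rm' + (xi - M * vs `^ p).
  by rewrite /M; ring.
by rewrite lerDl subr_ge0.
Qed.

End ClusterStep.

(** * Clusterings and medoids *)

Definition partition_cost (R : realType) (V : lmodType R) (ip : V -> V -> R)
    (I J : finType) (X : I -> V) (sigma : I -> J) (p : R) : R :=
  \sum_j inf [set \sum_(x | sigma x == j) hdist ip (X x) c `^ p | c in [set: V]].

Section PartitionCost.
Variables (R : realType) (V V' : lmodType R) (ip : V -> V -> R) (ip' : V' -> V' -> R).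
Variables (I J : finType) (X : I -> V) (X' : I -> V') (sigma : I -> J) (p : R).

Let costs (W : lmodType R) (i : W -> W -> R) (Y : I -> W) j :=
  [set \sum_(x | sigma x == j) hdist i (Y x) c `^ p | c in [set: W]].

Let costs_inf (W : lmodType R) (i : W -> W -> R) (Y : I -> W) j : has_inf (costs i Y j).
Proof.
split; first by exists (\sum_(x | sigma x == j) hdist i (Y x) 0 `^ p), 0.
by exists 0 => _ [c _ <-]; apply: sumr_ge0 => x _; exact: powR_ge0.
Qed.

Lemma partition_cost_ge_sum (B : J -> R) :
  (forall j c, B j <= \sum_(x | sigma x == j) hdist ip (X x) c `^ p) ->
  \sum_j B j <= partition_cost ip X sigma p.
Proof.
move=> cB; apply: ler_sum => j _; apply: lb_le_inf; first by case: (costs_inf ip X j).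
by move=> _ [c _ <-].
Qed.

Lemma partition_cost_ge0 : 0 <= partition_cost ip X sigma p.
Proof.
apply: sumr_ge0 => j _; apply: lb_le_inf; first by case: (costs_inf ip X j).
by move=> _ [c _ <-]; apply: sumr_ge0 => x _; exact: powR_ge0.
Qed.

Lemma partition_cost_le (A : R) (B : J -> R) : 0 < A ->
  (forall j c xi, 0 < xi -> exists c',
     \sum_(x | sigma x == j) hdist ip' (X' x) c' `^ p <=
     A * (\sum_(x | sigma x == j) hdist ip (X x) c `^ p) + B j + xi) ->
  partition_cost ip' X' sigma p <= A * partition_cost ip X sigma p + \sum_j B j.
Proof.
move=> A0 cB; rewrite mulr_sumr -big_split/=; apply: ler_sum => j _.
apply/ler_addgt0Pr => xi xi0.
have xiA : 0 < xi / (2 * A) by rewrite divr_gt0// mulr_gt0.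
have [_ [c _ <-] /ltW cP] := inf_adherent xiA (costs_inf ip X j).
have [c' c'P] := cB j c (xi / 2) (divr_gt0 xi0 (ltr0Sn _ _)).
apply: (@le_trans _ _ (\sum_(x | sigma x == j) hdist ip' (X' x) c' `^ p)).
  by apply: ge_inf; [case: (costs_inf ip' X' j)|exists c'].
apply: (le_trans c'P).
have := ler_wpM2l (ltW A0) cP; rewrite mulrDr.
have -> : A * (xi / (2 * A)) = xi / 2 by field; rewrite gt_eqF.
lra.
Qed.

End PartitionCost.

Lemma int_dist_le1 (i j : int) : i < j + 1 + 1 -> j < i + 1 + 1 ->
  j - i \in [:: -1; 0; 1].
Proof. rewrite !inE; lia. Qed.

Section Clustering.
Variables (R : realType) (V V' : lmodType R) (ip : V -> V -> R) (ip' : V' -> V' -> R).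
Hypotheses (ipP : is_inner_product ip) (ipP' : is_inner_product ip').
Variables (I J : finType) (X : I -> V) (X' : I -> V') (s : J -> I) (a : I -> J).
Variables (v : I -> I -> R) (p e beta theta : R).

Let h := e^-1.
Let d x y := hdist ip (X x) (X y).
Let d' x y := hdist ip' (X' x) (X' y).

Definition center_dist x := d x (s (a x)).
Let rho := center_dist.

Definition scale x : int := Num.floor (ln (rho x) / ln h).
(* The boolean separates the centers themselves, for which [ln 0 = 0] makes the
   scale meaningless. *)
Definition group x : J * bool * int := (a x, 0 < rho x, scale x).
Let g := group.

Definition group_size q : R := (#|[pred y | g y == q]|)%:R.

(* Besides the centers, only the groups at a scale comparable to that of [x] matter:
   the other points are represented by their centers, or [x] is by its own. *)
Definition defect x :=
  \sum_j v x (s j) +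
  beta^-1 * \sum_j \sum_(o <- [:: -1; 0; 1]) (group_size (j, true, scale x + o))^-1 *
     \sum_(y | g y == (j, true, scale x + o)) v x y.

(** A point with [rho x = 0] can be moved to its center at no cost, and its scale carries no
    information. *)
Definition fine_point x := (defect x <= 1) && (0 < rho x).

Hypotheses (p_ge1 : 1 <= p) (e_gt0 : 0 < e) (e_small : e <= 100^-1).
Hypotheses (beta_gt0 : 0 < beta) (theta_gt0 : 0 < theta).
Hypothesis nearest : forall x j, rho x <= d x (s j).
Hypothesis v_ge0 : forall x y, 0 <= v x y.
Hypothesis v_ok : forall x y, v x y <= 1 -> (1 - e) * d x y <= d' x y <= (1 + e) * d x y.
Hypothesis v_pow : forall x y, d' x y `^ p <= 2 * (1 + v x y) * d x y `^ p.
Hypothesis centers_ok : forall j j', v (s j) (s j') <= 1.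

Let h_ge : 100 <= h.
Proof. by rewrite -[100]invrK lef_pV2 ?posrE ?invr_gt0. Qed.

Let h_gt0 : 0 < h. Proof. by rewrite invr_gt0. Qed.

Let he : h * e = 1. Proof. by rewrite mulVf ?gt_eqF. Qed.

Let rho_ge0 x : 0 <= rho x. Proof. exact: hdist_ge0. Qed.

Let d_ge0 x y : 0 <= d x y. Proof. exact: hdist_ge0. Qed.

Let d'_ge0 x y : 0 <= d' x y. Proof. exact: hdist_ge0. Qed.

(** Symmetric in the two spaces, so that one argument transfers centers both ways. The tolerance
    [4 * e] leaves room for replacing a point by its center in [far_pair]. *)
Definition ok_pair x y := (d' x y <= (1 + 4 * e) * d x y) && (d x y <= (1 + 4 * e) * d' x y).

Let ok_pairC x y : ok_pair x y = ok_pair y x.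
Proof. by rewrite /ok_pair /d /d' (hdistC ipP) (hdistC ipP'). Qed.

Let v_ok_pair x y : v x y <= 1 -> ok_pair x y.
Proof.
move=> /v_ok /andP[h1 h2]; have := d_ge0 x y; have := e_small; have := e_gt0 => eg es d0.
have de : 0 <= e * d x y by rewrite mulr_ge0// ltW.
have de2 : e * (e * d x y) <= 100^-1 * (e * d x y) by rewrite ler_wpM2r.
apply/andP; split; first by lra.
have : (1 + 4 * e) * ((1 - e) * d x y) <= (1 + 4 * e) * d' x y by rewrite ler_wpM2l//; lra.
lra.
Qed.

(* When [y] is much closer to its center than [x] is, the center stands for [y]. *)
Let far_pair x y : v x (s (a y)) <= 1 -> v y (s (a y)) <= 1 ->
  h * rho y <= d x (s (a y)) -> ok_pair x y.
Proof.
move=> /v_ok/andP[D1 D2] /v_ok/andP[_ r2] hr.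
have eg := e_gt0; have es := e_small.
set c := s (a y) in D1 D2 r2 hr.
have r_le : rho y <= e * d x c.
  by rewrite -(ler_pM2l h_gt0) mulrA he mul1r.
have T1 : d x y <= d x c + rho y by rewrite /rho /center_dist -/c /d (hdistC ipP (X y)) hdist_tri.
have T2 : d x c <= d x y + rho y by rewrite /rho /center_dist -/c /d hdist_tri.
have T3 : d' x y <= d' x c + d' y c by rewrite /d' (hdistC ipP' (X' y)) hdist_tri.
have T4 : d' x c <= d' x y + d' y c by rewrite /d' hdist_tri.
have D0 := d_ge0 x c.
have r2' : d' y c <= (1 + e) * rho y by [].
have eD : 0 <= e * d x c by rewrite mulr_ge0// ltW.
have eD2 : e * (e * d x c) <= 100^-1 * (e * d x c) by rewrite ler_wpM2r.
have er : e * rho y <= e * (e * d x c) by rewrite ler_wpM2l// ltW.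
have eD20 : 0 <= e * (e * d x c) by rewrite mulr_ge0// ltW.
have eD3 : e * (e * (e * d x c)) <= 100^-1 * (e * (e * d x c)) by rewrite ler_wpM2r.
apply/andP; split.
  have : (1 + 4 * e) * ((1 - e) * d x c) <= (1 + 4 * e) * d x y by rewrite ler_wpM2l//; lra.
  lra.
have : (1 + 4 * e) * ((1 - 2 * e) * d x c - e * (e * d x c)) <= (1 + 4 * e) * d' x y.
  by rewrite ler_wpM2l//; lra.
lra.
Qed.

Let defect_center x j : defect x <= 1 -> v x (s j) <= 1.
Proof.
apply: le_trans; rewrite /defect (bigD1 j)//= -addrA lerDl addr_ge0 ?sumr_ge0//.
rewrite mulr_ge0 ?invr_ge0 ?(ltW beta_gt0)// sumr_ge0// => i _.
by rewrite sumr_ge0// => o _; rewrite mulr_ge0 ?invr_ge0 ?ler0n ?sumr_ge0.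
Qed.

Let defect_group x j o : defect x <= 1 -> o \in [:: -1; 0; 1 : int] ->
  \sum_(y | g y == (j, true, scale x + o)) v x y <=
  beta * group_size (j, true, scale x + o).
Proof.
move=> Ux oin; set q := (j, true, scale x + o).
have [|q0] := leP (group_size q) 0.
  rewrite lern0 => /eqP/card0_eq q0; rewrite big_pred0; last first.
    by move=> y; have := q0 y; rewrite inE.
  by rewrite mulr_ge0 ?ler0n ?(ltW beta_gt0).
rewrite mulrC -ler_pdivrMl// -[beta]invrK -[_^-1^-1]mulr1 ler_pdivlMl ?invr_gt0//.
apply: le_trans Ux; rewrite /defect -[leLHS]add0r lerD ?sumr_ge0//.
rewrite ler_pM2l ?invr_gt0// (bigD1 j)//= (bigD1_seq o)//= -addrA lerDl addr_ge0//.
  by rewrite sumr_ge0// => o' _; rewrite mulr_ge0 ?invr_ge0 ?ler0n ?sumr_ge0.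
rewrite sumr_ge0// => i _.
by rewrite sumr_ge0// => o' _; rewrite mulr_ge0 ?invr_ge0 ?ler0n ?sumr_ge0.
Qed.

Let lnh_gt0 : 0 < ln h. Proof. by rewrite ln_gt0// (lt_le_trans _ h_ge)// ltr1n. Qed.


Let scale_bound x : 0 < rho x ->
  (scale x)%:~R * ln h <= ln (rho x) < (scale x + 1)%:~R * ln h.
Proof. by move=> x0; rewrite -ler_pdivlMr// -ltr_pdivrMr//; exact: floor_itv. Qed.

Let group_rho x y : 0 < rho x -> g x = g y -> rho x <= h * rho y.
Proof.
move=> x0 [_ y0 sxy]; rewrite x0 in y0; symmetry in y0.
rewrite -ler_ln ?posrE ?mulr_gt0// lnM ?posrE//.
have /andP[_ b1] := scale_bound x0; have /andP[b2 _] := scale_bound y0.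
rewrite sxy intrD mulrDl mul1r in b1; lra.
Qed.

Variable sigma : I -> J.

Let cell x := [pred y | [&& sigma y == sigma x, g y == g x & fine_point y]].

(* A cell that is small compared to its group need not inherit the sparsity of the
   distorted pairs of the group. *)
Definition kept x := fine_point x && (theta * group_size (g x) <= (#|cell x|)%:R).

Definition moved x := if kept x then x else s (a x).

Let bad x y := [&& kept x, kept y & ~~ ok_pair x y].

Let kept_fine x : kept x -> defect x <= 1 /\ 0 < rho x.
Proof. by case/andP => /andP[]. Qed.

Let bad_dist x y : bad x y -> d x (s (a y)) < h * rho y /\ d y (s (a x)) < h * rho x.
Proof.
case/and3P => kx ky nok; have [ux _] := kept_fine kx; have [uy _] := kept_fine ky.
split; rewrite ltNge; apply: contra nok => far.
  by apply: far_pair => //; exact: defect_center.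
by rewrite ok_pairC; apply: far_pair => //; exact: defect_center.
Qed.

Let bad_rho x y : bad x y -> rho x < h * rho y /\ rho y < h * rho x.
Proof. by move=> /bad_dist[h1 h2]; split; [exact: le_lt_trans h1|exact: le_lt_trans h2]. Qed.

(** By [bad_rho] the two distances to the centers differ by less than the factor [h], so the floors
    of their logarithms to base [h] differ by at most 1. This is the origin of the three offsets in
    [defect]. *)
Let bad_scale x y : bad x y -> exists2 o, o \in [:: -1; 0; 1 : int] &
  g y = (a y, true, scale x + o).
Proof.
move=> bxy; have [r1 r2] := bad_rho bxy.
case/and3P : bxy => /kept_fine[_ x0] /kept_fine[_ y0] _.
exists (scale y - scale x); last by rewrite /g /group y0 addrCA subrr addr0.
have /andP[x1 x2] := scale_bound x0; have /andP[y1 y2] := scale_bound y0.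
rewrite -ltr_ln ?posrE ?mulr_gt0// lnM ?posrE// in r1.
rewrite -ltr_ln ?posrE ?mulr_gt0// lnM ?posrE// in r2.
have s1 : scale x < scale y + 1 + 1.
  rewrite -(ltr_int R) -(ltr_pM2r lnh_gt0) (intrD _ _ 1) mulrDl mul1r; lra.
have s2 : scale y < scale x + 1 + 1.
  rewrite -(ltr_int R) -(ltr_pM2r lnh_gt0) (intrD _ _ 1) mulrDl mul1r; lra.
exact: int_dist_le1.
Qed.

Let defect_ge0 x : 0 <= defect x.
Proof.
rewrite addr_ge0 ?sumr_ge0// mulr_ge0 ?invr_ge0 ?(ltW beta_gt0)// sumr_ge0// => i _.
by rewrite sumr_ge0// => o _; rewrite mulr_ge0 ?invr_ge0 ?ler0n ?sumr_ge0.
Qed.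

Let dist_h x y z b : z <= h * b -> 0 <= b ->
  d x y <= z + b -> d' x y <= (1 + e) * (z + b) ->
  d x y <= 2 * h * b /\ d' x y <= 2 * h * b.
Proof.
move=> zb b0 h1 h2; have eg := e_gt0; have es := e_small; have hg := h_ge.
have b1 : 100 * b <= h * b by rewrite ler_wpM2r.
have e1 : (1 + e) * (z + b) <= (1 + e) * (h * b + b) by rewrite ler_wpM2l; lra.
have e2 : e * b <= 100^-1 * b by rewrite ler_wpM2r.
have e3 : e * (h * b) = b by rewrite mulrA [e * h]mulrC he mul1r.
by split; lra.
Qed.

Let bad_le x y : bad x y -> d x y <= 2 * h ^+ 2 * rho x /\ d' x y <= 2 * h ^+ 2 * rho x.
Proof.
move=> bxy; have [D1 _] := bad_dist bxy; have [_ r2] := bad_rho bxy.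
case/and3P : bxy => /kept_fine[ux x0] /kept_fine[uy y0] _.
have /v_ok/andP[_ X1] := defect_center (a y) ux.
have /v_ok/andP[_ Y1] := defect_center (a y) uy.
have [] := @dist_h x y _ _ (ltW D1) (ltW y0).
- by rewrite /rho /center_dist /d (hdistC ipP (X y)) hdist_tri.
- rewrite mulrDr; apply: le_trans (lerD X1 Y1).
  by rewrite /d' (hdistC ipP' (X' y)) hdist_tri.
have : 2 * h * rho y <= 2 * h * (h * rho x) by rewrite ler_pM2l ?mulr_gt0// ltW.
have -> : 2 * h * (h * rho x) = 2 * h ^+ 2 * rho x by ring.
by move=> H h1 h2; split; apply: le_trans H.
Qed.

Let class_le x y : kept x -> kept y -> g x = g y ->
  [/\ d x y <= 2 * h * rho y, d' x y <= 2 * h * rho y & rho x <= h * rho y].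
Proof.
move=> /kept_fine[ux x0] /kept_fine[uy y0] gxy.
have r := group_rho x0 gxy.
have axy : a x = a y by case: gxy.
have /v_ok/andP[_ X1] := defect_center (a x) ux.
have /v_ok/andP[_ Y1] := defect_center (a y) uy.
have [||h1 h2] := @dist_h x y _ _ r (ltW y0); last by split.
- by rewrite /rho /center_dist axy /d (hdistC ipP (X y)) hdist_tri.
- rewrite mulrDr; apply: le_trans (lerD X1 Y1).
  by rewrite axy /d' (hdistC ipP' (X' y)) hdist_tri.
Qed.

Let good_le x y : ~~ bad x y -> ok_pair (moved x) (moved y).
Proof.
rewrite /bad /moved; have [kx|kx] := boolP (kept x); have [ky|ky] := boolP (kept y) => /=.
- by rewrite negbK.
- by move=> _; apply/v_ok_pair/defect_center; case: (kept_fine kx).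
- by move=> _; rewrite ok_pairC; apply/v_ok_pair/defect_center; case: (kept_fine ky).
- by move=> _; exact/v_ok_pair/centers_ok.
Qed.

(** A bad partner [z] of [x] has [v x z > 1], so [defect x <= 1] allows at most the fraction [beta]
    of the whole group of [y]. As [y] is kept, its cell has at least the fraction [theta] of that
    group, and all points of the cell are kept with it. *)
Let class_sparse l x y : sigma x == l -> sigma y == l -> bad x y ->
  (#|[pred z | [&& sigma z == l, kept z, g z == g y & bad x z]]|)%:R <=
  beta / theta * (#|[pred z | [&& sigma z == l, kept z & g z == g y]]|)%:R.
Proof.
move=> _ /eqP sy bxy; have [w win gy] := bad_scale bxy.
case/and3P : (bxy) => kx ky _; have [ux _] := kept_fine kx.
apply: (@le_trans _ _ (beta * group_size (g y))).
  rewrite [X in group_size X]gy; apply: le_trans (defect_group (a y) ux win).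
  apply: (@le_trans _ _ (\sum_(z | [&& sigma z == l, kept z, g z == g y & bad x z]) 1)).
    by rewrite -sum1_card natr_sum.
  rewrite -gy [leRHS]big_mkcond/= [leLHS]big_mkcond/=; apply: ler_sum => z _.
  case: ifPn => [/and4P[_ _ -> /and3P[_ _ nok]]|_]; last by case: ifP.
  by rewrite leNgt; apply: contra nok => /ltW /v_ok_pair.
rewrite -mulrA ler_pM2l// mulrC ler_pdivlMr// mulrC.
case/andP : (ky) => _ /le_trans; apply; rewrite ler_nat.
apply/subset_leq_card/fintype.subsetP => z; rewrite !inE => /and3P[/eqP sz /eqP gz fz].
rewrite sz sy eqxx/= gz eqxx andbT /kept fz gz /=.
case/andP : ky => _ /le_trans; apply; rewrite ler_nat.
by apply/subset_leq_card/fintype.subsetP => t; rewrite !inE sz gz.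
Qed.

Let E := \sum_x rho x `^ p * defect x + (#|J|)%:R * theta * h `^ p * \sum_x rho x `^ p.

Let small x := fine_point x && ((#|cell x|)%:R < theta * group_size (g x)).

(** Each summand is averaged over the group of [x], where [rho] varies by at most the factor [h]. A
    group has at most one small cell per cluster, each with less than the fraction [theta] of its
    points. *)
Let sum_small : \sum_(x | small x) rho x `^ p <=
  (#|J|)%:R * theta * h `^ p * \sum_x rho x `^ p.
Proof.
have gs0 x : 0 < group_size (g x).
  by rewrite ltr0n; apply/card_gt0P; exists x; rewrite inE.
apply: (@le_trans _ _ (\sum_(x | small x) \sum_(y | g y == g x)
    (group_size (g x))^-1 * (h * rho y) `^ p)).
  apply: ler_sum => x /andP[/andP[_ x0] _]; rewrite -mulr_sumr ler_pdivlMl//.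
  rewrite mulr_natl -sumr_const; apply: ler_sum => y /eqP gxy.
  apply: ge0_ler_powR; rewrite ?nnegrE ?mulr_ge0//; last exact: group_rho.
    by move: p_ge1; lra.
  exact: ltW.
rewrite (exchange_big_dep predT)//= mulr_sumr; apply: ler_sum => y _.
rewrite (eq_bigr (fun=> (group_size (g y))^-1 * (h * rho y) `^ p)); last first.
  by move=> x /andP[_ /eqP ->].
rewrite sumr_const -[leLHS]mulr_natl mulrA powRM ?(ltW h_gt0)// mulrA.
rewrite ler_wpM2r ?powR_ge0// ler_wpM2r ?powR_ge0// ler_pdivrMr//.
pose T l := [pred x | [&& small x, g y == g x & sigma x == l]].
rewrite (_ : #|_| = \sum_l #|T l|)%N; last first.
  rewrite -sum1_card (partition_big sigma predT)//=; apply: eq_bigr => l _.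
  by rewrite -sum1_card; apply: eq_bigl => x; rewrite !inE -andbA.
rewrite natr_sum -mulrA mulr_natl -sumr_const; apply: ler_sum => l _.
have [/existsP[x0 x0T]|/existsPn T0] := boolP [exists x, T l x]; last first.
  by rewrite eq_card0 ?mulr_ge0 ?(ltW theta_gt0) ?(ltW (gs0 _))// => x; apply/negbTE/T0.
case/and3P : x0T => /andP[_ sm] /eqP gy /eqP sl; rewrite gy.
apply: le_trans (ltW sm); rewrite ler_nat.
apply/subset_leq_card/fintype.subsetP => x; rewrite !inE.
by case/and3P => /andP[fx _] /eqP gx /eqP ->; rewrite sl -gy gx !eqxx.
Qed.

Let not_kept x : ~~ kept x -> [|| 1 < defect x, rho x == 0 | small x].
Proof.
rewrite /kept negb_and /small; case: (boolP (fine_point x)) => /= [_|].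
  by rewrite -ltNge => ->; rewrite !orbT.
rewrite negb_and -ltNge => /orP[->//|]; rewrite -leNgt => r0 _.
by rewrite eq_le r0 rho_ge0 orbT.
Qed.

(** If [defect x > 1], then [1 + defect x] is at most [2 * defect x]; if [rho x = 0], the bound on
    [f x] vanishes; otherwise [x] is small and [1 + defect x <= 2]. In each case the factor 4
    suffices. *)
Let rem_le (f : I -> R) : (forall x, 0 <= f x) ->
  (forall x, f x <= 2 * (1 + defect x) * rho x `^ p) ->
  \sum_(x | ~~ kept x) f x <= 4 * E.
Proof.
move=> f0 fle; have p0 : p != 0 by rewrite gt_eqF// (lt_le_trans ltr01 p_ge1).
rewrite /E mulrDr.
apply: (@le_trans _ _ (\sum_(x | ~~ kept x) 4 * (rho x `^ p * defect x) +
                       \sum_(x | small x) 4 * rho x `^ p)); last first.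
  rewrite -!mulr_sumr lerD ?ler_pM2l// ?sum_small//.
  rewrite [leRHS](bigID kept)/= lerDr sumr_ge0// => x _.
  by rewrite mulr_ge0 ?powR_ge0.
rewrite [X in _ <= X + _]big_mkcond/= [X in _ <= _ + X]big_mkcond/= -big_split/=.
rewrite [leLHS]big_mkcond/=; apply: ler_sum => x _.
have r0 := powR_ge0 (rho x) p; have u0 := defect_ge0 x; have fx := fle x.
have ru0 : 0 <= rho x `^ p * defect x by rewrite mulr_ge0.
case: (boolP (kept x)) => [_|/not_kept] /=; first by rewrite add0r; case: ifP => // _; lra.
have [u1 _|u1 /=] := ltP 1 (defect x).
  have : rho x `^ p * 1 <= rho x `^ p * defect x by rewrite ler_wpM2l// ltW.
  by case: ifP => _; lra.
case: eqVneq => [r00 _|_ /= ->].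
  by move: fx; rewrite r00 powR0// !mulr0 !mul0r mulr0 add0r => /le_trans; apply; case: ifP.
have : rho x `^ p * defect x <= rho x `^ p * 1 by rewrite ler_wpM2l.
lra.
Qed.

Let d_moved : \sum_(x | ~~ kept x) d x (moved x) `^ p <= 4 * E.
Proof.
apply: rem_le => x; first exact: powR_ge0.
rewrite /moved; case: ifP => kx.
  rewrite /d /hdist subrr /hnorm (ip0l ipP) sqrtr0 powR0; last first.
    by rewrite gt_eqF// (lt_le_trans ltr01 p_ge1).
  by rewrite mulr_ge0 ?powR_ge0// mulr_ge0// addr_ge0.
rewrite -[leLHS]mul1r ler_wpM2r ?powR_ge0//; have := defect_ge0 x; lra.
Qed.

Let defect_ge_center x j : v x (s j) <= defect x.
Proof.
rewrite /defect (bigD1 j)//= -addrA lerDl addr_ge0 ?sumr_ge0//.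
rewrite mulr_ge0 ?invr_ge0 ?(ltW beta_gt0)// sumr_ge0// => i _.
by rewrite sumr_ge0// => o _; rewrite mulr_ge0 ?invr_ge0 ?ler0n ?sumr_ge0.
Qed.

(** The points moved may have badly distorted distances to their centers, so the target cost of
    moving them needs [v_pow], which bounds distances to the power [p] linearly in [v], and hence in
    the defect. *)
Let d'_moved : \sum_(x | ~~ kept x) d' x (moved x) `^ p <= 4 * E.
Proof.
apply: rem_le => x; first exact: powR_ge0.
rewrite /moved; case: ifP => kx.
  rewrite /d' /hdist subrr /hnorm (ip0l ipP') sqrtr0 powR0; last first.
    by rewrite gt_eqF// (lt_le_trans ltr01 p_ge1).
  by rewrite mulr_ge0 ?powR_ge0// mulr_ge0// addr_ge0.
apply: (le_trans (v_pow _ _)); rewrite ler_wpM2r ?powR_ge0//.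
by rewrite ler_pM2l// lerD2l.
Qed.

Hypothesis k0_le : beta / theta * (2 + 3 * h ^+ 11) `^ p * h ^+ 13 <= e.

Let A := (1 + e) `^ p ^+ 3 * (1 + 10 * e) `^ p.
Let B := (1 + e) `^ p ^+ 2 * (1 + h) `^ p * (1 + 10 * e) `^ p.
Let err := 8 * E + \sum_x (e ^+ 4 * rho x) `^ p.

Let A_gt0 : 0 < A.
Proof. by rewrite mulr_gt0 ?exprn_gt0 ?powR_gt0 ?addr_gt0 ?mulr_gt0. Qed.

Let B_ge0 : 0 <= B.
Proof. by rewrite !mulr_ge0 ?exprn_ge0 ?powR_ge0. Qed.

Let k0_ge0 : 0 <= beta / theta. Proof. by rewrite divr_ge0 ?(ltW beta_gt0) ?(ltW theta_gt0). Qed.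

Let kept_moved x : kept x -> moved x = x. Proof. by rewrite /moved => ->. Qed.

Let bad_kept x y : bad x y -> kept x && kept y. Proof. by case/and3P => -> ->. Qed.

Let sum_err (f f' : I -> R) : \sum_(x | ~~ kept x) f x <= 4 * E ->
  \sum_(x | ~~ kept x) f' x <= 4 * E ->
  \sum_l B * (\sum_(x | (sigma x == l) && ~~ kept x) f x +
     \sum_(x | (sigma x == l) && ~~ kept x) f' x +
     \sum_(x | sigma x == l) (e ^+ 4 * rho x) `^ p) <= B * err.
Proof.
move=> f4 f'4; rewrite -mulr_sumr ler_wpM2l// !big_split/=.
have S (Q : pred I) (w : I -> R) :
    \sum_l \sum_(x | (sigma x == l) && Q x) w x = \sum_(x | Q x) w x.
  rewrite [RHS](partition_big sigma predT)//=; apply: eq_bigr => l _.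
  by apply: eq_bigl => x; rewrite andbC.
have S1 (w : I -> R) : \sum_l \sum_(x | sigma x == l) w x = \sum_x w x.
  by rewrite -(S predT); apply: eq_bigr => l _; apply: eq_bigl => x; rewrite andbT.
rewrite !S S1 /err lerD2r; lra.
Qed.

Lemma partition_cost_target_le :
  partition_cost ip' X' sigma p <= A * partition_cost ip X sigma p + B * err.
Proof.
apply: le_trans (lerD (lexx _) (sum_err d_moved d'_moved)).
apply: partition_cost_le => // l c xi xi0.
apply: (@cluster_step R V V' ip ip' ipP ipP' I _ (fun x => sigma x == l) X X' moved kept rho g
  bad p e _ p_ge1 e_gt0 e_small rho_ge0 k0_ge0 k0_le kept_moved bad_kept) => //.
- by move=> x y _ _ /good_le/andP[].
- by move=> x y /bad_le[].
- exact: class_sparse.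
Qed.

(** The same step with the two spaces exchanged. The groups and [rho] remain those of the source,
    which is why the pair bounds were proved for both distances in terms of [rho]. *)
Lemma partition_cost_source_le :
  partition_cost ip X sigma p <= A * partition_cost ip' X' sigma p + B * err.
Proof.
apply: le_trans (lerD (lexx _) (sum_err d'_moved d_moved)).
apply: partition_cost_le => // l c xi xi0.
apply: (@cluster_step R V' V ip' ip ipP' ipP I _ (fun x => sigma x == l) X' X moved kept rho g
  bad p e _ p_ge1 e_gt0 e_small rho_ge0 k0_ge0 k0_le kept_moved bad_kept) => //.
- by move=> x y _ _ /good_le/andP[].
- by move=> x y /bad_le[].
- by move=> x y kx ky gxy; have [] := class_le kx ky gxy.
- exact: class_sparse.
Qed.

End Clustering.

Section Medoids.
Variables (R : realType) (V : lmodType R) (ip : V -> V -> R).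
Hypothesis ipP : is_inner_product ip.
Variables (I J : finType) (X : I -> V) (p : R).
Hypothesis p_ge0 : 0 <= p.

Let d x y := hdist ip (X x) (X y).

(** The minimization runs over all choices of data points as centers, so [s] and [a] do not depend
    on [sigma]. For a cluster with center [c], the member closest to [c] is at distance at most
    [2 * hdist ip (X x) c] from each member [x]. *)
Lemma medoids (i0 : I) (j0 : J) : exists (s : J -> I) (a : I -> J),
  (forall x j, d x (s (a x)) <= d x (s j)) /\
  forall sigma : I -> J, \sum_x d x (s (a x)) `^ p <= 2 `^ p * partition_cost ip X sigma p.
Proof.
pose a (s : {ffun J -> I}) x := [arg min_(j < j0) d x (s j)]%O.
have aP (s : {ffun J -> I}) x j : d x (s (a s x)) <= d x (s j).
  by rewrite /a; case: arg_minP => // j1 _; apply.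
pose Phi (s : {ffun J -> I}) := \sum_x d x (s (a s x)) `^ p.
pose s := [arg min_(s < [ffun=> i0]) Phi s]%O.
have sP s' : Phi s <= Phi s' by rewrite /s; case: arg_minP => // s1 _; apply.
exists s, (a s); split=> [x j|sigma]; first exact: aP.
pose m j y := \sum_(x | sigma x == j) d x y `^ p.
pose y j := [arg min_(y < i0) m j y]%O.
have yP j z : m j (y j) <= m j z by rewrite /y; case: arg_minP => // y1 _; apply.
apply: (le_trans (sP [ffun j => y j])).
apply: (@le_trans _ _ (\sum_j m j (y j))).
  rewrite /Phi (partition_big sigma predT)//=; apply: ler_sum => j _.
  apply: ler_sum => x /eqP <-.
  apply: ge0_ler_powR; rewrite ?nnegrE ?hdist_ge0//.
  by apply: (le_trans (aP [ffun j => y j] x (sigma x))); rewrite ffunE.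
have p2 : 0 < 2 `^ p :> R by rewrite powR_gt0.
rewrite -ler_pdivrMl// mulr_sumr; apply: partition_cost_ge_sum => j c.
rewrite ler_pdivrMl//.
have [/existsP[x0 x0j]|/existsPn none] := boolP [exists x, sigma x == j]; last first.
  by rewrite /m !big_pred0 ?mulr0// => x; apply/negbTE/none.
pose z := [arg min_(z < x0 | sigma z == j) hdist ip (X z) c]%O.
apply: (le_trans (yP j z)); rewrite mulr_sumr; apply: ler_sum => x xj.
rewrite -powRM ?hdist_ge0//; apply: ge0_ler_powR; rewrite ?nnegrE ?mulr_ge0 ?hdist_ge0//.
apply: (le_trans (hdist_tri ipP _ c _)).
rewrite mulr_natl mulr2n lerD2l (hdistC ipP).
by rewrite /z; case: arg_minP => // z1 _; apply.
Qed.

End Medoids.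


Lemma powR_le_expR (R : realType) (x p : R) : 0 <= x -> 0 <= p -> (1 + x) `^ p <= expR (x * p).
Proof.
move=> x0 p0; rewrite expRM ge0_ler_powR ?nnegrE ?expR_ge0 ?expR_ge1Dx//.
exact: addr_ge0.
Qed.

Lemma expR_le_inv (R : realType) (x : R) : x < 1 -> expR x <= (1 - x)^-1.
Proof.
move=> x1; rewrite -[expR x]invrK lef_pV2 ?posrE ?invr_gt0 ?expR_gt0 ?subr_gt0//.
by rewrite -expRN expR_ge1Dx.
Qed.

Section RelativeError.
Variables (R : realType) (V V' : lmodType R) (ip : V -> V -> R) (ip' : V' -> V' -> R).
Hypotheses (ipP : is_inner_product ip) (ipP' : is_inner_product ip').
Variables (I J : finType) (X : I -> V) (X' : I -> V') (s : J -> I) (a : I -> J) (j0 : J).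
Variables (v : I -> I -> R) (p eps : R).

Let d x y := hdist ip (X x) (X y).
Let d' x y := hdist ip' (X' x) (X' y).
Let e := eps / (100 * p).
Let h := e^-1.
Let H := h `^ p.
Let N : R := (#|J|)%:R.
Let beta := H ^- 32 / N.
Let rho := center_dist ip X s a.

Hypotheses (p_ge1 : 1 <= p) (eps_gt0 : 0 < eps) (eps_lt1 : eps < 1).
Hypothesis nearest : forall x j, rho x <= d x (s j).
Hypothesis opt_le : forall sigma : I -> J,
  \sum_x rho x `^ p <= 2 `^ p * partition_cost ip X sigma p.
Hypothesis v_ge0 : forall x y, 0 <= v x y.
Hypothesis v_ok : forall x y, v x y <= 1 -> (1 - e) * d x y <= d' x y <= (1 + e) * d x y.
Hypothesis v_pow : forall x y, d' x y `^ p <= 2 * (1 + v x y) * d x y `^ p.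
Hypothesis centers_ok : forall j j', v (s j) (s j') <= 1.
Hypothesis defect_le : \sum_x rho x `^ p * defect ip X s a v e beta x <=
  H ^- 4 * \sum_x rho x `^ p.

Lemma partition_cost_relative_error (sigma : I -> J) :
  (1 - eps) * partition_cost ip X sigma p <= partition_cost ip' X' sigma p <=
  (1 + eps) * partition_cost ip X sigma p.
Proof.
have pg := p_ge1; have eg := eps_gt0; have el := eps_lt1.
have p_gt0 : 0 < p by lra.
have e_gt0 : 0 < e by rewrite divr_gt0// mulr_gt0.
have ep : e * p = eps / 100 by rewrite /e; field; rewrite gt_eqF.
have e_small : e <= 100^-1.
  have : e * 1 <= e * p by rewrite ler_pM2l.
  rewrite ep; lra.
have h_ge : 100 <= h by rewrite -[100]invrK lef_pV2 ?posrE ?invr_gt0.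
have h_gt0 : 0 < h by rewrite invr_gt0.
have he : h * e = 1 by rewrite mulVf ?gt_eqF.
have hH : h <= H by apply: le1r_powR => //; lra.
have H_ge : 100 <= H by lra.
have H_gt0 : 0 < H by lra.
have powH c n : 0 <= c -> c <= h ^+ n -> c `^ p <= H ^+ n.
  move=> c0 ch; rewrite /H -(powR_mulrn n (powR_ge0 _ _)) powRAC (powR_mulrn n (ltW h_gt0)).
  by apply: ge0_ler_powR; rewrite ?nnegrE ?exprn_ge0 ?(ltW h_gt0) ?(ltW p_gt0).
have N_ge1 : 1 <= N by rewrite ler1n; apply/card_gt0P; exists j0.
have N_gt0 : 0 < N by lra.
(* With this [theta], small cells cost [N * theta * H * OPT = H ^- 4 * OPT], as much as the defect
   term. Then [beta / theta = H ^- 27] pays for the factors [H ^+ 12] and [H ^+ 13] in [k0_le] and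
   leaves [H ^- 2 <= e]. *)
pose theta := H ^- 5 / N.
have Hn0 n : 0 < H ^- n by rewrite invr_gt0 exprn_gt0.
have theta_gt0 : 0 < theta by rewrite divr_gt0.
have beta_gt0 : 0 < beta by rewrite divr_gt0.
have bt : beta / theta = H ^- 27 by rewrite /beta /theta; field; rewrite !gt_eqF.
have k0_le : beta / theta * (2 + 3 * h ^+ 11) `^ p * h ^+ 13 <= e.
  have h1 : (2 + 3 * h ^+ 11) `^ p <= H ^+ 12.
    apply: powH; first by rewrite addr_ge0// mulr_ge0// exprn_ge0// ltW.
    rewrite exprS; have : 1 <= h ^+ 11 by apply: exprn_ege1; lra.
    have : 100 * h ^+ 11 <= h * h ^+ 11 by rewrite ler_wpM2r ?exprn_ge0 ?(ltW h_gt0).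
    lra.
  have h2 : h ^+ 13 <= H ^+ 13 by rewrite lerXn2r ?nnegrE ?(ltW h_gt0) ?(ltW H_gt0).
  rewrite bt; apply: (@le_trans _ _ (H ^- 27 * H ^+ 12 * H ^+ 13)).
    rewrite -[leLHS]mulrA -[leRHS]mulrA ler_pM2l//; apply: ler_pM => //; first exact: powR_ge0.
    by rewrite exprn_ge0// ltW.
  have -> : H ^- 27 * H ^+ 12 * H ^+ 13 = H^-1 * H^-1 by field; rewrite gt_eqF.
  apply: (@le_trans _ _ (H^-1 * 1)).
    by rewrite ler_pM2l ?invr_gt0// invf_le1//; lra.
  by rewrite mulr1 -[e]invrK lef_pV2 ?posrE.
pose OPT := \sum_x rho x `^ p.
have opt_le' : OPT <= 2 `^ p * partition_cost ip X sigma p by exact: opt_le.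
have defect_le' := defect_le; rewrite -/OPT in defect_le'.
have OPT0 : 0 <= OPT by apply: sumr_ge0 => x _; exact: powR_ge0.
set c := partition_cost ip X sigma p; set c' := partition_cost ip' X' sigma p.
have c0 : 0 <= c by exact: partition_cost_ge0.
have c'0 : 0 <= c' by exact: partition_cost_ge0.
pose A := (1 + e) `^ p ^+ 3 * (1 + 10 * e) `^ p.
pose B := (1 + e) `^ p ^+ 2 * (1 + h) `^ p * (1 + 10 * e) `^ p.
have x1 := powR_le_expR (ltW e_gt0) (ltW p_gt0); rewrite ep in x1.
have x2 : (1 + 10 * e) `^ p <= expR (eps / 10).
  have : 0 <= 10 * e by rewrite mulr_ge0 ?(ltW e_gt0).
  move=> /powR_le_expR /(_ (ltW p_gt0)); rewrite -mulrA ep.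
  by have -> : 10 * (eps / 100) = eps / 10 by lra.
have X0 := powR_ge0 (1 + e) p.
have A_le : A <= 1 + 15 / 100 * eps.
  apply: (@le_trans _ _ (expR (13 / 100 * eps))).
    apply: (@le_trans _ _ (expR (eps / 100) ^+ 3 * expR (eps / 10))).
      by apply: ler_pM; rewrite ?exprn_ge0 ?powR_ge0// lerXn2r ?nnegrE ?expR_ge0.
    rewrite -expRM_natl -expRD le_eqVlt; apply/orP; left; apply/eqP; congr expR; lra.
  apply: (le_trans (expR_le_inv _)); first by lra.
  by rewrite -[leLHS]mul1r ler_pdivrMr; nra.
have B_le : B <= 2 * 2 `^ p * H.
  have B1 : (1 + e) `^ p ^+ 2 * (1 + 10 * e) `^ p <= 2.
    apply: (@le_trans _ _ (expR (12 / 100 * eps))).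
      apply: (@le_trans _ _ (expR (eps / 100) ^+ 2 * expR (eps / 10))).
        by apply: ler_pM; rewrite ?exprn_ge0 ?powR_ge0// lerXn2r ?nnegrE ?expR_ge0.
      rewrite -expRM_natl -expRD le_eqVlt; apply/orP; left; apply/eqP; congr expR; lra.
    apply: (le_trans (expR_le_inv _)); first by lra.
    by rewrite -[leLHS]mul1r ler_pdivrMr; lra.
  have B2 : (1 + h) `^ p <= 2 `^ p * H.
    rewrite /H -(powRM p (ler0n R 2) (ltW h_gt0)); apply: ge0_ler_powR; rewrite ?nnegrE ?mulr_ge0 ?(ltW h_gt0) ?(ltW p_gt0)//; lra.
  rewrite /B mulrAC -[leRHS]mulrA; apply: ler_pM => //; last exact: powR_ge0.
  by rewrite mulr_ge0 ?exprn_ge0 ?powR_ge0.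
pose err := 8 * (\sum_x rho x `^ p * defect ip X s a v e beta x +
   N * theta * H * OPT) + \sum_x (e ^+ 4 * rho x) `^ p.
have B0 : 0 <= B by rewrite !mulr_ge0 ?exprn_ge0 ?powR_ge0.
(* All errors add up to at most [17 * H ^- 4 * OPT]. The factor [B] costs one [H], and the two
   factors [2 ^ p] cost another since [4 <= h]; there remains [34 * H ^- 2 <= 34 * e ^+ 2]. *)
have err_le : B * err <= eps / 100 * c.
  have tau : \sum_x (e ^+ 4 * rho x) `^ p = H ^- 4 * OPT.
    rewrite mulr_sumr; apply: eq_bigr => x _.
    rewrite powRM ?hdist_ge0 ?exprn_ge0 ?(ltW e_gt0)//; congr (_ * _).
    rewrite -(powR_mulrn 4 (ltW e_gt0)) powRAC powR_mulrn ?powR_ge0// -exprVn; congr (_ ^+ _).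
    have Hn : H != 0 by rewrite gt_eqF.
    apply: (mulIf Hn); rewrite mulVf// /H -powRM ?(ltW e_gt0) ?(ltW h_gt0)//.
    by rewrite mulrC he powR1.
  have E1 : err <= 17 * H ^- 4 * OPT.
    have -> : 17 * H ^- 4 * OPT = 8 * (H ^- 4 * OPT + N * theta * H * OPT) + H ^- 4 * OPT.
      by rewrite /theta; field; rewrite !gt_eqF.
    by rewrite /err tau lerD2r ler_pM2l// lerD2r.
  have err0 : 0 <= err.
    rewrite /err addr_ge0//; last by apply: sumr_ge0 => x _; exact: powR_ge0.
    rewrite mulr_ge0// addr_ge0//; last exact: mulr_ge0 (mulr_ge0 (mulr_ge0 (ltW N_gt0) (ltW theta_gt0)) (ltW H_gt0)) OPT0.
    apply: sumr_ge0 => x _; rewrite mulr_ge0 ?powR_ge0//.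
    rewrite addr_ge0 ?sumr_ge0// mulr_ge0 ?invr_ge0 ?(ltW beta_gt0)// sumr_ge0// => i _.
    by rewrite sumr_ge0// => o _; rewrite mulr_ge0 ?invr_ge0 ?ler0n ?sumr_ge0.
  have P2 : 0 <= 2 `^ p :> R by exact: powR_ge0.
  have E2 : B * err <= 2 * 2 `^ p * H * (17 * H ^- 4 * (2 `^ p * c)).
    apply: ler_pM => //.
    apply: (le_trans E1); rewrite ler_wpM2l ?opt_le'// mulr_ge0// ltW//.
  apply: (le_trans E2).
  have -> : 2 * 2 `^ p * H * (17 * H ^- 4 * (2 `^ p * c)) = 34 * (2 `^ p * 2 `^ p) * H ^- 3 * c.
    by field; rewrite gt_eqF.
  rewrite ler_wpM2r//.
  have P4 : 2 `^ p * 2 `^ p <= H ^+ 1.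
    by rewrite -powRM//; apply: powH; rewrite ?mulr_ge0// expr1; lra.
  apply: (@le_trans _ _ (34 * H ^+ 1 * H ^- 3)).
    by rewrite ler_wpM2r ?(ltW (Hn0 3))// ler_pM2l.
  have -> : 34 * H ^+ 1 * H ^- 3 = 34 * (H^-1 * H^-1) by field; rewrite gt_eqF.
  have Hi : H^-1 <= e by rewrite -[e]invrK lef_pV2 ?posrE.
  have Hi0 : 0 < H^-1 by rewrite invr_gt0.
  have ee : H^-1 * H^-1 <= e * e by apply: ler_pM => //; exact: ltW.
  have ee2 : e * e <= 100^-1 * e by rewrite ler_wpM2r// ltW.
  have ee3 : e * 1 <= e * p by rewrite ler_pM2l.
  rewrite ep in ee3; lra.
have T1 := partition_cost_target_le ipP ipP' p_ge1 e_gt0 e_small beta_gt0 theta_gt0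
  nearest v_ge0 v_ok v_pow centers_ok sigma k0_le.
have T2 := partition_cost_source_le ipP ipP' p_ge1 e_gt0 e_small beta_gt0 theta_gt0
  nearest v_ge0 v_ok v_pow centers_ok sigma k0_le.
rewrite -/c -/c' in T1 T2.
have {}T1 : c' <= A * c + B * err by exact: T1.
have {}T2 : c <= A * c' + B * err by exact: T2.
have A1 : A * c <= (1 + 15 / 100 * eps) * c by rewrite ler_wpM2r.
have A2 : A * c' <= (1 + 15 / 100 * eps) * c' by rewrite ler_wpM2r.
have ec : 0 <= eps * c by rewrite mulr_ge0 ?(ltW eps_gt0).
have ec' : 0 <= eps * c' by rewrite mulr_ge0 ?(ltW eps_gt0).
apply/andP; split; last by lra.
(* The error in [T2] is a multiple of [c], so it is absorbed on the left and cancelled at the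
   end. *)
have : (1 - eps) * ((1 - eps / 100) * c) <= (1 - eps) * ((1 + 15 / 100 * eps) * c').
  by rewrite ler_wpM2l//; lra.
rewrite mulrCA [leRHS]mulrA => hh.
have h3 : (1 - eps) * (1 + 15 / 100 * eps) <= 1 - eps / 100 by nra.
have h4 : (1 - eps) * (1 + 15 / 100 * eps) * c' <= (1 - eps / 100) * c' by rewrite ler_wpM2r.
have e1 : 0 < 1 - eps / 100 by lra.
by move: (le_trans hh h4); rewrite ler_pM2l.
Qed.

End RelativeError.

(** * Second differences of analytic functions *)

Section SecondDifference.
Variable R : realType.
Implicit Types (f : R -> R) (t b M : R).

(** A finite difference instead of a derivative: as a combination of three values it commutes with
    expectations and pointwise limits, and [cos (u * th)] is still an eigenfunction, with eigenvalue
    [- 2 * (1 - cos th)]. *)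
Definition diff2 f t := f (t + 1) + f (t - 1) - 2 * f t.

Lemma iter_diff2_bound a f t M : (forall u, `|u| <= `|t| + a%:R -> `|f u| <= M) ->
  `|iter a diff2 f t| <= 4 ^+ a * M.
Proof.
elim: a t => [|a ih] t fM; first by rewrite mul1r fM// addr0.
have [h1 h2] : `|t + 1| <= `|t| + 1 /\ `|t - 1| <= `|t| + 1.
  by split; rewrite -[in leRHS](normr1 R) ?ler_normD ?ler_normB.
have b1 u : `|u| <= `|t| + 1 -> `|iter a diff2 f u| <= 4 ^+ a * M.
  move=> ut; apply: ih => w wu; apply: fM; rewrite -natr1; lra.
rewrite iterS {1}/diff2; set g := iter a diff2 f in b1 *.
have := b1 _ h1; have := b1 _ h2; have := b1 t; rewrite lerDl ler01 => /(_ isT).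
have := ler_normB (g (t + 1) + g (t - 1)) (2 * g t); have := ler_normD (g (t + 1)) (g (t - 1)).
rewrite normrM (ger0_norm (ler0n R 2)) exprS; lra.
Qed.

Lemma iter_diff2_cvg a (fn : nat -> R -> R) f t :
  (forall u, `|u| <= `|t| + a%:R -> fn ^~ u @ \oo --> f u) ->
  (fun n => iter a diff2 (fn n) t) @ \oo --> iter a diff2 f t.
Proof.
elim: a t => [|a ih] t ff; first by apply: ff; rewrite addr0.
have [h1 h2] : `|t + 1| <= `|t| + 1 /\ `|t - 1| <= `|t| + 1.
  by split; rewrite -[in leRHS](normr1 R) ?ler_normD ?ler_normB.
have b1 u : `|u| <= `|t| + 1 -> (fun n => iter a diff2 (fn n) u) @ \oo --> iter a diff2 f u.
  move=> ut; apply: ih => w wu; apply: ff; rewrite -natr1; lra.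
rewrite iterS; apply: cvgB; first by apply: cvgD; exact: b1.
by apply: cvgM; [exact: cvg_cst|apply: b1; rewrite lerDl].
Qed.

Lemma iter_diff2_sum a n (c : nat -> R) (g : nat -> R -> R) t :
  iter a diff2 (fun u => \sum_(i < n) c i * g i u) t = \sum_(i < n) c i * iter a diff2 (g i) t.
Proof.
elim: a t => [//|a ih] t; rewrite iterS {1}/diff2 !ih mulr_sumr -big_split/= -sumrB.
by apply: eq_bigr => i _; rewrite /diff2; ring.
Qed.

(** In the Taylor expansions at [t] with steps 1 and -1, the orders 0 and 1 cancel and the order
    [i + 2] enters with the factor [1 + (-1) ^+ i]. *)
Lemma diff2_poly (p : {poly R}) : exists2 q : {poly R},
  (size q <= size p - 2)%N & diff2 (horner p) = horner q.
Proof.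
exists (\sum_(i < size p) (1 + (-1) ^+ i) *: p^`N(i.+2)).
  apply/leq_sizeP => j pj; rewrite coef_sum big1// => i _.
  rewrite coefZ coef_nderivn nth_default ?mul0rn ?mulr0//.
  by move: pj; rewrite leq_subLR => /leq_trans; apply; rewrite leq_add2r.
apply/funext => t; have sp : (size p <= (size p).+2)%N by rewrite -addn2 leq_addr.
rewrite /diff2 !(nderiv_taylor_wide _ sp); do ?exact: mulrC.
rewrite !big_ord_recl/= nderivn0 horner_sum !expr0 !mulr1 !expr1.
set S1 := \sum_(i < size p) _; set S2 := \sum_(i < size p) _.
have -> : \sum_(i < size p) ((1 + (-1) ^+ i) *: p^`N(i.+2)).[t] = S1 + S2.
  rewrite /S1 /S2 -big_split/=; apply: eq_bigr => i _.
  by rewrite hornerZ /bump/= !add1n !expr1n mulr1 !exprS !mulN1r opprK; ring.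
ring.
Qed.

(** Only homogeneous parts of degree at least [2 a] survive [a] differences; this is where the
    factor [supnorm z] to the power [2 a] comes from. *)
Lemma iter_diff2_monomial a n : (n < a.*2)%N -> iter a diff2 (fun t => t ^+ n) = fun=> 0.
Proof.
move=> na; suff [q sq ->] : exists2 q : {poly R},
    (size q <= n.+1 - a.*2)%N & iter a diff2 (fun t => t ^+ n) = horner q.
  have : (size q <= 0)%N by apply: leq_trans sq _; move: na; lia.
  by rewrite leqn0 size_poly_eq0 => /eqP ->; apply/funext => t; rewrite horner0.
elim: a {na} => [|a [q sq ih]].
  exists 'X^n; first by rewrite size_polyXn subn0.
  by apply/funext => t; rewrite hornerXn.
rewrite iterS ih; have [q' sq' ->] := diff2_poly q; exists q' => //.
by apply: leq_trans sq' _; move: sq; lia.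
Qed.

End SecondDifference.

Section HomogeneousParts.
Variables (R : realType) (d : nat).
Implicit Types (F : ('I_d -> nat) -> R) (z : 'rV[R]_d).

Definition hom_part F m : R :=
  \sum_(al : {ffun 'I_d -> 'I_m.+1} | (\sum_i (al i : nat) == m)%N) F (fun i => al i : nat).

Lemma ps_partial_hom F n : ps_partial F n = \sum_(m < n.+1) hom_part F m.
Proof.
rewrite /ps_partial (partition_big (fun al : {ffun 'I_d -> 'I_n.+1} =>
  inord (\sum_i (al i : nat))%N : 'I_n.+1) predT)//=; apply: eq_bigr => m _.
have mn : (m.+1 <= n.+1)%N by [].
pose wd (al : {ffun 'I_d -> 'I_m.+1}) : {ffun 'I_d -> 'I_n.+1} := [ffun i => widen_ord mn (al i)].
pose nw (al : {ffun 'I_d -> 'I_n.+1}) : {ffun 'I_d -> 'I_m.+1} := [ffun i => inord (al i)].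
rewrite (reindex_onto wd nw)/=; last first.
  move=> al /andP[aln /eqP alm]; apply/ffunP => i; rewrite !ffunE; apply/val_inj => /=.
  rewrite inordK// ltnS; move/(congr1 val): alm => /=; rewrite inordK// => <-.
  by rewrite (bigD1 i)//= leq_addr.
apply: eq_big => [al|al _]; last first.
  by congr F; apply/funext => i; rewrite ffunE.
have E : (\sum_i (wd al i : nat) = \sum_i (al i : nat))%N.
  by apply: eq_bigr => i _; rewrite ffunE.
rewrite E; have -> : nw (wd al) == al.
  by apply/eqP/ffunP => i; rewrite !ffunE; apply/val_inj; rewrite /= inordK.
rewrite andbT; apply/idP/eqP => [/andP[aln /eqP/(congr1 val)/=]|am].
  by rewrite inordK.
by rewrite am -ltnS ltn_ord/=; apply/eqP/val_inj; rewrite /= inordK.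
Qed.

Lemma ps_term_scale (c : ('I_d -> nat) -> R) t z al :
  ps_term c 0 (t *: z) al = t ^+ (\sum_i al i)%N * ps_term c 0 z al.
Proof.
rewrite /ps_term mulrCA; congr (_ * _).
rewrite (eq_bigr (fun i => t ^+ al i * (z 0 i - 0) ^+ al i)); last first.
  by move=> i _; rewrite !mxE !subr0 exprMn.
rewrite big_split/=; congr (_ * _); last by apply: eq_bigr => i _; rewrite mxE.
by rewrite (big_morph (fun k => t ^+ k) (fun x y => exprD t x y) (expr0 t)).
Qed.

Lemma hom_part_scale (c : ('I_d -> nat) -> R) t z m :
  hom_part (ps_term c 0 (t *: z)) m = t ^+ m * hom_part (ps_term c 0 z) m.
Proof.
by rewrite /hom_part mulr_sumr; apply: eq_bigr => al /eqP alm; rewrite ps_term_scale alm.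
Qed.

(** Absolute convergence is used at one point only: the corner of the cube of radius [r] dominates
    every point of the cube, and shrinking by [u] scales degree [m] by [u ^+ m]. *)
Lemma hom_part_bound (c : ('I_d -> nat) -> R) z r u M m : 0 <= u -> 0 <= r ->
  (forall i, `|z 0 i| <= u * r) ->
  (forall n, ps_partial (fun al => `|ps_term c 0 (const_mx r) al|) n <= M) ->
  `|hom_part (ps_term c 0 z) m| <= u ^+ m * M.
Proof.
move=> u0 r0 zu psM; set F0 := fun al => _ in psM.
have F00 n : 0 <= hom_part F0 n by apply: sumr_ge0 => al _; exact: normr_ge0.
have FM : hom_part F0 m <= M.
  apply: le_trans (psM m); rewrite ps_partial_hom big_ord_recr/= lerDr sumr_ge0//.
apply: le_trans (ler_wpM2l (exprn_ge0 m u0) FM).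
apply: (le_trans (ler_norm_sum _ _ _)); rewrite mulr_sumr.
apply: ler_sum => al /eqP alm; 
have -> : u ^+ m = u ^+ (\sum_i al i)%N by rewrite alm.
rewrite /F0 /ps_term !normrM mulrCA.
rewrite ler_wpM2l// !normr_prod.
rewrite (big_morph (fun k => u ^+ k) (fun x y => exprD u x y) (expr0 u)) -big_split/=.
apply: ler_prod => i _; rewrite normr_ge0/= !mxE !subr0 !normrX -exprMn (ger0_norm r0).
by rewrite lerXn2r ?nnegrE ?mulr_ge0.
Qed.

Definition supnorm z : R := \big[Num.max/0]_(i < d) `|z 0 i|.

Lemma supnorm_ge z i : `|z 0 i| <= supnorm z. Proof. exact: le_bigmax. Qed.

Lemma supnorm_ge0 z : 0 <= supnorm z. Proof. exact: bigmax_ge_id. Qed.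

Lemma supnorm_attained z : 0 < supnorm z -> exists i, supnorm z = `|z 0 i|.
Proof.
move=> z0; have [/existsP[i /eqP zi]|/existsPn nz] := boolP [exists i, supnorm z == `|z 0 i|].
  by exists i.
suff : supnorm z < supnorm z by rewrite ltxx.
apply/bigmax_ltP; split=> // i _; rewrite lt_neqAle supnorm_ge andbT eq_sym; exact: nz.
Qed.

Lemma supnormZ t z : 0 < t -> supnorm (t *: z) = t * supnorm z.
Proof.
move=> t0; apply/eqP; rewrite eq_le; apply/andP; split.
  apply/bigmax_leP; split=> [|i _]; first by rewrite mulr_ge0 ?supnorm_ge0// ltW.
  by rewrite mxE normrM gtr0_norm// ler_pM2l// supnorm_ge.
rewrite -ler_pdivlMl//; apply/bigmax_leP; split=> [|i _].
  by rewrite mulr_ge0 ?supnorm_ge0// invr_ge0 ltW.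
rewrite ler_pdivlMl//; have := supnorm_ge (t *: z) i.
by rewrite mxE normrM gtr0_norm.
Qed.

(** The [a]-fold difference at 0 samples [t] up to [a] in absolute value, so the power series is
    needed at multiples of [z] up to [a]; this costs the factor [a ^ 2]. The homogeneous parts of
    degree at least [2 a] then form a geometric tail. *)
Lemma analytic_diff2_bound (K : 'rV[R]_d -> R) (U : set 'rV[R]_d) :
  analytic_on K U -> U 0 -> (forall z, `|K z| <= 1) ->
  exists2 B : R, 1 <= B & forall a z, (0 < a)%N ->
    `|iter a (@diff2 R) (fun t => K (t *: z)) 0| <= (B * a%:R ^+ 2 * supnorm z ^+ 2) ^+ a.
Proof.
move=> aK U0 K1; have [rho [rho0 [c cP]]] := aK _ U0.
pose r := rho / 2; have r0 : 0 < r by rewrite divr_gt0.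
have [|[M psM] _] := cP (const_mx r).
  move=> i; rewrite !mxE subr0 gtr0_norm// /r; lra.
have M0 : 0 <= M.
  apply: le_trans (psM 0%N); apply: sumr_ge0 => al _; exact: normr_ge0.
pose B := 1 + 16 * (2 * M + 1) / r ^+ 2.
have B0 : 0 <= 16 * (2 * M + 1) / r ^+ 2.
  by rewrite divr_ge0 ?sqr_ge0// mulr_ge0// addr_ge0// mulr_ge0.
exists B; first by rewrite lerDl.
move=> a z a0; pose u := supnorm z / r.
have u0 : 0 <= u by rewrite divr_ge0 ?supnorm_ge0// ltW.
have zE : supnorm z = u * r by rewrite divfK// gt_eqF.
have a1 : 1 <= a%:R :> R by rewrite ler1n.
have key (L : R) : `|iter a (@diff2 R) (fun t => K (t *: z)) 0| <= 4 ^+ a * L ->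
    L <= (4 * (2 * M + 1) * (u * a%:R) ^+ 2) ^+ a ->
    `|iter a (@diff2 R) (fun t => K (t *: z)) 0| <= (B * a%:R ^+ 2 * supnorm z ^+ 2) ^+ a.
  move=> /le_trans h Lle; apply: h; apply: (le_trans (ler_wpM2l _ Lle)); first by rewrite exprn_ge0.
  rewrite -exprMn; apply: lerXn2r; rewrite ?nnegrE.
  - have M1 : 0 <= 2 * M + 1 by lra.
    by rewrite mulr_ge0// mulr_ge0 ?sqr_ge0// mulr_ge0.
  - by rewrite mulr_ge0 ?sqr_ge0// mulr_ge0 ?sqr_ge0// /B addr_ge0.
  have -> : 4 * (4 * (2 * M + 1) * (u * a%:R) ^+ 2) =
     16 * (2 * M + 1) / r ^+ 2 * a%:R ^+ 2 * supnorm z ^+ 2.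
    by rewrite zE; field; rewrite gt_eqF.
  by rewrite ler_wpM2r ?sqr_ge0// ler_wpM2r ?sqr_ge0// lerDr.
(* When the sampled points may leave the cube of convergence, the trivial bound by 1 on the kernel
   suffices, because the base of the claimed power is then at least 1. *)
have [ua|ua] := leP (u * a%:R) (1 / 2); last first.
  apply: (key 1); first by apply: iter_diff2_bound => t _; exact: K1.
  apply: exprn_ege1.
  have : (1 / 2) ^+ 2 <= (u * a%:R) ^+ 2 by rewrite lerXn2r ?nnegrE ?ltW//; lra.
  have : 0 <= M * (u * a%:R) ^+ 2 by rewrite mulr_ge0 ?sqr_ge0.
  rewrite (_ : (1 / 2) ^+ 2 = 1 / 4 :> R); last by field.
  lra.
apply: (key (2 * M * (u * a%:R) ^+ a.*2)); last first.
  rewrite -muln2 mulnC exprM [leRHS]exprMn ler_wpM2r//; first by rewrite exprn_ge0 ?sqr_ge0.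
  rewrite exprMn.
  have m1 : 2 * M + 1 <= (2 * M + 1) ^+ a by apply: ler_eXnr => //; lra.
  have : 1 <= 4 ^+ a :> R by apply: exprn_ege1; lra.
  move=> h4; apply: (@le_trans _ _ (1 * (2 * M + 1) ^+ a)); first by lra.
  by rewrite ler_wpM2r// exprn_ge0//; lra.
pose P m := hom_part (ps_term c 0 z) m.
pose fn n t : R := \sum_(m < n.+1) P m * t ^+ m.
have Pm m : `|P m| <= u ^+ m * M.
  apply: (@hom_part_bound _ _ r) => //; first exact: ltW.
  by move=> i; rewrite -zE supnorm_ge.
have cv : (fun n => iter a (@diff2 R) (fn n) 0) @ \oo --> iter a (@diff2 R) (fun t => K (t *: z)) 0.
  apply: iter_diff2_cvg => t; rewrite normr0 add0r => ta.
  have [|_] := cP (t *: z).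
    move=> i; rewrite !mxE subr0 normrM.
    apply: (@le_lt_trans _ _ (a%:R * (u * r))).
      by apply: ler_pM => //; rewrite -zE supnorm_ge.
    have : u * a%:R * r <= 1 / 2 * r by rewrite ler_pM2r.
    rewrite mulrA [a%:R * u]mulrC /r => h; apply: (le_lt_trans h); lra.
  suff -> : fn ^~ t = ps_partial (ps_term c 0 (t *: z)) by [].
  apply/funext => n; rewrite ps_partial_hom /fn.
  by apply: eq_bigr => m _; rewrite hom_part_scale mulrC.
have cvn : (fun n => `|iter a (@diff2 R) (fn n) 0|) @ \oo -->
    `|iter a (@diff2 R) (fun t => K (t *: z)) 0| by exact: cvg_norm.
apply: (cvgr_to_le cvn); near=> n.
rewrite /fn (iter_diff2_sum a n.+1 P (fun m t => t ^+ m)).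
apply: (le_trans (ler_norm_sum _ _ _)).
apply: (@le_trans _ _ (\sum_(m < n.+1) 4 ^+ a * M * (if (a.*2 <= m)%N then (u * a%:R) ^+ m else 0))).
  apply: ler_sum => m _; rewrite normrM; case: leqP => am; last first.
    by rewrite iter_diff2_monomial// normr0 !mulr0.
  have : `|iter a (@diff2 R) (fun t => t ^+ m) 0| <= 4 ^+ a * a%:R ^+ m.
    apply: iter_diff2_bound => t; rewrite normr0 add0r => ta.
    by rewrite normrX lerXn2r ?nnegrE.
  move=> /(ler_pM (normr_ge0 _) (normr_ge0 _) (Pm m)) /le_trans; apply.
  rewrite [(u * _) ^+ m]exprMn le_eqVlt; apply/orP; left; apply/eqP; ring.
rewrite -mulr_sumr; set w := u * a%:R in ua *; have w0 : 0 <= w by rewrite mulr_ge0.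
have -> : 4 ^+ a * (2 * M * w ^+ a.*2) = 4 ^+ a * M * (2 * w ^+ a.*2) by ring.
rewrite ler_wpM2l//; first by rewrite mulr_ge0// exprn_ge0.
have geo k : (1 - w) * \sum_(m < k) (if (a.*2 <= m)%N then w ^+ m else 0) <= w ^+ a.*2.
  suff : (1 - w) * \sum_(m < k) (if (a.*2 <= m)%N then w ^+ m else 0) <=
      w ^+ a.*2 - (if (a.*2 <= k)%N then w ^+ k else w ^+ a.*2).
    move/le_trans; apply; rewrite gerBl; case: ifP => _; exact: exprn_ge0.
  elim: k => [|k ih]; first by rewrite big_ord0 mulr0 leqn0; case: ifP => [/eqP->|_]; rewrite subrr.
  rewrite big_ord_recr/= mulrDr; move: ih; case: leqP => ak ih.
    by rewrite (leqW ak) exprS; lra.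
  rewrite subrr in ih; rewrite mulr0 addr0; case: leqP => ak1; last by rewrite subrr.
  by rewrite (_ : k.+1 = a.*2) ?subrr//; apply/eqP; rewrite eqn_leq ak ak1.
have S0 : 0 <= \sum_(m < n.+1) (if (a.*2 <= m)%N then w ^+ m else 0).
  by apply: sumr_ge0 => m _; case: ifP => // _; exact: exprn_ge0.
have := geo n.+1; set S := \sum_(m < n.+1) _ in S0 *.
have : (1 / 2) * S <= (1 - w) * S by rewrite ler_wpM2r//; lra.
lra.
Unshelve. all: by end_near. Qed.

End HomogeneousParts.

(** * Measures on Euclidean space *)

Section WeightedIntegral.
Context (dT dS : measure_display) (R : realType) (T : measurableType dT) (S : measurableType dS).
Variables (mu : {measure set T -> \bar R}) (X : T -> S) (g : T -> R).
Hypotheses (mX : measurable_fun setT X) (mg : measurable_fun setT g).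
Hypothesis g_ge0 : forall x, 0 <= g x.

Import HBNNSimple.

Variable f : S -> R.
Hypotheses (mf : measurable_fun setT f) (f_ge0 : forall x, 0 <= f x).

Let mEf : measurable_fun [set: S] (fun x => (f x)%:E). Proof. exact/measurable_EFinP. Qed.

Let fn n : {nnsfun S >-> R} := nnsfun_approx measurableT mEf n.

Lemma weighted_integral_approx :
  (\int[mu]_x (g x * f (X x))%:E)%E =
  limn (fun n => \sum_(y \in range (fn n))
    y%:E * \int[mu]_x (g x * \1_(fn n @^-1` [set y]) (X x))%:E)%E.
Proof.
transitivity (limn (fun n => \int[mu]_x (g x * fn n (X x))%:E)%E).
  rewrite -monotone_convergence//.
  - apply: eq_integral => x _; apply/esym/cvg_lim => //.
    under eq_fun do rewrite EFinM; rewrite EFinM; apply: cvgeZl => //.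
    by apply: (cvg_nnsfun_approx measurableT mEf) => // y _; rewrite lee_fin.
  - move=> n; apply/measurable_EFinP/measurable_funM => //.
    exact: (measurableT_comp (measurable_funP (fn n))).
  - by move=> n x _; rewrite lee_fin mulr_ge0.
  - move=> x _ m n mn; rewrite lee_fin ler_wpM2l//.
    by have /lefP := nd_nnsfun_approx measurableT mEf mn; apply.
congr (limn _); apply/funext => n.
transitivity (\int[mu]_x (\sum_(y \in range (fn n))
    (y * (g x * \1_(fn n @^-1` [set y]) (X x)))%:E))%E.
  apply: eq_integral => x _; rewrite fsumEFin//; congr EFin.
  rewrite [in LHS]fimfunE fsbig_distrr//=.
  by apply: eq_fsbigr => y _; rewrite mulrCA.
have m1 y : measurable_fun setT (fun x => g x * \1_(fn n @^-1` [set y]) (X x)).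
  apply: measurable_funM => //; apply: (measurableT_comp _ mX).
  exact: measurable_indic.
have y0 y : y \in range (fn n) -> 0 <= y by rewrite inE => -[x _ <-].
rewrite ge0_integral_fsum//; last 2 first.
- by move=> y; apply/measurable_EFinP/measurable_funM.
- move=> y x _; rewrite lee_fin mulrCA mulr_ge0//.
  by have := nnfun_muleindic_ge0 (fn n) y (X x); rewrite -EFinM lee_fin.
apply: eq_fsbigr => y yr; under eq_integral do rewrite EFinM.
rewrite ge0_integralZl_EFin//; last by exact: y0.
- by move=> x _; rewrite lee_fin mulr_ge0.
- exact/measurable_EFinP.
Qed.

End WeightedIntegral.

Section WeightedIntegralEq.
Import HBNNSimple.

(* Both integrals are limits of the same combinations of integrals of indicators. *)
Lemma weighted_integral_eq (dT1 dT2 dS : measure_display) (R : realType)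
    (T1 : measurableType dT1) (T2 : measurableType dT2) (S : measurableType dS)
    (mu1 : {measure set T1 -> \bar R}) (mu2 : {measure set T2 -> \bar R})
    (X1 : T1 -> S) (X2 : T2 -> S) (g1 : T1 -> R) (g2 : T2 -> R) (f : S -> R) :
  measurable_fun setT X1 -> measurable_fun setT X2 ->
  measurable_fun setT g1 -> measurable_fun setT g2 ->
  (forall x, 0 <= g1 x) -> (forall x, 0 <= g2 x) ->
  (forall A, measurable A -> \int[mu1]_x (g1 x * \1_A (X1 x))%:E =
                             \int[mu2]_x (g2 x * \1_A (X2 x))%:E)%E ->
  measurable_fun setT f -> (forall x, 0 <= f x) ->
  (\int[mu1]_x (g1 x * f (X1 x))%:E = \int[mu2]_x (g2 x * f (X2 x))%:E)%E.
Proof.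
move=> mX1 mX2 mg1 mg2 g10 g20 gA mf f0.
rewrite (weighted_integral_approx mu1 mX1 mg1 g10 mf f0).
rewrite (weighted_integral_approx mu2 mX2 mg2 g20 mf f0).
congr (limn _); apply/funext => n; apply: eq_fsbigr => y _; rewrite gA//; exact: measurable_sfunP.
Qed.

End WeightedIntegralEq.

Section EuclideanBorel.
Variables (R : realType) (d : nat).
Local Notation V := 'rV[R]_d.

Lemma open_Rd_measurable (U : set V) : open U -> measurable (U : set (Rd R d)).
Proof. by move=> oU; apply: sub_sigma_algebra. Qed.

Lemma continuous_Rd_measurable (f : V -> R) : continuous f ->
  measurable_fun [set: Rd R d] (f : Rd R d -> R).
Proof.
move=> /continuousP cf; apply: (measurability _ (RGenOpens.measurableE R)).
move=> _ [_ [a [b ->] <-]]; rewrite setTI; apply: open_Rd_measurable.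
exact/cf/interval_open.
Qed.

Lemma coord_Rd_continuous i : continuous (fun w : V => w 0 i).
Proof. by move=> w; exact: coord_continuous. Qed.

Lemma dotv_continuous (x : V) : continuous (fun w : V => dotv w x).
Proof.
move=> w; rewrite /dotv.
apply: (@cvg_fsum R V (nbhs w) _ 'I_d _ _ (fun i w => w 0 i * x 0 i)) => i _.
by apply: cvgM; [exact: coord_Rd_continuous|exact: cvg_cst].
Qed.

Definition cbox (a b : V) : set (Rd R d) :=
  [set x : Rd R d | forall i, a 0 i <= (x : V) 0 i <= b 0 i].

(** Bounds that are inverted in some coordinate are allowed and give the empty set, so the family is
    closed under intersection. *)
Definition cboxes : set (set (Rd R d)) := [set A | exists a b, A = cbox a b].

Lemma cbox_measurable a b : measurable (cbox a b).
Proof.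
have -> : cbox a b = \bigcap_(i in [set: 'I_d])
    ((fun w : Rd R d => (w : V) 0 i) @^-1` `[a 0 i, b 0 i]%classic).
  apply/seteqP; split => [x xab i _|x xab i] /=.
    by rewrite in_itv/=; exact: xab.
  by have := xab i I; rewrite /= in_itv.
apply: fin_bigcap_measurable; first exact: finite_finset.
move=> i _; rewrite -[X in measurable X]setTI.
exact: (continuous_Rd_measurable (coord_Rd_continuous (i := i))).
Qed.

Lemma cboxes_setI : setI_closed cboxes.
Proof.
move=> _ _ [a [b ->]] [a' [b' ->]].
exists (\row_i Num.max (a 0 i) (a' 0 i)), (\row_i Num.min (b 0 i) (b' 0 i)).
apply/seteqP; split => [x [h h'] i|x h]; last first.
  by split=> i; have := h i; rewrite !mxE ge_max le_min => /andP[/andP[? ?] /andP[? ?]]; apply/andP.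
rewrite !mxE ge_max le_min.
by have /andP[-> ->] := h i; have /andP[-> ->] := h' i.
Qed.

(** [is_lebesgue_Rd] fixes the measure on closed boxes only, so translation invariance rests on
    their generating the Borel sets. An open set is the union of the countably many rational cubes
    that it contains. *)
Lemma measurable_cboxes : @measurable _ (Rd R d) = <<s cboxes >>.
Proof.
apply/seteqP; split; last first.
  apply: smallest_sub; first exact: sigma_algebra_measurable.
  by move=> _ [a [b ->]]; exact: cbox_measurable.
apply: smallest_sub; first exact: smallest_sigma_algebra.
move=> U oU; pose S := g_sigma_algebraType cboxes.
pose qbox (q : 'rV[rat]_d * rat) : set (Rd R d) :=
  cbox (\row_i ratr (q.1 0 i - q.2)) (\row_i ratr (q.1 0 i + q.2)).
have -> : U = \bigcup_q (if `[< qbox q `<=` U >] then qbox q else set0).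
  apply/seteqP; split => [x Ux|x [q _]]; last by case: ifPn => // /asboolP; apply.
  have /nbhs_ballP[e /= e0 eU] : nbhs (x : V) U by exact: open_nbhs_nbhs.
  have e30 : 0 < e / 3 by rewrite divr_gt0.
  have [r] : exists r : rat, ratr r \in `]0, e / 3[ by have [r] := rat_in_itvoo e30; exists r.
  rewrite in_itv/= => /andP[r0 r1].
  have h i : exists q : rat, `|(x : V) 0 i - ratr q| <= ratr r.
    have : (x : V) 0 i - ratr r < (x : V) 0 i + ratr r by lra.
    move=> /rat_in_itvoo[q]; rewrite in_itv/= => /andP[q1 q2]; exists q.
    by rewrite ler_norml; lra.
  have [q qP] := choice h.
  exists (\row_i q i, r) => //.
  have xq : qbox (\row_i q i, r) x.
    move=> i; rewrite !mxE /= rmorphB rmorphD/=.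
    by have := qP i; rewrite ler_norml; lra.
  rewrite asboolT// => y yq; apply: eU; split => // j i; rewrite !ord1.
  have := yq i; rewrite !mxE /= rmorphB rmorphD/=; have := qP i.
  rewrite /ball/= ler_norml ltr_norml; lra.
apply: (@countable_bigcupT_measurable _ S) => // q.
case: ifP => _; last exact: (@measurable0 _ S).
by apply: sub_sigma_algebra; exists (\row_i ratr (q.1 0 i - q.2)), (\row_i ratr (q.1 0 i + q.2)).
Qed.

Section Lebesgue.
Variable lam : {measure set (Rd R d) -> \bar R}.
Hypothesis lamP : is_lebesgue_Rd lam.

Lemma cbox_empty (a b : V) : ~ (forall i, a 0 i <= b 0 i) -> cbox a b = set0.
Proof.
move=> nab; rewrite -subset0 => x xab; apply: nab => i.
by have /andP[h1 h2] := xab i; exact: le_trans h1 h2.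
Qed.

Definition shift_Rd (h : V) : Rd R d -> Rd R d := fun w => (w : V) + h.

Lemma shift_cbox h (a b : V) : shift_Rd h @^-1` cbox a b = cbox (a - h) (b - h).
Proof.
apply/seteqP; split => x hx i; have := hx i;
by rewrite /shift_Rd !mxE lerBlDr lerBrDr.
Qed.

Lemma shift_Rd_measurable h : measurable_fun setT (shift_Rd h).
Proof.
apply: (measurability _ measurable_cboxes) => _ [_ [a [b ->] <-]]; rewrite setTI.
rewrite shift_cbox; exact: cbox_measurable.
Qed.

Lemma lebesgue_shift h A : measurable A -> lam (shift_Rd h @^-1` A) = lam A.
Proof.
pose tau : {mfun Rd R d >-> Rd R d} := HB.pack (shift_Rd h)
  (isMeasurableFun.Build _ _ _ _ _ (shift_Rd_measurable h)).
have -> : lam (shift_Rd h @^-1` A) = pushforward lam tau A by [].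
move: A; apply: (measure_unique cboxes (fun n => cbox (const_mx (- n%:R)) (const_mx n%:R))).
- exact: measurable_cboxes.
- exact: cboxes_setI.
- by move=> n; exists (const_mx (- n%:R)), (const_mx n%:R).
- apply/seteqP; split => // x _.
  exists (Num.bound (supnorm (x : V))) => // i; rewrite !mxE -ler_norml.
  apply: (le_trans (supnorm_ge _ _)); apply: ltW; apply: archi_boundP; exact: supnorm_ge0.
- move=> _ [a [b ->]]; change (lam (shift_Rd h @^-1` cbox a b) = lam (cbox a b)).
  rewrite shift_cbox.
  have [ab|ab] := pselect (forall i, a 0 i <= b 0 i); last first.
    rewrite !cbox_empty// => abh; apply: ab => i; have := abh i.
    by rewrite !mxE lerD2r.
  rewrite !lamP//; last by move=> i; rewrite !mxE lerD2r.
  by congr EFin; apply: eq_bigr => i _; rewrite !mxE; ring.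
- move=> n; set a : V := const_mx (- n%:R); set b : V := const_mx n%:R.
  change (is_true (lam (shift_Rd h @^-1` cbox a b) < +oo)%E).
  rewrite shift_cbox /a /b.
  by rewrite lamP ?ltry// => i; rewrite !mxE lerD2r; have := ler0n R n; lra.
Qed.

End Lebesgue.
End EuclideanBorel.

(** Two points of the unit circle close to 1 are close to each other. It shows that translates of a
    slab with nearly maximal cosine are disjoint unless the cosine of the phase shift is close to
    1. *)
Lemma cos_close (R : realType) (x y s : R) : 0 <= s <= 1 ->
  1 - s < cos x -> 1 - s < cos y -> 1 - cos (y - x) <= 5 * s.
Proof.
move=> /andP[s0 s1] cx cy; rewrite cosB.
have := cos2Dsin2 x; have := cos2Dsin2 y; have := cos_le1 x; have := cos_le1 y.
move: cx cy; set a := cos x; set b := cos y; set a' := sin x; set b' := sin y.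
move=> ha hb b1 a1 hb' ha'.
have h1 : (a - b) ^+ 2 <= s.
  have ab : `|a - b| <= s by rewrite ler_norml; lra.
  rewrite -[_ ^+ 2]ger0_norm ?sqr_ge0// normrX.
  by have := normr_ge0 (a - b); nra.
have h2 := sqr_ge0 (a' + b').
have h3 : 1 - a ^+ 2 <= 2 * s by nra.
have h4 : 1 - b ^+ 2 <= 2 * s by nra.
have h5 : (a - b) ^+ 2 + (a' - b') ^+ 2 <= 9 * s by nra.
nra.
Qed.

Section WeightedMean.
Context (dT : measure_display) (T : measurableType dT) (R : realType).
Variables (mu : {measure set T -> \bar R}) (rho : T -> R).
Hypotheses (mrho : measurable_fun setT rho) (rho_ge0 : forall w, 0 <= rho w).
Hypothesis rho_mass : (\int[mu]_w (rho w)%:E = 1)%E.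

Definition bounded_meas (f : T -> R) : Prop :=
  measurable_fun setT f /\ exists c : R, forall w, `|f w| <= c.

(** Used in two ways: with a density against Lebesgue measure it is the expectation over one
    frequency, and with weight 1 against a probability it is the expectation over the whole
    sample. *)
Definition weighted_mean (f : T -> R) : R := \int[mu]_w (rho w * f w).
Local Notation mean := weighted_mean.

Lemma bounded_measD f g : bounded_meas f -> bounded_meas g ->
  bounded_meas (fun w => f w + g w).
Proof.
move=> [mf [c fc]] [mg [c' gc]]; split; first exact: measurable_funD.
by exists (c + c') => w; rewrite (le_trans (ler_normD _ _))// lerD.
Qed.

Lemma bounded_measM f g : bounded_meas f -> bounded_meas g ->
  bounded_meas (fun w => f w * g w).
Proof.
move=> [mf [c fc]] [mg [c' gc]]; split; first exact: measurable_funM.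
by exists (c * c') => w; rewrite normrM ler_pM.
Qed.

Lemma bounded_meas_cst c : bounded_meas (fun=> c).
Proof. by split; [exact: measurable_cst|exists `|c|]. Qed.

Lemma bounded_measB f g : bounded_meas f -> bounded_meas g ->
  bounded_meas (fun w => f w - g w).
Proof.
move=> bf bg; have := bounded_measD bf (bounded_measM (bounded_meas_cst (-1)) bg).
by congr bounded_meas; apply/funext => w; rewrite mulN1r.
Qed.

Lemma bounded_measX f n : bounded_meas f -> bounded_meas (fun w => f w ^+ n).
Proof.
move=> bf; elim: n => [|n ih]; first exact: bounded_meas_cst.
by under eq_fun do rewrite exprS; exact: bounded_measM.
Qed.

Lemma weight_integrable : mu.-integrable setT (fun w => (rho w)%:E).
Proof.
apply/integrableP; split; first exact/measurable_EFinP.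
under eq_integral do rewrite gee0_abs ?lee_fin//.
by rewrite rho_mass ltry.
Qed.

Lemma mean_integrable f : bounded_meas f ->
  mu.-integrable setT (fun w => (rho w * f w)%:E).
Proof.
move=> [mf [c fc]].
have c0 : 0 <= c by apply: le_trans (fc point); exact: normr_ge0.
apply: (@le_integrable _ _ _ mu setT measurableT _ (fun w => (c%:E * (rho w)%:E)%E)) => //.
- exact/measurable_EFinP/measurable_funM.
- move=> w _; rewrite lee_fin !normrM (ger0_norm (rho_ge0 w)) (ger0_norm c0).
  by rewrite mulrC ler_wpM2r.
- exact: integrableZl weight_integrable.
Qed.

Lemma mean_EFin f : bounded_meas f -> ((mean f)%:E = \int[mu]_w (rho w * f w)%:E)%E.
Proof.
move=> bf; rewrite /weighted_mean /Rintegral fineK//.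
exact: (integrable_fin_num measurableT (mean_integrable bf)).
Qed.

Lemma meanD f g : bounded_meas f -> bounded_meas g ->
  mean (fun w => f w + g w) = mean f + mean g.
Proof.
move=> bf bg; rewrite /weighted_mean -RintegralD//; try exact: mean_integrable.
by apply: eq_Rintegral => w _; rewrite mulrDr.
Qed.

Lemma meanZ c f : bounded_meas f -> mean (fun w => c * f w) = c * mean f.
Proof.
move=> bf; rewrite /weighted_mean -RintegralZl//; last exact: mean_integrable.
by apply: eq_Rintegral => w _; rewrite mulrCA.
Qed.

Lemma mean1 : mean (fun=> 1) = 1.
Proof.
by rewrite /weighted_mean /Rintegral; under eq_integral do rewrite mulr1; rewrite rho_mass.
Qed.

Lemma mean_cst c : mean (fun=> c) = c.
Proof.
rewrite -[RHS]mulr1 -mean1 -meanZ; last exact: bounded_meas_cst.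
by congr mean; apply/funext => w; rewrite mulr1.
Qed.

Lemma meanB f g : bounded_meas f -> bounded_meas g ->
  mean (fun w => f w - g w) = mean f - mean g.
Proof.
move=> bf bg; rewrite -[- mean g]mulN1r -meanZ// -meanD//; last first.
  exact: bounded_measM (bounded_meas_cst (-1)) bg.
by congr mean; apply/funext => w; rewrite mulN1r.
Qed.

Lemma le_mean f g : bounded_meas f -> bounded_meas g -> (forall w, f w <= g w) ->
  mean f <= mean g.
Proof.
move=> bf bg fg; apply: le_Rintegral => //; try exact: mean_integrable.
by move=> w _; rewrite ler_wpM2l.
Qed.

Lemma le_norm_mean f c : bounded_meas f -> (forall w, `|f w| <= c) -> `|mean f| <= c.
Proof.
move=> bf fc; rewrite ler_norml; apply/andP; split.
  rewrite -[leLHS]mean_cst; apply: le_mean => // [|w]; first exact: bounded_meas_cst.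
  by have := fc w; rewrite ler_norml => /andP[].
rewrite -[leRHS]mean_cst; apply: le_mean => // [|w]; first exact: bounded_meas_cst.
by have := fc w; rewrite ler_norml => /andP[].
Qed.

End WeightedMean.

Arguments bounded_meas_cst {dT T R} c.

Section Density.
Variables (R : realType) (d : nat).
Variables (lam : {measure set (Rd R d) -> \bar R}) (pK : Rd R d -> R).
Hypothesis lamP : is_lebesgue_Rd lam.
Hypotheses (mpK : measurable_fun setT pK) (pK_ge0 : forall w, 0 <= pK w).
Hypothesis pK_mass : (\int[lam]_w (pK w)%:E = 1)%E.

Local Notation mean := (weighted_mean lam pK).

Lemma bounded_meas_cos (x : 'rV[R]_d) :
  bounded_meas (fun w : Rd R d => cos (dotv (w : 'rV[R]_d) x)).
Proof.
split.
  apply: continuous_Rd_measurable => w.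
  apply: (@continuous_comp _ _ _ (fun w => dotv w x) (@cos R)).
    exact: dotv_continuous.
  exact: continuous_cos.
by exists 1 => w; rewrite ler_norml cos_geN1 cos_le1.
Qed.

(* [G] carries density at least [1 / n] inside a box; a slab
   [cos <w, z> > 1 - s] has many disjoint translates in a slightly larger box, so it
   fills at most half of [G]. *)
Lemma mean_cos_far : exists2 c0 : R, 0 < c0 &
  forall z : 'rV[R]_d, 1 <= supnorm z -> mean (fun w : Rd R d => cos (dotv (w : 'rV[R]_d) z)) <= 1 - c0.
Proof.
pose Q (r : R) : set (Rd R d) := cbox (const_mx (- r)) (const_mx r).
pose G n : set (Rd R d) := [set w | n.+1%:R^-1 <= pK w] `&` Q n%:R.
have mQ r : measurable (Q r) by exact: cbox_measurable.
have lamQ r : 0 <= r -> lam (Q r) = (\prod_(i < d) (2 * r))%:E.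
  move=> r0; rewrite lamP; last by move=> i; rewrite !mxE; lra.
  by congr EFin; apply: eq_bigr => i _; rewrite !mxE opprK mulr_natl mulr2n.
have mG n : measurable (G n).
  apply: measurableI; last exact: mQ.
  rewrite -[X in measurable X]setTI.
  have -> : [set w | n.+1%:R^-1 <= pK w] = pK @^-1` `[n.+1%:R^-1, +oo[%classic.
    by apply/seteqP; split => w /=; rewrite in_itv/= andbT.
  exact: mpK.
have [n Gn] : exists n, (0 < lam (G n))%E.
  apply: contrapT => /forallNP nG.
  have : (\int[lam]_w (pK w)%:E = 0)%E.
    have -> : 0%E = (\int[lam]_w (0 : \bar R))%E by rewrite integral0.
    apply: ge0_ae_eq_integral => //.
    - exact/measurable_EFinP.
    - by move=> w _; rewrite lee_fin.
    have : lam.-negligible (\bigcup_n G n).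
      apply: negligible_bigcup => n; exists (G n); split => //.
      by apply/eqP; rewrite eq_le measure_ge0 andbT leNgt; apply/negP/nG.
    apply: negligibleS => w /= hw; apply: contrapT => nGw; apply: hw => _; congr EFin.
    apply/eqP; rewrite eq_le pK_ge0 andbT leNgt; apply/negP => w0; apply: nGw.
    pose m := maxn (Num.bound (pK w)^-1) (Num.bound (supnorm (w : 'rV[R]_d))).
    exists m => //; split => /=.
      rewrite -[leRHS]invrK lef_pV2 ?posrE ?invr_gt0//.
      apply: ltW; apply: lt_le_trans (archi_boundP _) _; first by rewrite invr_ge0.
      by rewrite ler_nat; apply: leqW; exact: leq_maxl.
    move=> i; rewrite !mxE -ler_norml; apply: (le_trans (supnorm_ge _ _)); apply: ltW.
    apply: lt_le_trans (archi_boundP (supnorm_ge0 _)) _.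
    by rewrite ler_nat leq_maxr.
  by rewrite pK_mass => /eqP; rewrite onee_eq0.
have Gfin : (lam (G n) < +oo)%E.
  apply: (@le_lt_trans _ _ (lam (Q n%:R))); last by rewrite lamQ ?ltry.
  by apply: le_measure; rewrite ?inE//; exact: subIsetr.
pose gam := fine (lam (G n)).
have gamE : lam (G n) = gam%:E by rewrite fineK// ge0_fin_numE// measure_ge0.
have gam0 : 0 < gam by rewrite -lte_fin -gamE.
pose L : R := \prod_(i < d) (2 * (n%:R + 1)).
have L0 : 0 <= L by apply: prodr_ge0 => i _; rewrite mulr_ge0// addr_ge0.
(* [M] disjoint translates of the slab inside a box of volume [L] force its volume down to
   [L / M <= gam / 2]. *)
pose M := (Num.bound (2 * L / gam)).+1.
have ML : L <= M%:R * (gam / 2).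
  have : 2 * L / gam < M%:R.
    apply: lt_le_trans (archi_boundP _) _; last by rewrite ler_nat.
    by rewrite divr_ge0 ?(ltW gam0)// mulr_ge0.
  rewrite ltr_pdivrMr//; lra.
have M0 : 0 < M%:R :> R by rewrite ltr0n.
have Mi1 : M%:R^-1 <= 1 :> R by rewrite invf_le1// ler1n.
have Mi0 : 0 < M%:R^-1 :> R by rewrite invr_gt0.
have pi1 : 1 <= pi :> R by have := pi_ge2 R; lra.
(* Chosen so that [5 * s < 1 - cos (M^-1)]: by [cos_close], slabs whose phases differ by an amount
   between [M^-1] and 1 cannot meet. *)
pose s : R := (1 - cos (M%:R^-1)) / 8.
have cos_dec (x y : R) : 0 <= x -> x <= y -> y <= 1 -> cos y <= cos x.
  move=> x0 xy y1; rewrite leNgt ltr_cos ?in_itv/=; lra.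
have s0 : 0 < s.
  have : cos (M%:R^-1) < cos 0 :> R by rewrite ltr_cos ?in_itv/=; lra.
  by rewrite cos0 => c1; rewrite divr_gt0// subr_gt0.
(* On [G n] outside the slab the density is at least [n.+1^-1], the integrand [1 - cos] is at least
   [s], and the volume is at least [gam / 2]. *)
exists (s * gam / (2 * n.+1%:R)).
  by apply: divr_gt0; [exact: mulr_gt0 s0 gam0|rewrite mulr_gt0].
move=> z z1.
have [i zi] : exists i, supnorm z = `|z 0 i| by apply: supnorm_attained; lra.
have zi0 : z 0 i != 0 by rewrite -normr_eq0 -zi gt_eqF//; lra.
pose E : set (Rd R d) := Q n%:R `&` [set w | 1 - s < cos (dotv (w : 'rV[R]_d) z)].
have mE : measurable E.
  apply: measurableI => //; rewrite -[X in measurable X]setTI.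
  have -> : [set w : Rd R d | 1 - s < cos (dotv (w : 'rV[R]_d) z)] =
      (fun w : Rd R d => cos (dotv (w : 'rV[R]_d) z)) @^-1` `]1 - s, +oo[%classic.
    by apply/seteqP; split => w /=; rewrite in_itv/= andbT.
  by have [+ _] := bounded_meas_cos z; exact.
(* Along the coordinate where [z] attains its supremum norm, this shift changes the phase by exactly
   [j / M]. As that coordinate has absolute value at least 1, points move by at most 1 and stay in
   the enlarged box. *)
pose h (j : nat) : 'rV[R]_d := \row_l (if l == i then j%:R / M%:R / z 0 i else 0).
pose F (j : nat) : set (Rd R d) := if (j < M)%N then shift_Rd (h j) @^-1` E else set0.
have mF j : measurable (F j).
  rewrite /F; case: ifP => // _.
  by rewrite -[X in measurable X]setTI; exact: shift_Rd_measurable.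
have doth (w : 'rV[R]_d) j : dotv (w + h j) z = dotv w z + j%:R / M%:R.
  rewrite /dotv; under eq_bigr do rewrite mxE mulrDl.
  rewrite big_split/=; congr (_ + _).
  rewrite (bigD1 i)//= big1 ?addr0; last by move=> l li; rewrite mxE (negbTE li) mul0r.
  by rewrite mxE eqxx divfK.
have FQ : \big[setU/set0]_(j < M) F j `<=` Q (n%:R + 1).
  rewrite -bigcup_mkord => w [j /= jM]; rewrite /F jM => -[wQ _] l; have := wQ l.
  rewrite /shift_Rd !mxE; case: eqP => [->|_]; last by rewrite addr0; lra.
  have : `|j%:R / M%:R / z 0 i| <= 1.
    rewrite normrM normfV -zi ler_pdivrMr ?mul1r; last by lra.
    rewrite ger0_norm ?divr_ge0//; apply: le_trans z1.
    by rewrite ler_pdivrMr// mul1r ler_nat ltnW.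
  by rewrite ler_norml; lra.
have Ftriv : trivIset setT F.
  apply/trivIsetP => j l _ _; rewrite /F; case: ifPn => jM; last by rewrite set0I.
  case: ifPn => lM; last by rewrite setI0.
  apply: contraNeq => /eqP/eqP /set0P[w [[_ /= Fj] [_ /= Fl]]].
  rewrite doth in Fj; rewrite doth in Fl.
  wlog jl : j l jM lM Fj Fl / (j < l)%N => [hw|].
    have [jl|lj] := ltnP j l; first exact: (hw j l).
    by move: lj; rewrite leq_eqVlt => /orP[/eqP->//|lj]; rewrite eq_sym; exact: (hw l j).
  exfalso.
  set x := dotv _ z + _ in Fj; set y := dotv _ z + _ in Fl.
  have yx : y - x = (l - j)%:R / M%:R by rewrite /x /y natrB ?(ltnW jl)//; ring.
  have c1 : cos (y - x) <= cos (M%:R^-1).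
    apply: cos_dec; [exact: ltW| |].
      by rewrite yx -[leLHS]mul1r ler_wpM2r ?(ltW Mi0)// ler1n subn_gt0.
    by rewrite yx ler_pdivrMr// mul1r ler_nat (leq_trans (leq_subr _ _))// ltnW.
  have s1 : 0 <= s <= 1.
    by apply/andP; split; [exact: ltW|have := cos_geN1 (M%:R^-1 : R); rewrite /s; lra].
  have := cos_close s1 Fj Fl; have := s0; rewrite /s; lra.
have lamE : (lam E <= (gam / 2)%:E)%E.
  have Efin : lam E \is a fin_num.
    rewrite ge0_fin_numE// (@le_lt_trans _ _ (lam (Q n%:R)))//; last by rewrite lamQ ?ltry.
    by apply: le_measure; rewrite ?inE//; exact: subIsetl.
  have : (lam (\big[setU/set0]_(j < M) F j) <= lam (Q (n%:R + 1)%R))%E.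
    apply: le_measure => //; rewrite ?inE//.
    by apply: bigsetU_measurable => j _; exact: mF.
  rewrite lamQ ?addr_ge0// measure_bigsetU//.
  have FE (j : 'I_M) : lam (F j) = lam E.
    by rewrite /F ltn_ord; exact: lebesgue_shift.
  rewrite (eq_bigr (fun=> (fine (lam E))%:E)); last first.
    by move=> j _; transitivity (lam E); [exact: FE|rewrite fineK].
  rewrite sumEFin sumr_const card_ord -(fineK Efin) !lee_fin -/L => EL.
  rewrite -(ler_pM2l M0); apply: le_trans ML.
  by rewrite mulr_natl.
have GE : ((gam / 2)%:E <= lam (G n `\` E))%E.
  have gE : (gam%:E = lam (G n `\` E) + lam (G n `&` E))%E.
    by rewrite -gamE; exact: measureDI.
  have GI : (lam (G n `&` E) <= (gam / 2)%:E)%E.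
    apply: le_trans lamE; apply: le_measure; [rewrite inE; exact: measurableI|by rewrite inE|].
    exact: (@subIsetr _ (G n) E).
  have GIf : lam (G n `&` E) \is a fin_num.
    by rewrite ge0_fin_numE// (le_lt_trans GI)// ltry.
  rewrite -(fineK GIf) lee_fin in GI; rewrite -(fineK GIf) in gE.
  rewrite -(leeD2rE _ _ GIf) -(fineK GIf) -gE -EFinD lee_fin; lra.
pose c0 := s * gam / (2 * n.+1%:R).
have bc := bounded_meas_cos z.
have b1c := bounded_measB (bounded_meas_cst 1) bc.
rewrite lerBrDl -lerBrDr -[X in _ <= X - _](mean_cst mpK pK_ge0 pK_mass 1) -meanB//; last exact: bounded_meas_cst.
rewrite -lee_fin mean_EFin//.
have sn0 : 0 <= s / n.+1%:R by rewrite divr_ge0// ltW.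
apply: (@le_trans _ _ (\int[lam]_w ((s / n.+1%:R)%:E * (\1_(G n `\` E) w)%:E))%E).
  rewrite ge0_integralZl_EFin//.
  - rewrite integral_indic ?setIT//; last exact: measurableD.
    apply: le_trans (lee_wpmul2l _ GE); last by rewrite lee_fin.
    have N0 : n.+1%:R != 0 :> R by rewrite pnatr_eq0.
    rewrite -EFinM lee_fin; move: N0; set N := n.+1%:R => N0.
    by rewrite le_eqVlt; apply/orP; left; apply/eqP; field.
  - by apply/measurable_EFinP/measurable_indic/measurableD.
apply: ge0_le_integral => //.
- by move=> w _; rewrite mule_ge0// lee_fin.
- apply: measurable_funeM; apply/measurable_EFinP/measurable_indic; exact: measurableD.
- apply/measurable_EFinP/measurable_funM => //; exact: b1c.1.
- move=> w _; rewrite -EFinM lee_fin indicE; have cw := cos_le1 (dotv (w : 'rV[R]_d) z).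
  case: (boolP (w \in _)) => [/set_mem[[/= pw wQ] nE]|_]; last first.
    by rewrite mulr0 mulr_ge0// subr_ge0.
  rewrite mulr1 mulrC ler_pM ?(ltW s0)//.
  have : ~ (1 - s < cos (dotv (w : 'rV[R]_d) z)) by move=> h1; apply: nE.
  by move/negP; rewrite -leNgt; lra.
Qed.

End Density.

(** * Moments of the kernel density *)

Lemma iter_diff2_cos (R : realType) a (th t : R) :
  iter a (@diff2 R) (fun u => cos (u * th)) t = (- 2 * (1 - cos th)) ^+ a * cos (t * th).
Proof.
elim: a t => [|a ih] t; first by rewrite mul1r.
rewrite iterS {1}/diff2 !ih mulrDl mulrBl !mul1r cosD cosB exprS; ring.
Qed.

Lemma dotvZ (R : realType) d t (w x : 'rV[R]_d) : dotv w (t *: x) = t * dotv w x.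
Proof. by rewrite /dotv mulr_sumr; apply: eq_bigr => i _; rewrite mxE mulrCA. Qed.

Lemma dotv0 (R : realType) d (w : 'rV[R]_d) : dotv w 0 = 0.
Proof. by rewrite /dotv big1// => i _; rewrite mxE mulr0. Qed.

Section Kernel.
Variables (R : realType) (d : nat) (K : 'rV[R]_d -> R).
Variables (lam : {measure set (Rd R d) -> \bar R}) (pK : Rd R d -> R).
Hypothesis lamP : is_lebesgue_Rd lam.
Hypotheses (mpK : measurable_fun setT pK) (pK_ge0 : forall w, 0 <= pK w).
Hypothesis K0 : K 0 = 1.
Hypothesis KE : forall x : 'rV[R]_d,
  (K x)%:E = (\int[lam]_w (pK w * cos (dotv (w : 'rV[R]_d) x))%:E)%E.

Lemma density_mass : (\int[lam]_w (pK w)%:E = 1)%E.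
Proof.
by rewrite -K0 KE; apply: eq_integral => w _; rewrite dotv0 cos0 mulr1.
Qed.

Local Notation mean := (weighted_mean lam pK).

Lemma kernel_mean x : K x = mean (fun w : Rd R d => cos (dotv (w : 'rV[R]_d) x)).
Proof.
apply/EFin_inj; rewrite KE mean_EFin//; first exact: density_mass.
exact: bounded_meas_cos.
Qed.

Lemma kernel_norm_le1 x : `|K x| <= 1.
Proof.
rewrite kernel_mean; apply: le_norm_mean => //.
- exact: density_mass.
- exact: bounded_meas_cos.
- by move=> w; exact: cos_max.
Qed.

Lemma bounded_one_minus_cos (z : 'rV[R]_d) : bounded_meas (fun w : Rd R d => 1 - cos (dotv (w : 'rV[R]_d) z)).
Proof. by apply: bounded_measB; [exact: bounded_meas_cst|exact: bounded_meas_cos]. Qed.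

Lemma one_minus_kernel z : 1 - K z = mean (fun w : Rd R d => 1 - cos (dotv (w : 'rV[R]_d) z)).
Proof.
have m := density_mass.
have b1 := bounded_meas_cst (T := Rd R d) (1 : R); have bc := bounded_meas_cos z.
by rewrite kernel_mean meanB// mean1.
Qed.

Lemma mean_iter_diff2 (F : R -> Rd R d -> R) a t : (forall u, bounded_meas (F u)) ->
  bounded_meas (fun w : Rd R d => iter a (@diff2 R) (F ^~ w) t) /\
  iter a (@diff2 R) (fun u => mean (F u)) t = mean (fun w : Rd R d => iter a (@diff2 R) (F ^~ w) t).
Proof.
move=> bF; have m := density_mass; elim: a t => [|a ih] t; first by split; [exact: bF|].
have [b1 e1] := ih (t + 1); have [b2 e2] := ih (t - 1); have [b3 e3] := ih t.
have b4 := bounded_measM (bounded_meas_cst 2) b3.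
have b5 := bounded_measD b1 b2.
split; first exact: bounded_measB b5 b4.
by rewrite iterS {1}/diff2 e1 e2 e3 -meanZ// -meanD// -meanB.
Qed.

Lemma mean_cos_power a z :
  2 ^+ a * mean (fun w : Rd R d => (1 - cos (dotv (w : 'rV[R]_d) z)) ^+ a) =
  `|iter a (@diff2 R) (fun t => K (t *: z)) 0|.
Proof.
have m := density_mass.
have -> : (fun t => K (t *: z)) = (fun t => mean (fun w : Rd R d => cos (t * dotv (w : 'rV[R]_d) z))).
  by apply/funext => t; rewrite kernel_mean; congr mean; apply/funext => w; rewrite dotvZ.
have bF t : bounded_meas (fun w : Rd R d => cos (t * dotv (w : 'rV[R]_d) z)).
  have := bounded_meas_cos (t *: z); congr bounded_meas.
  by apply/funext => w; rewrite dotvZ.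
have [_ ->] := mean_iter_diff2 a 0 bF.
have bX := bounded_measX a (bounded_one_minus_cos z).
have -> : (fun w : Rd R d => iter a (@diff2 R) (fun t => cos (t * dotv (w : 'rV[R]_d) z)) 0) =
  (fun w => (- 2) ^+ a * (1 - cos (dotv (w : 'rV[R]_d) z)) ^+ a).
  by apply/funext => w; rewrite iter_diff2_cos mul0r cos0 mulr1 exprMn.
rewrite meanZ// normrM normrX normrN (ger0_norm (ler0n R 2)); congr (_ * _).
have nonneg (w : Rd R d) : 0 <= (1 - cos (dotv (w : 'rV[R]_d) z)) ^+ a.
  by rewrite exprn_ge0// subr_ge0 cos_le1.
rewrite ger0_norm// -[leLHS](mean_cst mpK pK_ge0 m).
apply: le_mean => //; exact: bounded_meas_cst.
Qed.

(** Pointwise, since [4 * (1 - cos th) - (1 - cos (2 * th)) = 2 * (1 - cos th) ^+ 2]. *)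
Lemma kernel_doubling z : 1 - K (2 *: z) <= 4 * (1 - K z).
Proof.
have m := density_mass; have b := bounded_one_minus_cos.
rewrite !one_minus_kernel -meanZ//; apply: le_mean => //.
  exact: bounded_measM (bounded_meas_cst 4) (b z).
move=> w; rewrite dotvZ; set th := dotv _ z; rewrite mulr_natl cos_mulr2n.
have := sqr_ge0 (1 - cos th); lra.
Qed.

(** A small nonzero [z] is doubled until its norm lies between 1 and 2, where [mean_cos_far]
    applies. Each doubling multiplies [1 - K] by at most 4, exactly as it does the squared norm, so
    the lower bound is quadratic. *)
Lemma kernel_gap : exists2 c : R, 0 < c &
  forall z, c * Num.min 1 (supnorm z ^+ 2) <= 1 - K z.
Proof.
have m := density_mass.
have [c0 c00 far] := mean_cos_far lamP mpK pK_ge0 m.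
have {}far z : 1 <= supnorm z -> c0 <= 1 - K z.
  by move=> /far; rewrite -kernel_mean; lra.
have K_ge0 z : 0 <= 1 - K z by have := kernel_norm_le1 z; rewrite ler_norml; lra.
exists (c0 / 4); first by rewrite divr_gt0.
move=> z; have [z1|z1] := leP 1 (supnorm z).
  apply: (@le_trans _ _ (c0 / 4 * 1)); first by rewrite ler_pM2l ?divr_gt0// ge_min lexx.
  have := far _ z1; lra.
have [->|zn0] := eqVneq (supnorm z) 0; first by rewrite expr0n/= min_r// mulr0.
have z0 : 0 < supnorm z by rewrite lt_neqAle eq_sym zn0 supnorm_ge0.
have pow n : 1 - K (2 ^+ n *: z) <= 4 ^+ n * (1 - K z).
  elim: n => [|n ih]; first by rewrite !expr0 scale1r mul1r.
  rewrite !exprS -scalerA; apply: (le_trans (kernel_doubling _)).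
  by rewrite -mulrA ler_pM2l.
have ex : exists n, 1 <= 2 ^+ n * supnorm z.
  exists (Num.bound (supnorm z)^-1); rewrite -ler_pdivrMr// mul1r.
  apply: ltW; apply: lt_trans (archi_boundP _) _; first by rewrite invr_ge0 ltW.
  by rewrite -natrX ltr_nat ltn_expl.
case: (ex_minnP ex) => n n1 nmin.
have n2 : 2 ^+ n * supnorm z <= 2.
  case: n n1 nmin => [|n] n1 nmin; first by rewrite mul1r; lra.
  have : ~~ (1 <= 2 ^+ n * supnorm z) by apply/negP => /nmin; rewrite ltnn.
  by rewrite -ltNge exprS; lra.
have : c0 <= 4 ^+ n * (1 - K z).
  apply: le_trans (pow n); apply: far; rewrite supnormZ ?exprn_gt0//.
move=> cn.
have n4 : 4 ^+ n * supnorm z ^+ 2 <= 4.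
  have -> : 4 ^+ n * supnorm z ^+ 2 = (2 ^+ n * supnorm z) ^+ 2.
    by rewrite exprMn -exprM mulnC exprM; congr (_ ^+ _ * _); ring.
  have : (2 ^+ n * supnorm z) ^+ 2 <= 2 ^+ 2 by rewrite lerXn2r ?nnegrE// mulr_ge0 ?exprn_ge0// ltW.
  by move=> /le_trans; apply; lra.
apply: (@le_trans _ _ (c0 / 4 * supnorm z ^+ 2)).
  by rewrite ler_pM2l ?divr_gt0// ge_min lexx orbT.
have p4 : 0 < 4 ^+ n :> R by rewrite exprn_gt0.
rewrite -(ler_pM2l p4); apply: le_trans cn.
have -> : 4 ^+ n * (c0 / 4 * supnorm z ^+ 2) = c0 / 4 * (4 ^+ n * supnorm z ^+ 2) by ring.
by have := ler_wpM2l (ltW (divr_gt0 c00 (ltr0n R 4))) n4; lra.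
Qed.

(* [(-2) ^ a] times the moment is an iterated second difference of [t |-> K (t *: z)]
   at 0, which analyticity controls for small [z]; for the other [z], [1 - K z] is
   bounded away from 0. *)
Lemma kernel_moments (U : set 'rV[R]_d) : analytic_on K U -> U 0 ->
  exists2 B : R, 1 <= B & forall a z,
    mean (fun w : Rd R d => (1 - cos (dotv (w : 'rV[R]_d) z)) ^+ a) <=
    (B * a%:R ^+ 2 * (1 - K z)) ^+ a.
Proof.
move=> aK U0; have m := density_mass.
have [b b1 bP] := analytic_diff2_bound aK U0 kernel_norm_le1.
have [c c0 cP] := kernel_gap.
have K_ge0 z : 0 <= 1 - K z by have := kernel_norm_le1 z; rewrite ler_norml; lra.
(* For large [z] the crude bound [2 ^+ n] on the moment is enough, as [B * c >= 2]; for small [z]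
   the squared norm is at most [(1 - K z) / c]. *)
pose B := b + 2 * b / c.
have bc : 0 < b / c by rewrite divr_gt0//; lra.
exists B; first by rewrite /B; lra.
move=> [|a] z; first by rewrite expr0; under [X in mean X]eq_fun do rewrite expr0; rewrite mean1.
set n := a.+1; have n1 : 1 <= n%:R :> R by rewrite ler1n.
have n2 : 1 <= n%:R ^+ 2 :> R by apply: exprn_ege1.
have cz := cP z.
have [z1|z1] := leP 1 (supnorm z ^+ 2).
  apply: (@le_trans _ _ (2 ^+ n)).
    apply: le_trans (ler_norm _) _; apply: le_norm_mean => //.
      exact: bounded_measX (bounded_one_minus_cos z).
    move=> w; rewrite normrX lerXn2r ?nnegrE//.
    have := cos_geN1 (dotv (w : 'rV[R]_d) z); have := cos_le1 (dotv (w : 'rV[R]_d) z).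
    by move=> ? ?; rewrite ger0_norm; lra.
  apply: lerXn2r; rewrite ?nnegrE//.
    by rewrite mulr_ge0// mulr_ge0 ?sqr_ge0// /B; lra.
  rewrite min_l// mulr1 in cz.
  apply: (@le_trans _ _ (2 * b / c * 1 * c)).
    have -> : 2 * b / c * 1 * c = 2 * b by field; rewrite gt_eqF.
    lra.
  apply: ler_pM => //; [by rewrite mulr1 -mulrA mulr_ge0// ltW|exact: ltW|].
  by apply: ler_pM => //; rewrite /B; lra.
rewrite (min_r (ltW z1)) in cz.
rewrite -(ler_pM2l (exprn_gt0 n (ltr0n R 2))) mean_cos_power.
apply: (le_trans (bP n z _)) => //; rewrite -exprMn.
apply: lerXn2r; rewrite ?nnegrE.
- by rewrite mulr_ge0 ?sqr_ge0// mulr_ge0 ?sqr_ge0//; lra.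
- by rewrite mulr_ge0// mulr_ge0// mulr_ge0 ?sqr_ge0// /B; lra.
have h1 : supnorm z ^+ 2 <= (1 - K z) / c by rewrite ler_pdivlMr// [leLHS]mulrC.
apply: (@le_trans _ _ (b * n%:R ^+ 2 * ((1 - K z) / c))).
  by rewrite ler_wpM2l// mulr_ge0 ?sqr_ge0//; lra.
have -> : b * n%:R ^+ 2 * ((1 - K z) / c) = b / c * (n%:R ^+ 2 * (1 - K z)) by ring.
have -> : 2 * (B * n%:R ^+ 2 * (1 - K z)) = 2 * B * (n%:R ^+ 2 * (1 - K z)) by ring.
by rewrite ler_wpM2r ?mulr_ge0 ?sqr_ge0// /B; lra.
Qed.

End Kernel.

(** * Moments of sums of independent samples *)

Lemma fact_le_pow n : (n`! <= n ^ n)%N.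
Proof.
elim: n => [//|[//|n]] ih; rewrite factS expnS leq_mul2l /=.
by apply: leq_trans ih _; rewrite leq_exp2r.
Qed.

Lemma sqr_le_exp2 b : (b.+2 ^ 2 <= 8 * 2 ^ b)%N.
Proof. by elim: b => [//|b ih]; rewrite [(2 ^ b.+1)%N]expnS; nia. Qed.

Lemma pow_le_fact (R : realType) n : n%:R ^+ n <= expR 1 ^+ n * n`!%:R :> R.
Proof.
case: n => [|n]; first by rewrite !expr0 mulr1.
have f0 : 0 < (n.+1)`!%:R :> R by rewrite ltr0n fact_gt0.
rewrite -expRM_natl mulr1 -ler_pdivrMr//.
have := expR_ge1Dxn n (ler0n R n.+1); lra.
Qed.

Section SumMoment.
Variables (R : realType) (w : nat -> R).

(* The [a]-th moment of the sum of [n] independent copies of a variable with moments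
   [w]; [a!] divided out, these are the coefficients of the [n]-th power of the
   moment generating function. *)
Fixpoint sum_moment n a : R := if n is n'.+1
  then \sum_(b < a.+1) 'C(a, b)%:R * (sum_moment n' (a - b)%N * w b)
  else (a == 0)%:R.

(** Division by factorials turns the binomial recursion into a product of series, and the product of
    truncations contains the truncated product. Truncation is essential: for moments as large as
    [(B b^2) ^ b] the full series can diverge for every [t > 0]. *)
Lemma sum_moment_le N n (t : R) : 0 <= t ->
  \sum_(a < N.+1) t ^+ a * `|sum_moment n a| / a`!%:R <=
  (\sum_(b < N.+1) t ^+ b * `|w b| / b`!%:R) ^+ n.
Proof.
move=> t0; elim: n => [|n ih].
  rewrite expr0 big_ord_recl /= normr1 mulr1 expr0 divr1 big1 ?addr0// => i _.
  by rewrite /= normr0 mulr0 mul0r.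
pose u a := t ^+ a * `|sum_moment n a| / a`!%:R.
pose v b := t ^+ b * `|w b| / b`!%:R.
have f0 a : 0 < a`!%:R :> R by rewrite ltr0n fact_gt0.
have u0 a : 0 <= u a by rewrite !mulr_ge0 ?exprn_ge0// invr_ge0 ltW.
have v0 a : 0 <= v a by rewrite !mulr_ge0 ?exprn_ge0// invr_ge0 ltW.
apply: (@le_trans _ _ (\sum_(a < N.+1) \sum_(b < N.+1 | (b <= a)%N) u (a - b)%N * v b)).
  apply: ler_sum => a _.
  apply: (@le_trans _ _ (\sum_(b < a.+1) u (a - b)%N * v b)); last first.
    by rewrite (big_ord_widen N.+1 (fun b => u (a - b)%N * v b)) ?ltn_ord.
  rewrite /=.
  have ta0 : 0 <= t ^+ a / a`!%:R by rewrite divr_ge0 ?exprn_ge0 ?(ltW (f0 a)).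
  rewrite mulrAC; apply: le_trans (ler_wpM2l ta0 (ler_norm_sum _ _ _)) _.
  rewrite mulr_sumr; apply: ler_sum => b _; have ba : (b <= a)%N by rewrite -ltnS ltn_ord.
  rewrite !normrM normr_nat -{1}(subnK ba) exprD -(bin_fact ba) !natrM /u /v.
  have := f0 b; have := f0 (a - b)%N; have : 0 < 'C(a, b)%:R :> R by rewrite ltr0n bin_gt0.
  move=> c0 d0 e0; rewrite le_eqVlt; apply/orP; left; apply/eqP; field; rewrite !gt_eqF//.
rewrite (exchange_big_dep xpredT)//= exprSr.
apply: (@le_trans _ _ (\sum_(b < N.+1) (\sum_(a < N.+1) u a) * v b)).
  apply: ler_sum => b _; rewrite -mulr_suml ler_wpM2r//.
  rewrite -(big_mkord xpredT u).
  have bN : (b <= N.+1)%N by exact: ltnW (ltn_ord b).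
  rewrite (eq_bigl (fun a : 'I_N.+1 => true && (b <= a)%N))//.
  rewrite -(big_geq_mkord _ _ xpredT (fun a => u (a - b)%N)).
  rewrite -{1}[nat_of_ord b]add0n big_addn.
  under eq_bigr do rewrite addnK.
  rewrite [leRHS](big_cat_nat (leq0n _) (leq_subr b _)) lerDl.
  by apply: sumr_ge0.
rewrite -mulr_sumr ler_wpM2r//; exact: sumr_ge0.
Qed.

Lemma sum_moment_bound B m D : 0 < B -> w 0%N = 1 -> w 1%N = 0 ->
  (forall b, `|w b.+2| <= (B * b.+2%:R ^+ 2) ^+ b.+2) -> (0 < m)%N ->
  8 * m%:R ^+ 3 <= D%:R :> R ->
  `|sum_moment D (2 * m)| <= (32 * expR 1 ^+ 4 * B ^+ 2 * m%:R * D%:R) ^+ m.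
Proof.
move=> B0 w0 w1 wb m0 mD.
have m1 : 0 < m%:R :> R by rewrite ltr0n.
have m3 : 0 < m%:R ^+ 3 :> R by exact: exprn_gt0.
have D0 : 0 < D%:R :> R by lra.
have e0 : 0 < expR 1 :> R := expR_gt0 1.
pose c := expR 1 * B; have c0 : 0 < c by exact: mulr_gt0.
(* Balanced so that [16 * (c * t) ^+ 2 * D = 2 * m], which bounds the [D]-th power of the series by
   [expR 1 ^+ (2 * m)]. The condition [8 m^3 <= D] then says that [c * t * b <= 1 / 4] for all
   [b <= 2 * m]. *)
pose t := Num.sqrt (m%:R / (8 * c ^+ 2 * D%:R)).
have q0 : 0 < m%:R / (8 * c ^+ 2 * D%:R) by rewrite divr_gt0// !mulr_gt0 ?exprn_gt0.
have t0 : 0 < t by rewrite sqrtr_gt0.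
have t2 : t ^+ 2 = m%:R / (8 * c ^+ 2 * D%:R) by rewrite sqr_sqrtr// ltW.
have ct : (c * t) ^+ 2 = m%:R / (8 * D%:R).
  by rewrite exprMn t2; field; rewrite !gt_eqF.
have ctm : c * t * (2 * m%:R) <= 4^-1.
  have ct0 : 0 <= c * t * (2 * m%:R) by rewrite !mulr_ge0// ltW.
  rewrite -(ler_pXn2r (ltn0Sn 1)) ?nnegrE ?invr_ge0//.
  rewrite exprMn ct.
  have -> : m%:R / (8 * D%:R) * (2 * m%:R) ^+ 2 = m%:R ^+ 3 / (2 * D%:R) :> R.
    by field; rewrite gt_eqF.
  by rewrite ler_pdivrMr ?mulr_gt0//; lra.
(* Two of the [b + 2] factors [c * t * (b + 2)] are set aside. The others are at most 1/4 each,
   which outweighs [(b + 2) ^ 2 <= 8 * 2 ^ b] and leaves a geometric series of ratio 1/2. *)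
have term b : (b.+2 <= 2 * m)%N ->
    t ^+ b.+2 * `|w b.+2| / b.+2`!%:R <= 8 * (c * t) ^+ 2 * 2^-1 ^+ b.
  move=> bm; have f0 : 0 < b.+2`!%:R :> R by rewrite ltr0n fact_gt0.
  apply: (@le_trans _ _ ((c * t * b.+2%:R) ^+ b.+2)).
    rewrite ler_pdivrMr//; apply: (le_trans (ler_wpM2l (exprn_ge0 _ (ltW t0)) (wb b))).
    have := pow_le_fact R b.+2; move: f0; move: (b.+2`!%:R) (b.+2%:R : R) (ler0n R b.+2) => f n n0 f0.
    move: (b.+2) => k /(ler_wpM2l (exprn_ge0 k (mulr_ge0 (mulr_ge0 (ltW t0) (ltW B0)) n0))).
    rewrite mulrA -!exprMn.
    have -> : t * B * n * expR 1 = c * t * n by rewrite /c; ring.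
    by have -> : t * B * n * n = t * (B * n ^+ 2) by ring.
  rewrite -addn2 exprD addn2 mulrC.
  have s1 : (c * t * b.+2%:R) ^+ b <= 4^-1 ^+ b.
    have ct0 : 0 <= c * t by rewrite mulr_ge0// ltW.
    have ctb : 0 <= c * t * b.+2%:R by exact: mulr_ge0.
    apply: lerXn2r; rewrite ?nnegrE ?invr_ge0//.
    by apply: le_trans ctm; rewrite ler_wpM2l// -natrM ler_nat.
  have s2 : b.+2%:R ^+ 2 <= 8 * 2 ^+ b :> R.
    rewrite -natrX -natrX -natrM ler_nat; exact: sqr_le_exp2.
  rewrite exprMn; apply: le_trans (ler_pM _ _ (ler_wpM2l (sqr_ge0 (c * t)) s2) s1) _.
  - by rewrite mulr_ge0 ?sqr_ge0.
  - by rewrite exprn_ge0// !mulr_ge0// ltW.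
  - have -> : (4^-1 : R) ^+ b = 2^-1 ^+ b * 2^-1 ^+ b by rewrite -exprMn; congr (_ ^+ _); field.
    have E : 2 ^+ b * 2^-1 ^+ b = 1 :> R by rewrite -exprMn divff ?expr1n.
    rewrite le_eqVlt; apply/orP; left; apply/eqP.
    transitivity (8 * (c * t) ^+ 2 * 2^-1 ^+ b * (2 ^+ b * 2^-1 ^+ b)); last by rewrite E mulr1.
    by move: (2 ^+ b) (2^-1 ^+ b) => q1 q2; ring.
have geo n : \sum_(i < n) 2^-1 ^+ i <= 2 :> R.
  suff : \sum_(i < n) 2^-1 ^+ i = 2 - 2 * 2^-1 ^+ n :> R.
    by move=> ->; have : 0 <= 2^-1 ^+ n :> R by [exact: exprn_ge0]; lra.
  elim: n => [|n ih]; first by rewrite big_ord0 expr0; lra.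
  by rewrite big_ord_recr /= ih exprS; lra.
have base : \sum_(b < (2 * m).+1) t ^+ b * `|w b| / b`!%:R <= 1 + 16 * (c * t) ^+ 2.
  have [n mn] : exists n, (2 * m = n.+1)%N by exists (2 * m).-1; rewrite prednK// muln_gt0.
  rewrite mn 2!big_ord_recl /= /bump /= w0 w1 normr0 normr1 expr0 mulr0 mul0r add0r.
  rewrite mulr1 fact0 divr1 lerD2l.
  apply: (@le_trans _ _ (\sum_(i < n) 8 * (c * t) ^+ 2 * 2^-1 ^+ i)).
    by apply: ler_sum => i _; apply: term; rewrite mn !ltnS ltn_ord.
  rewrite -mulr_sumr; have := ler_wpM2l (sqr_ge0 (c * t)) (geo n); lra.
have f0 : 0 < (2 * m)`!%:R :> R by rewrite ltr0n fact_gt0.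
have tm : 0 < t ^+ (2 * m) by exact: exprn_gt0.
have ub : t ^+ (2 * m) * `|sum_moment D (2 * m)| / (2 * m)`!%:R <= expR 1 ^+ (2 * m).
  have := sum_moment_le (2 * m) D (ltW t0); rewrite big_ord_recr /=.
  have : 0 <= \sum_(i < 2 * m) t ^+ i * `|sum_moment D i| / i`!%:R.
    by apply: sumr_ge0 => i _; rewrite divr_ge0 ?mulr_ge0 ?exprn_ge0// ltW.
  move=> s0 s1; apply: (le_trans (le_trans _ s1)); first by rewrite lerDr.
  have b0 : 0 <= \sum_(b < (2 * m).+1) t ^+ b * `|w b| / b`!%:R.
    by apply: sumr_ge0 => i _; rewrite divr_ge0 ?mulr_ge0 ?exprn_ge0// ltW.
  apply: (@le_trans _ _ (expR (16 * (c * t) ^+ 2) ^+ D)).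
    apply: lerXn2r; rewrite ?nnegrE ?expR_ge0//.
    by apply: le_trans base (expR_ge1Dx _).
  rewrite -!expRM_natl ct; rewrite le_eqVlt; apply/orP; left; apply/eqP; congr expR.
  by rewrite natrM; field; rewrite gt_eqF.
rewrite ler_pdivrMr// -ler_pdivlMl// in ub; apply: le_trans ub _.
rewrite ler_pdivrMl//.
have : (2 * m)`!%:R <= (2 * m)%:R ^+ (2 * m) :> R by rewrite -natrX ler_nat fact_le_pow.
move=> /(ler_wpM2l (exprn_ge0 (2 * m) (ltW e0))) /le_trans; apply.
rewrite !exprM -!exprMn t2; rewrite le_eqVlt; apply/orP; left; apply/eqP; congr (_ ^+ _).
by rewrite natrM /c; field; rewrite !gt_eqF.
Qed.

End SumMoment.

Section IndependentSample.
Variables (R : realType) (d : nat).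
Variables (lam : {measure set (Rd R d) -> \bar R}) (pK : Rd R d -> R).
Hypotheses (mpK : measurable_fun setT pK) (pK_ge0 : forall w, 0 <= pK w).
Hypothesis pK_mass : (\int[lam]_w (pK w)%:E = 1)%E.
Context (dT : measure_display) (T : measurableType dT).
Variables (Pr : probability T R) (D : nat) (om : 'I_D -> T -> Rd R d).
Hypothesis iid : iid_with_density Pr om lam pK.

Definition expected : (T -> R) -> R := weighted_mean Pr (fun=> 1).
Local Notation expect := expected.
Local Notation mean := (weighted_mean lam pK).

Let m1 : measurable_fun [set: T] (fun _ : T => 1 : R). Proof. exact: measurable_cst. Qed.

Let one_ge0 (t : T) : 0 <= (1 : R). Proof. exact: ler01. Qed.

Lemma expect_mass : (\int[Pr]_t (1 : R)%:E = 1)%E.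
Proof. by rewrite integral_cst// mul1e; exact: probability_setT. Qed.

Lemma om_measurable j : measurable_fun setT (om j). Proof. by case: iid. Qed.

Lemma bounded_meas_om j (f : Rd R d -> R) : bounded_meas f -> bounded_meas (fun t => f (om j t)).
Proof.
move=> [mf [c fc]]; split; last by exists c.
exact: (measurableT_comp mf (om_measurable j)).
Qed.

Lemma bounded_meas_indic (dS : measure_display) (S : measurableType dS) (A : set S) : measurable A ->
  bounded_meas (\1_A : S -> R).
Proof.
move=> mA; split; first exact: measurable_indic.
by exists 1 => w; rewrite indicE; case: (_ \in _); rewrite ?normr1 ?normr0.
Qed.

Lemma bounded_meas_prod (dS : measure_display) (S : measurableType dS) (J : finType) (P : pred J) (f : J -> S -> R) :
  (forall j, bounded_meas (f j)) -> bounded_meas (fun t => \prod_(j | P j) f j t).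
Proof.
move=> bf; elim: (index_enum J) => [|j r ih].
  by under eq_fun do rewrite big_nil; exact: bounded_meas_cst.
under eq_fun do rewrite big_cons.
by case: (P j) => //; apply: bounded_measM.
Qed.

Lemma mean_indic (A : set (Rd R d)) : measurable A -> mean \1_A = fine (\int[lam]_(w in A) (pK w)%:E)%E.
Proof.
move=> mA; rewrite /weighted_mean /Rintegral; congr fine; rewrite [RHS]integral_mkcond.
apply: eq_integral => w _; rewrite patchE indicE; case: (_ \in _).
  by rewrite mulr1.
by rewrite mulr0.
Qed.

Lemma expect_indicators (A : 'I_D -> set (Rd R d)) : (forall j, measurable (A j)) ->
  expect (fun t => \prod_j \1_(A j) (om j t)) = \prod_j mean \1_(A j).
Proof.
move=> mA; case: iid => mom law ind.
have -> : (fun t => \prod_j \1_(A j) (om j t)) = \1_(\bigcap_(j in [set: 'I_D]) om j @^-1` A j) :> (T -> R).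
  apply/funext => t; rewrite indicE; case: (boolP (t \in _)) => [/set_mem h|/negP h].
    by rewrite big1// => j _; rewrite indicE mem_set//; exact: h.
  have [j /negP nj] : exists j, ~ (om j t \in A j).
    apply: contrapT => /forallNP nA; apply: h; apply/mem_set => j _ /=.
    by have /contrapT/set_mem := nA j.
  by rewrite (bigD1 j)//= indicE (negbTE nj) mul0r.
rewrite /expected /weighted_mean /Rintegral.
under eq_integral do rewrite mul1r.
rewrite integral_indic// ?setIT; last first.
  apply: fin_bigcap_measurable => [|j _]; first exact: finite_finset.
  by rewrite -[X in measurable X]setTI; exact: mom.
transitivity (\prod_j fine (Pr (om j @^-1` A j))); first exact: (congr1 fine (ind A mA)).
apply: eq_bigr => j _.
by rewrite (congr1 fine (law j (A j) (mA j))); exact/esym/mean_indic.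
Qed.


Let swap (g : 'I_D -> Rd R d -> R) n f j := if j == n then f else g j.

Let expect_swap g n f : expect (fun t => \prod_j swap g n f j (om j t)) =
  expect (fun t => (\prod_(j | j != n) g j (om j t)) * f (om n t)).
Proof.
congr expect; apply/funext => t; rewrite (bigD1 n)//= /swap eqxx mulrC; congr (_ * _).
by apply: eq_bigr => j /negbTE ->.
Qed.

Let mean_swap g n f : \prod_j mean (swap g n f j) = (\prod_(j | j != n) mean (g j)) * mean f.
Proof.
rewrite (bigD1 n)//= /swap eqxx mulrC; congr (_ * _).
by apply: eq_bigr => j /negbTE ->.
Qed.

Let swap_id g n : swap g n (g n) = g.
Proof. by apply/funext => j; rewrite /swap; case: eqP => [->|]. Qed.

Let mean_ge0 (f : Rd R d -> R) : (forall w, 0 <= f w) -> 0 <= mean f.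
Proof. by move=> f0; apply: Rintegral_ge0 => w _; rewrite mulr_ge0. Qed.

Let bounded_others (g : 'I_D -> Rd R d -> R) n : (forall j, bounded_meas (g j)) ->
  bounded_meas (fun t => \prod_(j | j != n) g j (om j t)).
Proof. by move=> bg; apply: bounded_meas_prod => j; exact: bounded_meas_om. Qed.

Let expect_prod_nonneg n (g : 'I_D -> Rd R d -> R) : (forall j, bounded_meas (g j)) ->
  (forall j w, 0 <= g j w) ->
  (forall j : 'I_D, (n <= j)%N -> exists2 A, measurable A & g j = \1_A) ->
  expect (fun t => \prod_j g j (om j t)) = \prod_j mean (g j).
Proof.
elim: n g => [|n ih] g bg g0 gA.
  have [A AP] := choice (fun j => let: ex_intro2 A mA gA := gA j (leq0n j) in
    ex_intro (fun A => measurable A /\ g j = \1_A) A (conj mA gA)).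
  have -> : g = fun j => \1_(A j) by apply/funext => j; case: (AP j).
  by apply: expect_indicators => j; case: (AP j).
have [nD|Dn] := ltnP n D; last first.
  by apply: ih => // j nj; have := leq_trans (ltn_ord j) Dn; rewrite ltnNge nj.
pose k := Ordinal nD; have b' := bounded_others k bg.
pose c := \prod_(j | j != k) mean (g j).
have c0 : 0 <= c by apply: prodr_ge0 => j _; exact: mean_ge0.
have W0 t : 0 <= \prod_(j | j != k) g j (om j t) by exact: prodr_ge0.
have bW f : bounded_meas f -> bounded_meas (fun t => (\prod_(j | j != k) g j (om j t)) * f (om k t)).
  by move=> bf; apply: bounded_measM => //; exact: bounded_meas_om.
have mcp : measurable_fun setT (fun w => c * pK w) by exact: measurable_funM.
have cE f : bounded_meas f -> (\int[lam]_w (c * pK w * f w)%:E = (c * mean f)%:E)%E.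
  move=> bf; rewrite -meanZ// mean_EFin//; last exact: bounded_measM (bounded_meas_cst c) bf.
  by apply: eq_integral => w _; rewrite mulrA [c * pK w]mulrC -!mulrA.
have lE f : bounded_meas f ->
    (\int[Pr]_t ((\prod_(j | j != k) g j (om j t)) * f (om k t))%:E =
     (expect (fun t => (\prod_(j | j != k) g j (om j t)) * f (om k t)))%:E)%E.
  move=> bf; rewrite mean_EFin//; [|exact: expect_mass|exact: bW].
  by apply: eq_integral => t _; rewrite mul1r.
rewrite -(swap_id g k) expect_swap mean_swap; apply: EFin_inj.
rewrite -lE// -/c -cE//.
(* Factor [k] is integrated against [Pr] weighted by the other factors on one side, and against the
   density scaled by [c] on the other. For indicators the two agree by [ih]. *)
apply: (weighted_integral_eq (X1 := om k) (X2 := id)) => //.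
- exact: om_measurable.
- exact: b'.1.
- by move=> w; rewrite mulr_ge0.
- move=> A mA; rewrite lE ?cE//; try exact: bounded_meas_indic.
  rewrite -expect_swap -mean_swap; congr EFin; apply: ih.
  + by move=> j; rewrite /swap; case: eqP => // _; exact: bounded_meas_indic.
  + by move=> j w; rewrite /swap; case: eqP => // _; rewrite indicE.
  + move=> j nj; rewrite /swap; case: eqP => [_|/eqP jk]; first by exists A.
    by apply: gA; rewrite ltn_neqAle nj andbT eq_sym.
- exact: (bg k).1.
Qed.

(* Indicator functions are replaced by nonnegative functions one factor at a time,
   and then by signed ones after adding a constant. *)
Lemma expect_prod (g : 'I_D -> Rd R d -> R) : (forall j, bounded_meas (g j)) ->
  expect (fun t => \prod_j g j (om j t)) = \prod_j mean (g j).
Proof.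
move=> bg.
suff H n : forall g : 'I_D -> Rd R d -> R, (forall j, bounded_meas (g j)) ->
    (forall j : 'I_D, (n <= j)%N -> forall w, 0 <= g j w) ->
    expect (fun t => \prod_j g j (om j t)) = \prod_j mean (g j).
  by apply: (H D) => // j; rewrite leqNgt ltn_ord.
elim: n {g bg} => [|n ih] g bg g0.
  by apply: (@expect_prod_nonneg D) => // [j|j]; [exact: g0|by rewrite leqNgt ltn_ord].
have [nD|Dn] := ltnP n D; last first.
  by apply: ih => // j nj; have := leq_trans (ltn_ord j) Dn; rewrite ltnNge nj.
pose k := Ordinal nD; have [mgk [c gc]] := bg k.
have step f : bounded_meas f -> (forall w, 0 <= f w) ->
    expect (fun t => (\prod_(j | j != k) g j (om j t)) * f (om k t)) =
    (\prod_(j | j != k) mean (g j)) * mean f.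
  move=> bf f0; rewrite -expect_swap -mean_swap; apply: ih.
    by move=> j; rewrite /swap; case: eqP.
  move=> j nj w; rewrite /swap; case: eqP => [//|/eqP jk].
  by apply: g0; rewrite ltn_neqAle nj andbT eq_sym.
have bc := bounded_meas_cst (T := Rd R d) c.
have bgc := bounded_measD (bg k) bc.
have b' := bounded_others k bg.
have em := expect_mass.
rewrite -(swap_id g k) expect_swap mean_swap.
have c0 : 0 <= c by apply: le_trans (gc point); exact: normr_ge0.
have := step _ bc (fun _ => c0); have := step _ bgc.
have -> : (fun t => (\prod_(j | j != k) g j (om j t)) * (g k (om k t) + c)) =
   (fun t => (\prod_(j | j != k) g j (om j t)) * g k (om k t) +
             (\prod_(j | j != k) g j (om j t)) * c).
  by apply/funext => t; rewrite mulrDr.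
have b1 := bounded_measM b' (bounded_meas_om k (bg k)).
have b2 := bounded_measM b' (bounded_meas_cst (T := T) c).
rewrite /expected meanD//.
rewrite meanD// mulrDr => e1 e2; rewrite e2 in e1; apply: (addIr ((\prod_(j | j != k) mean (g j)) * mean (fun=> c))).
by apply: e1 => w; have := gc w; rewrite ler_norml; lra.
Qed.

End IndependentSample.

Section SampleMoments.
Variables (R : realType) (d : nat).
Variables (lam : {measure set (Rd R d) -> \bar R}) (pK : Rd R d -> R).
Hypotheses (mpK : measurable_fun setT pK) (pK_ge0 : forall w, 0 <= pK w).
Hypothesis pK_mass : (\int[lam]_w (pK w)%:E = 1)%E.
Context (dT : measure_display) (T : measurableType dT).
Variables (Pr : probability T R) (D : nat) (om : 'I_D -> T -> Rd R d).
Hypothesis iid : iid_with_density Pr om lam pK.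
Local Notation mean := (weighted_mean lam pK).
Local Notation expect := (expected Pr).

Let m1 : measurable_fun [set: T] (fun _ : T => 1 : R). Proof. exact: measurable_cst. Qed.

Let one_ge0 (t : T) : 0 <= (1 : R). Proof. exact: ler01. Qed.

Let mass1 := expect_mass Pr.

Lemma bounded_meas_sum (dS : measure_display) (S : measurableType dS) (J : finType) (P : pred J) (f : J -> S -> R) :
  (forall j, bounded_meas (f j)) -> bounded_meas (fun t => \sum_(j | P j) f j t).
Proof.
move=> bf; elim: (index_enum J) => [|j r ih].
  by under eq_fun do rewrite big_nil; exact: bounded_meas_cst.
under eq_fun do rewrite big_cons.
by case: (P j) => //; apply: bounded_measD.
Qed.

Lemma expectZ c (f : T -> R) : bounded_meas f -> expect (fun t => c * f t) = c * expect f.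
Proof. by move=> bf; exact: (meanZ m1 one_ge0 mass1). Qed.

Lemma expect_cst c : expect (fun=> c) = c.
Proof. exact: (mean_cst m1 one_ge0 mass1). Qed.

Lemma expect_sum (J : finType) (P : pred J) (f : J -> T -> R) : (forall j, bounded_meas (f j)) ->
  expect (fun t => \sum_(j | P j) f j t) = \sum_(j | P j) expect (f j).
Proof.
move=> bf; suff [_ ->] : bounded_meas (fun t => \sum_(j | P j) f j t) /\
  expect (fun t => \sum_(j | P j) f j t) = \sum_(j | P j) expect (f j) by [].
elim: (index_enum J) => [|j r [ihb ihe]].
  under eq_fun do rewrite big_nil.
  by split; [exact: bounded_meas_cst|rewrite big_nil; exact: (mean_cst m1 one_ge0 mass1)].
rewrite big_cons; under eq_fun do rewrite big_cons.
case: (P j) => //; split; first exact: bounded_measD.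
by rewrite /expected (meanD m1 one_ge0 mass1)//; congr (_ + _).
Qed.

(* Carrying the samples that are not summed yet as a factor keeps the induction within
   products of functions of single samples. *)
Lemma expect_sum_pow (W : Rd R d -> R) : bounded_meas W -> forall n a (g : 'I_D -> Rd R d -> R),
  (n <= D)%N -> (forall j, bounded_meas (g j)) ->
  expect (fun t => (\sum_(j < D | (j < n)%N) W (om j t)) ^+ a *
    \prod_(j < D | (n <= j)%N) g j (om j t)) =
  sum_moment (fun b => mean (fun w => W w ^+ b)) n a * \prod_(j < D | (n <= j)%N) mean (g j).
Proof.
move=> bW; elim=> [|n ih] a g nD bg.
  rewrite /= -(expect_prod mpK pK_ge0 pK_mass iid bg) -expectZ; last first.
    by apply: bounded_meas_prod => j; exact: (bounded_meas_om iid).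
  by congr expect; apply/funext => t; rewrite big_pred0// expr0n.
pose k := Ordinal nD.
pose G (b : 'I_a.+1) j : Rd R d -> R := if j == k then fun w => W w ^+ b else g j.
have bG b j : bounded_meas (G b j) by rewrite /G; case: eqP => // _; exact: bounded_measX.
have prodG (F : (Rd R d -> R) -> 'I_D -> R) b : \prod_(j < D | (n <= j)%N) F (G b j) j =
    F (fun w => W w ^+ b) k * \prod_(j < D | (n < j)%N) F (g j) j.
  rewrite (bigD1 k)//= {1}/G eqxx; congr (_ * _).
  rewrite (eq_bigl (fun j : 'I_D => (n < j)%N)) => [|j]; last first.
    by rewrite ltn_neqAle eq_sym andbC.
  by apply: eq_bigr => j nj; rewrite /G -val_eqE gtn_eqF.
have bS n' b : bounded_meas (fun t => (\sum_(j < D | (j < n')%N) W (om j t)) ^+ b).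
  by apply: bounded_measX; apply: bounded_meas_sum => j; exact: (bounded_meas_om iid).
transitivity (expect (fun t => \sum_(b < a.+1) 'C(a, b)%:R * ((\sum_(j < D | (j < n)%N) W (om j t)) ^+ (a - b) *
    \prod_(j < D | (n <= j)%N) G b j (om j t)))).
  congr expect; apply/funext => t.
  rewrite (bigD1 k)//= addrC (eq_bigl (fun j : 'I_D => (j < n)%N)); last first.
    by move=> j; rewrite -val_eqE /= ltnS andbC -ltn_neqAle.
  rewrite exprDn mulr_suml; apply: eq_bigr => b _.
  rewrite (prodG (fun f j => f (om j t))) -mulr_natl; ring.
rewrite expect_sum => [|b]; last first.
  apply: bounded_measM; first exact: bounded_meas_cst.
  apply: bounded_measM => //; apply: bounded_meas_prod => j; exact: (bounded_meas_om iid).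
rewrite /= mulr_suml; apply: eq_bigr => b _; rewrite expectZ; last first.
  apply: bounded_measM => //; apply: bounded_meas_prod => j; exact: (bounded_meas_om iid).
rewrite ih// ?(ltnW nD)// (prodG (fun f j => mean f)); ring.
Qed.

Section Concentration.
Variables (Y : Rd R d -> R) (B : R).
Hypotheses (bY : bounded_meas Y) (Y_ge0 : forall w, 0 <= Y w) (B_ge1 : 1 <= B).
Hypothesis Y_pos : 0 < mean Y.
Hypothesis Y_moment : forall a, mean (fun w => Y w ^+ a) <= (B * a%:R ^+ 2 * mean Y) ^+ a.

Let W w := Y w / mean Y - 1.

Let bW : bounded_meas W.
Proof. by apply: bounded_measB; [apply: bounded_measM => //|]; exact: bounded_meas_cst. Qed.

(** For [y >= 0] the power [b] of the absolute value of [y - 1] is at most [y ^+ b + 1]. Both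
    summands have mean at most [(B b^2) ^ b], and the sum is absorbed by the factor 2 in the
    base. *)
Let W_moment b : `|mean (fun w => W w ^+ b.+2)| <= (2 * B * b.+2%:R ^+ 2) ^+ b.+2.
Proof.
have B1 := B_ge1; move: b.+2 (ltn0Sn b.+1) => {}b b0.
have mY0 := Y_pos.
have bG : bounded_meas (fun w => (mean Y)^-1 ^+ b * Y w ^+ b).
  by apply: bounded_measM; [exact: bounded_meas_cst|exact: bounded_measX].
have bG1 : bounded_meas (fun w => (mean Y)^-1 ^+ b * Y w ^+ b + 1).
  by apply: bounded_measD => //; exact: bounded_meas_cst.
have WG w : `|W w ^+ b| <= (mean Y)^-1 ^+ b * Y w ^+ b + 1.
  rewrite normrX -exprMn mulrC; have y0 : 0 <= Y w / mean Y by rewrite divr_ge0// ltW.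
  rewrite /W; move: (Y w / mean Y) y0 => y y0; have [y1|y1] := leP y 1.
    apply: (@le_trans _ _ 1); last by rewrite lerDr exprn_ge0.
    by rewrite exprn_ile1// ler_norml; lra.
  apply: (@le_trans _ _ (y ^+ b)); last by rewrite lerDl.
  by apply: lerXn2r; rewrite ?nnegrE// ler_norml; lra.
have h1 : `|mean (fun w => W w ^+ b)| <= mean (fun w => (mean Y)^-1 ^+ b * Y w ^+ b + 1).
  have bWb := bounded_measX b bW.
  rewrite ler_norml; apply/andP; split; last first.
    by apply: (le_mean mpK pK_ge0 pK_mass) => // w; exact: le_trans (ler_norm _) (WG w).
  rewrite lerNl -mulN1r -(meanZ mpK pK_ge0 pK_mass)//.
  apply: (le_mean mpK pK_ge0 pK_mass) => // [|w].
    by apply: bounded_measM => //; exact: bounded_meas_cst.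
  by rewrite mulN1r; apply: le_trans (ler_norm _) _; rewrite normrN.
apply: le_trans h1 _; rewrite (meanD mpK pK_ge0 pK_mass)//; last exact: bounded_meas_cst.
rewrite (mean_cst mpK pK_ge0 pK_mass) (meanZ mpK pK_ge0 pK_mass)//; last exact: bounded_measX.
have i0 : 0 <= (mean Y)^-1 ^+ b by rewrite exprn_ge0// invr_ge0 ltW.
have := ler_wpM2l i0 (Y_moment b); rewrite -exprMn.
have -> : (mean Y)^-1 * (B * b%:R ^+ 2 * mean Y) = B * b%:R ^+ 2 by field; rewrite gt_eqF.
move=> h2; have b1 : 1 <= b%:R :> R by rewrite ler1n.
have h3 : 1 <= B * b%:R ^+ 2 by nra.
have h4 : 1 <= (B * b%:R ^+ 2) ^+ b by exact: exprn_ege1.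
have -> : 2 * B * b%:R ^+ 2 = 2 * (B * b%:R ^+ 2) by ring.
rewrite [leRHS]exprMn.
have : 2 <= 2 ^+ b :> R by rewrite -{1}[2]expr1 ler_eXn2l ?ltr1n.
nra.
Qed.

(** The constant makes [32 * expR 1 ^+ 4 * (2 * B) ^+ 2 * m / (D * e ^+ 2)], the base of the [m]-th
    power from [sum_moment_bound], at most [(expR 1)^-1]. *)
Lemma sample_concentration m (e : R) : (0 < m)%N -> 0 < e ->
  8 * m%:R ^+ 3 <= D%:R :> R -> 128 * expR 1 ^+ 5 * B ^+ 2 * m%:R / e ^+ 2 <= D%:R ->
  expect (fun t => (((\sum_j Y (om j t)) / (D%:R * mean Y) - 1) / e) ^+ (2 * m)) <= expR (- m%:R).
Proof.
move=> m0 e0 mD eD; have mY0 := Y_pos; have B1 := B_ge1.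
have m1' : 0 < m%:R :> R by rewrite ltr0n.
have D0 : 0 < D%:R :> R by have : 0 < m%:R ^+ 3 :> R by [exact: exprn_gt0]; lra.
have -> : (fun t => (((\sum_j Y (om j t)) / (D%:R * mean Y) - 1) / e) ^+ (2 * m)) =
   (fun t => (D%:R * e)^-1 ^+ (2 * m) * ((\sum_(j < D | (j < D)%N) W (om j t)) ^+ (2 * m) *
      \prod_(j < D | (D <= j)%N) (fun=> 1) (om j t))).
  apply/funext => t; rewrite [\prod_(_ | _) _]big1// mulr1 -exprMn; congr (_ ^+ _).
  have -> : \sum_(j < D | (j < D)%N) W (om j t) = \sum_j W (om j t).
    by apply: eq_bigl => j; rewrite ltn_ord.
  rewrite /W big_split/= -mulr_suml sumr_const card_ord -mulr_natl.
  by field; rewrite !gt_eqF.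
rewrite expectZ; last first.
  apply: bounded_measM; last by apply: bounded_meas_prod => j; exact: bounded_meas_cst.
  by apply: bounded_measX; apply: bounded_meas_sum => j; exact: (bounded_meas_om iid).
rewrite (@expect_sum_pow W bW D (2 * m) (fun _ _ => 1))//; last by move=> _; exact: bounded_meas_cst.
rewrite big_pred0 ?mulr1 => [|j]; last by rewrite leqNgt ltn_ord.
have e1 : 0 < expR 1 :> R := expR_gt0 1.
have De : 0 < D%:R * e by exact: mulr_gt0.
have i0 : 0 <= (D%:R * e)^-1 ^+ (2 * m) by rewrite exprn_ge0// invr_ge0 ltW.
have W1 : mean (fun w => W w ^+ 1) = 0.
  rewrite /W (meanB mpK pK_ge0 pK_mass); [|by apply: bounded_measM => //; exact: bounded_meas_cst|exact: bounded_meas_cst].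
  under [fun=> _ / _]eq_fun do rewrite mulrC.
  by rewrite (meanZ mpK pK_ge0 pK_mass)// mulVf ?gt_eqF// (mean_cst mpK pK_ge0 pK_mass) subrr.
have B20 : 0 < 2 * B by lra.
have := @sum_moment_bound R (fun b => mean (fun w => W w ^+ b)) (2 * B) m D B20
  (mean1 pK_mass) W1 W_moment m0 mD.
move=> /(le_trans (ler_norm _)) /(ler_wpM2l i0) /le_trans; apply.
rewrite exprM -exprMn.
have -> : expR (- m%:R) = (expR 1)^-1 ^+ m :> R.
  by rewrite exprVn -expRM_natl mulr1 expRN.
have X0 : 0 <= 32 * expR 1 ^+ 4 * (2 * B) ^+ 2 * m%:R * D%:R.
  have : 0 <= B by lra.
  by move=> ?; rewrite !mulr_ge0// ?exprn_ge0 ?expR_ge0// mulr_ge0.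
apply: lerXn2r; rewrite ?nnegrE.
- by rewrite mulr_ge0// exprn_ge0// invr_ge0 ltW.
- by rewrite invr_ge0 expR_ge0.
move: eD; rewrite ler_pdivrMr ?exprn_gt0// => /(ler_wpM2l (ltW D0)) eD.
rewrite exprVn ler_pdivrMl ?exprn_gt0// ler_pdivlMr//.
move: eD; rewrite exprMn; lra.
Qed.

End Concentration.
End SampleMoments.

(** * Distortion and choice of parameters *)

Section Distortion.
Variables (R : realType) (d d' e p : R) (m : nat).
Hypotheses (d_ge0 : 0 <= d) (d'_ge0 : 0 <= d') (d'_eq0 : d = 0 -> d' = 0).
Hypotheses (p_ge1 : 1 <= p) (e_gt0 : 0 < e) (ep_le1 : e * p <= 2^-1) (pm : p <= m%:R).

(* For [d = 0 < m] the division by zero makes this 0. *)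
Definition distortion : R := ((d' ^+ 2 - d ^+ 2) / (e * d ^+ 2)) ^+ (2 * m).

Lemma distortion_ge0 : 0 <= distortion.
Proof. by rewrite /distortion exprM exprn_ge0// sqr_ge0. Qed.

Lemma distortion_ok : distortion <= 1 -> (1 - e) * d <= d' <= (1 + e) * d.
Proof.
have p1 := p_ge1; have e0 := e_gt0; have ep := ep_le1.
have e1 : e <= 2^-1 by apply: le_trans ep; rewrite ler_peMr// ltW.
have m0 : (0 < 2 * m)%N by rewrite muln_gt0/= -(ltr0n R) (lt_le_trans _ pm)//; lra.
move: d_ge0; rewrite le_eqVlt => /orP[/eqP d0|d0].
  by rewrite d'_eq0 -?d0// !mulr0 lexx.
have d20 : 0 < d ^+ 2 by exact: exprn_gt0.
move=> h; have : `|(d' ^+ 2 - d ^+ 2) / (e * d ^+ 2)| <= 1.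
  rewrite leNgt; apply/negP => /(@exprn_egt1 _ (2 * m)%N); rewrite -lt0n m0.
  by rewrite -normrX ger0_norm ?ltNge ?h// exprM exprn_ge0// sqr_ge0.
rewrite normrM normfV (gtr0_norm (mulr_gt0 e0 d20)) ler_pdivrMr ?mulr_gt0// mul1r.
rewrite ler_norml => /andP[h1 h2]; have d'0 := d'_ge0.
apply/andP; split.
  rewrite -(ler_pXn2r (ltn0Sn 1)) ?nnegrE ?mulr_ge0//; last lra.
  rewrite exprMn; have : (1 - e) ^+ 2 <= 1 - e by rewrite expr2 ler_piMl; lra.
  by move=> /(ler_wpM2r (ltW d20)); lra.
rewrite -(ler_pXn2r (ltn0Sn 1)) ?nnegrE ?mulr_ge0//; last lra.
rewrite exprMn; have : 1 + e <= (1 + e) ^+ 2 by rewrite expr2 ler_peMl; lra.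
by move=> /(ler_wpM2r (ltW d20)); lra.
Qed.

(** For [r > 1 + e], the ratio [r] of the squares is at most [(1 + e) * ((r - 1) / e)]. As
    [(r - 1) / e > 1], raising the exponent from [p / 2] to [2 * m] only increases the power; this
    is what [p <= m] is for. *)
Lemma distortion_pow : d' `^ p <= 2 * (1 + distortion) * d `^ p.
Proof.
have p1 := p_ge1; have e0 := e_gt0; have ep := ep_le1; have v0 := distortion_ge0.
have p0 : 0 < p by lra.
move: d_ge0; rewrite le_eqVlt => /orP[/eqP d0|d0].
  by rewrite d'_eq0 -?d0// powR0 ?mulr0// gt_eqF.
have d20 : 0 < d ^+ 2 by exact: exprn_gt0.
have e12 : (1 + e) `^ p <= 2.
  apply: le_trans (powR_le_expR (ltW e0) (ltW p0)) _.
  apply: (@le_trans _ _ (expR 2^-1)); first by rewrite ler_expR.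
  apply: le_trans (expR_le_inv _) _; first lra.
  by have -> : (1 - 2^-1)^-1 = 2 :> R by field.
pose r := (d' / d) ^+ 2.
have r0 : 0 <= r by exact: sqr_ge0.
have vr : distortion = ((r - 1) / e) ^+ (2 * m).
  by rewrite /distortion; congr (_ ^+ _); rewrite /r; field; rewrite !gt_eqF.
have -> : d' = d' / d * d by rewrite divfK ?gt_eqF.
have q0 : 0 <= d' / d by rewrite divr_ge0// ltW.
rewrite powRM ?(ltW d0)// ler_wpM2r ?powR_ge0//.
have -> : (d' / d) `^ p = r `^ (p / 2).
  by rewrite /r -powR_mulrn// -powRrM; congr (_ `^ _); field.
have [re|er] := leP r (1 + e).
  apply: (@le_trans _ _ ((1 + e) `^ p)); last lra.
  apply: (@le_trans _ _ ((1 + e) `^ (p / 2))).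
    by apply: ge0_ler_powR; rewrite ?nnegrE//; lra.
  by apply: ler_powR; lra.
have u1 : 1 < (r - 1) / e by rewrite ltr_pdivlMr//; lra.
apply: (@le_trans _ _ (((1 + e) * ((r - 1) / e)) `^ (p / 2))).
  apply: ge0_ler_powR; rewrite ?nnegrE ?divr_ge0//; try lra.
    by rewrite mulr_ge0//; lra.
  have -> : (1 + e) * ((r - 1) / e) = (r - 1) / e + r - 1 by field; rewrite gt_eqF.
  lra.
rewrite powRM; [|lra|lra].
apply: (@le_trans _ _ (2 * distortion)); last lra.
apply: ler_pM; rewrite ?powR_ge0//.
  by apply: le_trans e12; apply: ler_powR; lra.
rewrite vr -powR_mulrn; last lra.
apply: ler_powR; first lra.
have := pm; rewrite natrM; lra.
Qed.

End Distortion.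

Lemma cube_add3_le (R : realType) (a b c : R) : 0 <= a -> 0 <= b -> 0 <= c ->
  (a + b + c) ^+ 3 <= 9 * (a ^+ 3 + b ^+ 3 + c ^+ 3).
Proof.
have two (x y : R) : 0 <= x -> 0 <= y -> x ^+ 2 * y + x * y ^+ 2 <= x ^+ 3 + y ^+ 3.
  move=> x0 y0; have := mulr_ge0 (addr_ge0 x0 y0) (sqr_ge0 (x - y)); lra.
move=> a0 b0 c0; have := two _ _ a0 b0; have := two _ _ a0 c0; have := two _ _ b0 c0.
have abc : 6 * (a * b * c) <= 2 * (a ^+ 3 + b ^+ 3 + c ^+ 3).
  have := mulr_ge0 a0 (sqr_ge0 (b - c)); have := mulr_ge0 b0 (sqr_ge0 (a - c)).
  have := mulr_ge0 c0 (sqr_ge0 (a - b)).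
  have := two _ _ a0 b0; have := two _ _ a0 c0; have := two _ _ b0 c0; lra.
lra.
Qed.

Section ParameterBounds.
Variables (R : realType) (p eps delta : R) (k : nat).
Hypotheses (p_ge1 : 1 <= p) (k_gt0 : (0 < k)%N).
Hypotheses (eps_gt0 : 0 < eps) (eps_lt1 : eps < 1) (delta_gt0 : 0 < delta) (delta_lt1 : delta < 1).

Let L := ln (k%:R / delta).
Let l := ln eps^-1.
Let h := (eps / (100 * p))^-1.
Let H := h `^ p.

Lemma exponent_choice : exists m : nat, [/\ (0 < m)%N, p <= m%:R,
  m%:R <= 3605 * (L + p * l + p ^+ 2) &
  5 * k%:R ^+ 2 * H ^+ 36 * expR (- m%:R) <= delta].
Proof.
have p1 := p_ge1; have e0 := eps_gt0; have e1 := eps_lt1; have d0 := delta_gt0; have d1 := delta_lt1.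
have k1 : 1 <= k%:R :> R by rewrite ler1n.
have q0 : 0 < k%:R / delta by rewrite divr_gt0//; lra.
have L0 : 0 <= L by apply: ln_ge0; rewrite ler_pdivlMr// mul1r; lra.
have l0 : 0 <= l by apply: ln_ge0; rewrite invf_ge1// ltW.
have pl0 : 0 <= p * l by rewrite mulr_ge0//; lra.
have pp : p <= p ^+ 2 by rewrite expr2; nra.
(* The three summands pay for 5, for [k ^ 2 / delta], and for [H ^+ 36] by way of
   [100 p <= expR (100 p)]. Rounding up, [M + 1] has coefficients 2, 36, 3600 and the constant 5,
   whence 3605. *)
pose M := 4 + 2 * L + 36 * (p * (100 * p + l)).
have M0 : 0 <= M by rewrite /M mulrDr; nra.
have [m mM Mm] : exists2 m : nat, M <= m%:R & m%:R <= M + 1.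
  exists (Num.truncn M).+1; first by apply/ltW; exact: truncnS_gt.
  by rewrite -natr1 lerD2r truncn_le.
exists m; split.
- by rewrite -(ltr0n R) (lt_le_trans _ mM)// /M; nra.
- by apply: le_trans mM; rewrite /M; nra.
- by apply: (le_trans Mm); rewrite /M; nra.
have eM : expR M <= expR m%:R by rewrite ler_expR.
rewrite expRN ler_pdivrMr ?expR_gt0//.
apply: (@le_trans _ _ (delta * expR M)); last by rewrite ler_pM2l.
have E1 : k%:R ^+ 2 <= delta * expR (2 * L).
  rewrite expRM_natl lnK// exprMn mulrCA ler_peMr ?exprn_ge0 ?ler0n//.
  by rewrite exprVn expr2 invfM mulrA divff ?gt_eqF// mul1r invf_ge1// ltW.
have E2 : H ^+ 36 <= expR (36 * (p * (100 * p + l))).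
  rewrite expRM_natl; apply: lerXn2r; rewrite ?nnegrE ?powR_ge0 ?expR_ge0//.
  rewrite mulrC expRM; apply: ge0_ler_powR; rewrite ?nnegrE ?expR_ge0 ?invr_ge0 ?divr_ge0//; try lra.
  rewrite expRD lnK ?posrE ?invr_gt0// /h invf_div ler_pM2r ?invr_gt0//.
  by have := expR_ge1Dx (100 * p); lra.
have E3 : 5 <= expR 4 :> R by have := expR_ge1Dx (4 : R); lra.
have -> : expR M = expR 4 * expR (2 * L) * expR (36 * (p * (100 * p + l))).
  by rewrite /M expRD; congr (_ * _); exact: expRD.
have -> : delta * (expR 4 * expR (2 * L) * expR (36 * (p * (100 * p + l)))) =
  expR 4 * (delta * expR (2 * L)) * expR (36 * (p * (100 * p + l))) by ring.
have h1 : 0 <= k%:R ^+ 2 :> R by rewrite exprn_ge0.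
have h2 : 0 <= H ^+ 36 by rewrite exprn_ge0// powR_ge0.
apply: ler_pM => //.
by apply: ler_pM.
Qed.

(** By [cube_add3_le], the cube of [L + p l + p^2] is at most [9 (L^3 + p^3 l^3 + p^6)]; multiplied
    by [p^2] this is the bracket of the target dimension, and [72 = 8 * 9]. *)
Lemma sample_size (x c : R) (m D : nat) : 0 <= x -> 1 <= c -> (0 < m)%N ->
  m%:R <= x * (L + p * l + p ^+ 2) ->
  72 * x ^+ 3 * c * (p ^+ 2 * L ^+ 3 + p ^+ 5 * l ^+ 3 + p ^+ 8) / eps ^+ 2 <= D%:R ->
  8 * m%:R ^+ 3 <= D%:R :> R /\ c * p ^+ 2 * m%:R / eps ^+ 2 <= D%:R.
Proof.
have p1 := p_ge1; have e0 := eps_gt0; have e1 := eps_lt1; have d0 := delta_gt0; have d1 := delta_lt1.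
have k1 : 1 <= k%:R :> R by rewrite ler1n.
have q0 : 0 < k%:R / delta by rewrite divr_gt0//; lra.
have L0 : 0 <= L by apply: ln_ge0; rewrite ler_pdivlMr// mul1r; lra.
have l0 : 0 <= l by apply: ln_ge0; rewrite invf_ge1// ltW.
have p0 : 0 <= p by lra.
have pl0 : 0 <= p * l by rewrite mulr_ge0.
move=> x0 c1 m0 mS; have m1 : 1 <= m%:R :> R by rewrite ler1n.
pose Q := L ^+ 3 + (p * l) ^+ 3 + (p ^+ 2) ^+ 3.
have -> : p ^+ 2 * L ^+ 3 + p ^+ 5 * l ^+ 3 + p ^+ 8 = p ^+ 2 * Q by rewrite /Q; ring.
have := cube_add3_le L0 pl0 (exprn_ge0 2 p0); rewrite -/Q => SQ.
have x30 : 0 <= x ^+ 3 by rewrite exprn_ge0.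
have m3 : m%:R ^+ 3 <= x ^+ 3 * (9 * Q).
  apply: (@le_trans _ _ ((x * (L + p * l + p ^+ 2)) ^+ 3)).
    by apply: lerXn2r; rewrite ?nnegrE// (le_trans _ mS).
  by rewrite exprMn ler_wpM2l.
move: (x ^+ 3) x30 m3 => {mS SQ x0}x x0 m3.
have Q0 : 0 <= x * Q by have : 0 <= m%:R ^+ 3 :> R by [exact: exprn_ge0]; lra.
have f1 : 1 <= p ^+ 2 / eps ^+ 2.
  by rewrite ler_pdivlMr ?exprn_gt0// mul1r lerXn2r ?nnegrE//; lra.
move=> CD.
have CD' : 72 * c * (x * Q) * (p ^+ 2 / eps ^+ 2) <= D%:R by move: CD; lra.
have cQ : x * Q <= c * (x * Q) by rewrite ler_peMl.
split.
  apply: le_trans CD'; apply: (@le_trans _ _ (72 * c * (x * Q))); first lra.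
  by rewrite ler_peMr// -mulrA mulr_ge0//; lra.
apply: le_trans CD'; have -> : c * p ^+ 2 * m%:R / eps ^+ 2 = c * m%:R * (p ^+ 2 / eps ^+ 2) by ring.
apply: ler_wpM2r; first lra.
have mm : m%:R <= m%:R ^+ 3 :> R by exact: ler_eXnr.
have -> : 72 * c * (x * Q) = c * (72 * (x * Q)) by ring.
apply: ler_wpM2l; lra.
Qed.

End ParameterBounds.

Lemma parameter_choice (R : realType) (c : R) : 1 <= c -> exists2 C : R, 0 < C &
  forall (p eps delta : R) (k D : nat), 1 <= p -> (0 < k)%N -> 0 < eps -> eps < 1 ->
    0 < delta -> delta < 1 ->
    C * (p ^+ 2 * ln (k%:R / delta) ^+ 3 + p ^+ 5 * ln (eps^-1) ^+ 3 + p ^+ 8) / eps ^+ 2 <= D%:R ->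
  exists m : nat, [/\ (0 < m)%N, p <= m%:R, 8 * m%:R ^+ 3 <= D%:R :> R,
    c * p ^+ 2 * m%:R / eps ^+ 2 <= D%:R &
    5 * k%:R ^+ 2 * ((eps / (100 * p))^-1 `^ p) ^+ 36 * expR (- m%:R) <= delta].
Proof.
move=> c1; have : 0 < 3605 :> R by rewrite ltr0n.
have choice := fun p1 k0 e0 e1 d0 d1 => @exponent_choice R _ _ _ _ p1 k0 e0 e1 d0 d1.
move: (3605 : R) choice => x choice x0.
exists (72 * x ^+ 3 * c); first by rewrite !mulr_gt0 ?exprn_gt0//; lra.
move=> p eps delta k D p1 k0 e0 e1 d0 d1 CD.
have [m [m0 pm mx mdelta]] := choice _ _ _ _ p1 k0 e0 e1 d0 d1.
have [D1 D2] := sample_size p1 k0 e0 e1 d0 d1 (ltW x0) c1 m0 mx CD.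
by exists m; split.
Qed.

Lemma tolerance_bounds (R : realType) (p eps : R) : 1 <= p -> 0 < eps -> eps < 1 ->
  [/\ 0 < eps / (100 * p), eps / (100 * p) * p <= 2^-1 & 1 <= (eps / (100 * p))^-1 `^ p].
Proof.
move=> p1 eps0 eps1; have p0 : 0 < p := lt_le_trans ltr01 p1.
have e0 : 0 < eps / (100 * p) by rewrite divr_gt0// mulr_gt0.
have ep : eps / (100 * p) * p = eps / 100 by field; rewrite gt_eqF.
split=> //; first lra.
apply: (@le_trans _ _ (1 `^ p)); first by rewrite powR1.
have e1 : eps / (100 * p) <= 1 by have := ler_peMr (ltW e0) p1; lra.
by apply: ge0_ler_powR; rewrite ?nnegrE ?invr_ge0 ?invf_ge1// ltW.
Qed.

(** * Random Fourier features *)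

Section TargetSpace.
Variables (R : realType) (D : nat).

(** Matrices with two columns supply the vector space and inner product whose distance is
    [l2dist2D]. *)
Definition mx_ip (u v : 'M[R]_(D, 2)) : R := \sum_j \sum_i u j i * v j i.

Lemma mx_ipP : is_inner_product mx_ip.
Proof.
split=> [u v|c u v w|u u0].
- by apply: eq_bigr => j _; apply: eq_bigr => i _; rewrite mulrC.
- rewrite /mx_ip mulr_sumr -big_split; apply: eq_bigr => j _.
  rewrite mulr_sumr -big_split; apply: eq_bigr => i _.
  by rewrite !mxE mulrDl mulrA.
- rewrite lt_neqAle; apply/andP; split; last first.
    by apply: sumr_ge0 => j _; apply: sumr_ge0 => i _; rewrite -expr2 sqr_ge0.
  apply: contraNneq u0 => /esym/eqP.
  rewrite psumr_eq0 => [/allP u0|j _]; last first.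
    by apply: sumr_ge0 => i _; rewrite -expr2 sqr_ge0.
  apply/eqP/matrixP => j i; rewrite mxE; apply/eqP.
  have := u0 j (mem_index_enum _); rewrite /= psumr_eq0 => [/allP uj|i' _]; last first.
    by rewrite -expr2 sqr_ge0.
  by have := uj i (mem_index_enum _); rewrite /= mulf_eq0 orbb.
Qed.

Definition pairs_mx (u : 'I_D -> R * R) : 'M[R]_(D, 2) :=
  \matrix_(j, i) if i == ord0 then (u j).1 else (u j).2.

Definition mx_pairs (M : 'M[R]_(D, 2)) : 'I_D -> R * R := fun j => (M j ord0, M j ord_max).

Lemma mx_pairsK : cancel mx_pairs pairs_mx.
Proof.
move=> M; apply/matrixP => j i; rewrite !mxE /=; case: eqP => [->//|/eqP].
by case: i => [[|[|//]] i2] // _; congr (M j _); apply: val_inj.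
Qed.

Lemma hdist_pairs_mx u v : hdist mx_ip (pairs_mx u) (pairs_mx v) = l2dist2D u v.
Proof.
rewrite /hdist /hnorm /l2dist2D /mx_ip; congr Num.sqrt; apply: eq_bigr => j _.
by rewrite 2!big_ord_recl big_ord0 !mxE /= !expr2 addr0.
Qed.

End TargetSpace.

Section Cost.
Variables (R : realType) (d : nat) (U : Type) (dist : U -> U -> R) (f : 'rV[R]_d -> U).
Variables (V : lmodType R) (ip : V -> V -> R) (G : U -> V) (G' : V -> U).
Hypotheses (G'K : cancel G' G) (Gdist : forall u v, hdist ip (G u) (G v) = dist u v).

Lemma cost_partition_cost k (P : seq 'rV[R]_d) (sigma : 'rV[R]_d -> 'I_k) p :
  cost dist f P sigma p =
  partition_cost ip (fun i : 'I_(size P) => G (f (nth 0 P i))) (fun i => sigma (nth 0 P i)) p.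
Proof.
apply: eq_bigr => j _; congr inf; apply/seteqP; split=> [_ [c _ <-]|_ [c _ <-]].
  exists (G c) => //; rewrite (big_nth 0) big_mkord.
  by apply: eq_bigr => i _; rewrite Gdist.
exists (G' c) => //; rewrite (big_nth 0) big_mkord.
by apply: eq_bigr => i _; rewrite -Gdist G'K.
Qed.

End Cost.

Lemma partition_cost_void (R : realType) (V : lmodType R) (ip : V -> V -> R) (I J : finType)
    (X : I -> V) (sigma : I -> J) p : #|I| = 0%N -> partition_cost ip X sigma p = 0.
Proof.
move=> /eqP I0; apply: big1 => j _.
have E c : \sum_(x | sigma x == j) hdist ip (X x) c `^ p = 0.
  by apply: big1 => x _; move: (fintype0 x); rewrite (eqP I0).
under eq_imagel do rewrite E.
rewrite -[RHS](inf1 (0 : R)); congr inf; apply/seteqP; split=> [_ [c _ <-]//|_ ->].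
by exists 0.
Qed.

Lemma rff_dist_sqr (R : realType) (d D : nat) (om : 'I_D -> 'rV[R]_d) x y :
  l2dist2D (rff om x) (rff om y) ^+ 2 = 2 * (D%:R^-1 * \sum_j (1 - cos (dotv (om j) (x - y)))).
Proof.
rewrite sqr_sqrtr; last by apply: sumr_ge0 => j _; rewrite addr_ge0// sqr_ge0.
rewrite mulrA mulr_sumr; apply: eq_bigr => j _ /=.
have -> : dotv (om j) (x - y) = dotv (om j) x - dotv (om j) y.
  by rewrite /dotv -sumrB; apply: eq_bigr => i _; rewrite !mxE mulrBr.
rewrite -!mulrBr !exprMn sqr_sqrtr ?invr_ge0// cosB.
have := cos2Dsin2 (dotv (om j) x); have := cos2Dsin2 (dotv (om j) y).
move: (cos _) (sin _) (cos _) (sin _) => c1 s1 c2 s2 h1 h2.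
rewrite -mulrDr [2 * _]mulrC -mulrA; congr (_ * _); lra.
Qed.

Lemma feature_dist_sqr (R : realType) (d : nat) (K : 'rV[R]_d -> R) (H : lmodType R)
    (ip : H -> H -> R) (phi : 'rV[R]_d -> H) x y :
  is_inner_product ip -> feature_map K ip phi -> K 0 = 1 ->
  hdist ip (phi x) (phi y) ^+ 2 = 2 * (1 - K (x - y)).
Proof.
move=> ipP KE K0; rewrite hdist_sqr// ipBB// !KE !subrr K0; ring.
Qed.

Section RandomDefect.
Context (R : realType) (dT : measure_display) (T : measurableType dT) (Pr : probability T R).
Local Notation expect := (expected Pr).

Let m1 : measurable_fun [set: T] (fun _ : T => 1 : R). Proof. exact: measurable_cst. Qed.

Let one_ge0 (t : T) : 0 <= (1 : R). Proof. exact: ler01. Qed.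

Let mass1 := expect_mass Pr.

Definition expect_bounded (f : T -> R) (c : R) := bounded_meas f /\ expect f <= c.

Lemma expect_boundedD f g b c : expect_bounded f b -> expect_bounded g c ->
  expect_bounded (fun t => f t + g t) (b + c).
Proof.
move=> [bf fb] [bg gc]; split; first exact: bounded_measD.
by rewrite /expected (meanD m1 one_ge0 mass1)// lerD.
Qed.

Lemma expect_boundedZ a f b : 0 <= a -> expect_bounded f b ->
  expect_bounded (fun t => a * f t) (a * b).
Proof.
move=> a0 [bf fb]; split; first by apply: bounded_measM => //; exact: bounded_meas_cst.
by rewrite expectZ// ler_wpM2l.
Qed.

Lemma expect_bounded_sum (J : Type) (r : seq J) (P : pred J) (f : J -> T -> R) c :
  (forall j, expect_bounded (f j) (c j)) ->
  expect_bounded (fun t => \sum_(j <- r | P j) f j t) (\sum_(j <- r | P j) c j).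
Proof.
move=> fc; elim: r => [|j r ih].
  rewrite big_nil; under eq_fun do rewrite big_nil.
  by split; [exact: bounded_meas_cst|rewrite /expected (mean_cst m1 one_ge0 mass1)].
rewrite big_cons; under eq_fun do rewrite big_cons.
by case: (P j) => //; exact: expect_boundedD.
Qed.

Lemma expect_bounded_le f b c : b <= c -> expect_bounded f b -> expect_bounded f c.
Proof. by move=> bc [bf fb]; split=> //; exact: le_trans fb bc. Qed.

Lemma expect_markov f c : (forall t, 0 <= f t) -> expect_bounded f c ->
  measurable [set t | f t <= 1] /\ ((1 - c)%:E <= Pr [set t | (f t <= 1)%R])%E.
Proof.
move=> f0 [bf fc]; have mA : measurable [set t | f t <= 1].
  have := bf.1 measurableT _ (measurable_itv `]-oo, 1]); rewrite setTI.
  by congr measurable; apply/seteqP; split=> t /=; rewrite in_itv/=.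
split=> //; have mAC := measurableC mA.
have : expect \1_(~` [set t | f t <= 1]) <= expect f.
  apply: (le_mean m1 one_ge0 mass1) => //; first exact: bounded_meas_indic.
  move=> t; rewrite indicE; case: (boolP (t \in _)) => [/set_mem/= /negP|_] //.
  by rewrite -ltNge => /ltW.
have -> : expect \1_(~` [set t | f t <= 1]) = fine (Pr (~` [set t | f t <= 1])).
  rewrite /expected /weighted_mean /Rintegral.
  under eq_integral do rewrite mul1r.
  by rewrite integral_indic// ?setIT.
move=> h; have {}h := le_trans h fc.
have fA : Pr [set t | f t <= 1] \is a fin_num by exact: fin_num_measure.
by move: h; rewrite probability_setC// -(fineK fA) -EFinB/= lee_fin; lra.
Qed.

Variables (V : lmodType R) (ip : V -> V -> R) (I J : finType) (X : I -> V).
Variables (s : J -> I) (a : I -> J) (v : T -> I -> I -> R) (p e beta eta delta H : R).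
Let N : R := #|J|%:R.
Let rho := center_dist ip X s a.
Hypotheses (beta_gt0 : 0 < beta) (eta_ge0 : 0 <= eta) (H_gt0 : 0 < H).
Hypothesis v_ge0 : forall t x y, 0 <= v t x y.
Hypothesis v_eta : forall x y, expect_bounded (fun t => v t x y) eta.
Hypothesis eta_le : (N ^+ 2 + H ^+ 4 * (N + 3 * N / beta)) * eta <= delta.

Let defect t x := defect ip X s a (v t) e beta x.

Let defect_ge0 t x : 0 <= defect t x.
Proof.
apply: addr_ge0; first by apply: sumr_ge0 => j _; exact: v_ge0.
apply: mulr_ge0; first by rewrite invr_ge0 ltW.
apply: sumr_ge0 => j _; apply: sumr_ge0 => i _; apply: mulr_ge0.
  by rewrite invr_ge0 ler0n.
by apply: sumr_ge0 => y _; exact: v_ge0.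
Qed.

Let sum_cst (c : R) : \sum_(j : J) c = N * c.
Proof. by rewrite sumr_const -mulr_natl. Qed.

(** The average of [v] over a group has expectation at most [eta], and for an empty group it is 0
    because [0^-1 = 0]. Each of the [N] centers contributes three offsets. *)
Lemma defect_expect x : expect_bounded (defect^~ x) ((N + 3 * N / beta) * eta).
Proof.
have step q : expect_bounded (fun t => (group_size ip X s a e q)^-1 *
    \sum_(y | group ip X s a e y == q) v t x y) eta.
  have i0 : 0 <= (group_size ip X s a e q)^-1 by rewrite invr_ge0 ler0n.
  apply: expect_bounded_le (expect_boundedZ i0 (expect_bounded_sum _ _ (fun y => v_eta x y))).
  rewrite sumr_const -mulr_natr mulrCA; set n := _%:R.
  have -> : group_size ip X s a e q = n by [].
  have [->|n0] := eqVneq n 0; first by rewrite invr0 mul0r mulr0.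
  by rewrite mulVf// mulr1.
have b0 : 0 <= beta^-1 by rewrite invr_ge0 ltW.
apply: expect_bounded_le (expect_boundedD (expect_bounded_sum _ _ (fun j => v_eta x (s j)))
  (expect_boundedZ b0 (expect_bounded_sum _ _ (fun j =>
    expect_bounded_sum _ _ (fun o => step (j, true, scale ip X s a e x + o)))))).
rewrite !big_cons big_nil !sum_cst.
rewrite le_eqVlt; apply/orP; left; apply/eqP; field; rewrite gt_eqF//.
Qed.

Lemma good_sample : exists A : set T, [/\ measurable A, ((1 - delta)%:E <= Pr A)%E &
  forall t, A t -> (forall j j', v t (s j) (s j') <= 1) /\
    \sum_x rho x `^ p * defect t x <= H ^- 4 * \sum_x rho x `^ p].
Proof.
pose OPT := \sum_x rho x `^ p.
have OPT0 : 0 <= OPT by apply: sumr_ge0 => x _; exact: powR_ge0.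
(* Both conditions follow from one application of Markov's inequality, to [Z1 + H ^+ 4 / OPT * Z2].
   If [OPT = 0], the quotient is 0 and the second condition holds because every [rho x ^ p]
   vanishes. *)
have c0 : 0 <= H ^+ 4 / OPT by rewrite divr_ge0// exprn_ge0// ltW.
pose Z1 t := \sum_j \sum_j' v t (s j) (s j').
pose Z2 t := \sum_x rho x `^ p * defect t x.
have Z10 t : 0 <= Z1 t by apply: sumr_ge0 => j _; apply: sumr_ge0 => j' _; exact: v_ge0.
have Z20 t : 0 <= Z2 t by apply: sumr_ge0 => x _; rewrite mulr_ge0// powR_ge0.
have EZ1 : expect_bounded Z1 (N ^+ 2 * eta).
  apply: expect_bounded_le (expect_bounded_sum _ _ (fun j =>
    expect_bounded_sum _ _ (fun j' => v_eta (s j) (s j')))).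
  by rewrite !sum_cst; lra.
have EZ2 : expect_bounded Z2 (OPT * ((N + 3 * N / beta) * eta)).
  rewrite /OPT mulr_suml; apply: expect_bounded_sum => x.
  by apply: expect_boundedZ (defect_expect x); exact: powR_ge0.
have EZ : expect_bounded (fun t => Z1 t + H ^+ 4 / OPT * Z2 t) delta.
  apply: expect_bounded_le (expect_boundedD EZ1 (expect_boundedZ c0 EZ2)).
  apply: le_trans eta_le; rewrite [leRHS]mulrDl lerD2l.
  have [->|On0] := eqVneq OPT 0.
    by rewrite mul0r mulr0 !mulr_ge0 ?exprn_ge0 ?(ltW H_gt0)// addr_ge0 ?ler0n// divr_ge0 ?(ltW beta_gt0)// mulr_ge0 ?ler0n.
  by rewrite le_eqVlt; apply/orP; left; apply/eqP; field; rewrite On0 gt_eqF.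
have Z0 t : 0 <= Z1 t + H ^+ 4 / OPT * Z2 t by rewrite addr_ge0// mulr_ge0.
have [mA PA] := expect_markov Z0 EZ.
eexists; split; [exact: mA|exact: PA|move=> t /= Zt; split=> [j j'|]].
  apply: le_trans Zt; apply: (@le_trans _ _ (Z1 t)); last by rewrite lerDl mulr_ge0.
  rewrite /Z1 (bigD1 j)//= (bigD1 j')//= -addrA lerDl addr_ge0//.
    by apply: sumr_ge0 => i _; exact: v_ge0.
  by apply: sumr_ge0 => i _; apply: sumr_ge0 => i' _; exact: v_ge0.
rewrite -/(Z2 t) -/OPT; have [ O0|On0] := eqVneq OPT 0.
  rewrite O0 mulr0 /Z2 big1// => x _.
  have := O0; rewrite /OPT => /eqP; rewrite psumr_eq0 => [/allP|y _]; last exact: powR_ge0.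
  by move=> /(_ x (mem_index_enum _))/eqP ->; rewrite mul0r.
have Op : 0 < OPT by rewrite lt_neqAle eq_sym On0.
have Zt2 : H ^+ 4 / OPT * Z2 t <= 1 by apply: le_trans Zt; rewrite lerDr.
rewrite ler_pdivlMl ?exprn_gt0//.
move: Zt2; rewrite mulrAC ler_pdivrMr// mul1r//.
Qed.

End RandomDefect.

(** [G ^- 32 / N] is the value of [beta]. Its 32 powers and the 4 from Markov's inequality explain
    the exponent 36 in the choice of [m]. *)
Lemma defect_budget (R : realType) (N G : R) : 1 <= N -> 1 <= G ->
  N ^+ 2 + G ^+ 4 * (N + 3 * N / (G ^- 32 / N)) <= 5 * N ^+ 2 * G ^+ 36.
Proof.
move=> N1 G1; have N0 : 0 < N := lt_le_trans ltr01 N1; have G0 : 0 < G := lt_le_trans ltr01 G1.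
have -> : N ^+ 2 + G ^+ 4 * (N + 3 * N / (G ^- 32 / N)) =
    N ^+ 2 + N * G ^+ 4 + 3 * (N ^+ 2 * G ^+ 36) by field; rewrite !gt_eqF.
have h1 : N ^+ 2 <= N ^+ 2 * G ^+ 36 by rewrite ler_peMr ?sqr_ge0// exprn_ege1.
have h2 : N * G ^+ 4 <= N ^+ 2 * G ^+ 36.
  apply: ler_pM; rewrite ?(ltW N0) ?exprn_ge0 ?(ltW G0)//; first exact: ler_eXnr.
  by apply: ler_weXn2l.
lra.
Qed.

Section KernelDistortion.
Variables (R : realType) (d : nat) (K : 'rV[R]_d -> R).
Variables (lam : {measure set (Rd R d) -> \bar R}) (pK : Rd R d -> R).
Hypothesis lamP : is_lebesgue_Rd lam.
Hypotheses (mpK : measurable_fun setT pK) (pK_ge0 : forall w, 0 <= pK w).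
Hypothesis K0 : K 0 = 1.
Hypothesis KE : forall x : 'rV[R]_d,
  (K x)%:E = (\int[lam]_w (pK w * cos (dotv (w : 'rV[R]_d) x))%:E)%E.

(** It makes the feature map injective: at source distance 0 the points coincide, so the target
    distance is 0 as well and the value 0 of [distortion] there is the right one. *)
Lemma kernel_eq1 z : K z = 1 -> z = 0.
Proof.
have [c c0 gap] := kernel_gap lamP mpK pK_ge0 K0 KE.
move=> Kz; have := gap z; rewrite Kz subrr pmulr_rle0// ge_min leNgt ltr01/=.
move=> s0; have {s0} s0 : supnorm z = 0.
  by apply/eqP; rewrite -sqrf_eq0 eq_le s0 sqr_ge0.
apply/rowP => i; rewrite mxE; apply/eqP; rewrite -normr_le0 -s0; exact: supnorm_ge.
Qed.

Context (dT : measure_display) (T : measurableType dT).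
Variables (Pr : probability T R) (D : nat) (om : 'I_D -> T -> Rd R d).
Hypothesis iid : iid_with_density Pr om lam pK.
Variables (H : lmodType R) (ip : H -> H -> R) (phi : 'rV[R]_d -> H).
Hypotheses (ipP : is_inner_product ip) (phiP : feature_map K ip phi).
Variable B : R.
Hypothesis B_ge1 : 1 <= B.
Hypothesis moments : forall a (z : 'rV[R]_d),
  weighted_mean lam pK (fun w : Rd R d => (1 - cos (dotv (w : 'rV[R]_d) z)) ^+ a) <=
  (B * a%:R ^+ 2 * (1 - K z)) ^+ a.

Definition rff_dist t x y := l2dist2D (rff (fun j => (om j t : 'rV[R]_d)) x)
  (rff (fun j => (om j t : 'rV[R]_d)) y).

Lemma rff_dist_eq0 t x y : hdist ip (phi x) (phi y) = 0 -> rff_dist t x y = 0.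
Proof.
move=> d0; have := feature_dist_sqr x y ipP phiP K0; rewrite d0 expr0n/= => /esym/eqP.
rewrite mulf_eq0 pnatr_eq0/= subr_eq0 => /eqP/esym/kernel_eq1/eqP; rewrite subr_eq0 => /eqP ->.
by rewrite /rff_dist /l2dist2D big1 ?sqrtr0// => j _; rewrite !subrr expr0n addr0.
Qed.

Lemma expect_distortion x y (e : R) m : (0 < m)%N -> 0 < e ->
  8 * m%:R ^+ 3 <= D%:R :> R -> 128 * expR 1 ^+ 5 * B ^+ 2 * m%:R / e ^+ 2 <= D%:R ->
  expect_bounded Pr (fun t => distortion (hdist ip (phi x) (phi y)) (rff_dist t x y) e m)
    (expR (- m%:R)).
Proof.
move=> m0 e0 mD eD; set z := x - y.
pose Y (w : Rd R d) : R := 1 - cos (dotv (w : 'rV[R]_d) z).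
have bY : bounded_meas Y := bounded_one_minus_cos z.
have mY : 1 - K z = weighted_mean lam pK Y := one_minus_kernel mpK pK_ge0 K0 KE z.
have Kz : 0 <= 1 - K z.
  by have := kernel_norm_le1 mpK pK_ge0 K0 KE z; rewrite ler_norml; lra.
have E t : distortion (hdist ip (phi x) (phi y)) (rff_dist t x y) e m =
    ((D%:R^-1 * (\sum_j Y (om j t)) - (1 - K z)) / (e * (1 - K z))) ^+ (2 * m).
  rewrite /distortion (feature_dist_sqr x y ipP phiP K0) rff_dist_sqr -/z.
  congr (_ ^+ _); rewrite -mulrBr mulrCA -mulf_div divff ?mul1r//.
under eq_fun do rewrite E.
have b1 : bounded_meas (fun t => ((D%:R^-1 * (\sum_j Y (om j t)) - (1 - K z)) / (e * (1 - K z))) ^+ (2 * m)).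
  apply: bounded_measX; apply: bounded_measM; last exact: bounded_meas_cst.
  apply: bounded_measB; last exact: bounded_meas_cst.
  apply: bounded_measM; first exact: bounded_meas_cst.
  by apply: bounded_meas_sum => j; exact: (bounded_meas_om iid).
split=> //; have [z0|zn0] := eqVneq (1 - K z) 0.
  have -> : (fun t => ((D%:R^-1 * (\sum_j Y (om j t)) - (1 - K z)) / (e * (1 - K z))) ^+ (2 * m)) =
      (fun=> 0).
    apply/funext => t; rewrite z0 mulr0 invr0 mulr0 expr0n.
    by case: (m) m0.
  by rewrite expect_cst expR_ge0.
have Kzp : 0 < 1 - K z by rewrite lt_neqAle eq_sym zn0.
have m1 : 0 < m%:R :> R by rewrite ltr0n.
have D0 : 0 < D%:R :> R by have : 0 < m%:R ^+ 3 :> R by [exact: exprn_gt0]; lra.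
have -> : (fun t => ((D%:R^-1 * (\sum_j Y (om j t)) - (1 - K z)) / (e * (1 - K z))) ^+ (2 * m)) =
    (fun t => (((\sum_j Y (om j t)) / (D%:R * weighted_mean lam pK Y) - 1) / e) ^+ (2 * m)).
  apply/funext => t; rewrite -mY; congr (_ ^+ _); field; rewrite !gt_eqF//.
apply: (sample_concentration mpK pK_ge0 (density_mass K0 KE) iid (B := B)) => //.
- by move=> w; rewrite /Y subr_ge0; have := cos_max (dotv (w : 'rV[R]_d) z); rewrite ler_norml => /andP[].
- by rewrite -mY.
- by move=> a; rewrite -mY; exact: moments.
Qed.

End KernelDistortion.

Unset Implicit Arguments.

Theorem theorem3p5 (R : realType) (d : nat) (K : 'rV[R]_d -> R)
    (lam : {measure set (Rd R d) -> \bar R}) (pK : Rd R d -> R) :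
  K 0 = 1 ->
  (exists r : R, 0 < r /\ analytic_on K [set x | l1norm x < r]) ->
  is_lebesgue_Rd lam ->
  measurable_fun setT pK -> (forall w, 0 <= pK w) ->
  (forall x : 'rV[R]_d,
     (K x)%:E = (\int[lam]_w (pK w * cos (dotv (w : 'rV[R]_d) x))%:E)%E) ->
  (forall x : 'rV[R]_d,
     (\int[lam]_w (pK w * sin (dotv (w : 'rV[R]_d) x))%:E)%E = 0%E) ->
  exists C : R, 0 < C /\
  forall (H : lmodType R) (ip : H -> H -> R) (phi : 'rV[R]_d -> H),
    is_inner_product ip -> hilbert_complete ip -> feature_map K ip phi ->
  forall (p : R) (k : nat) (eps delta : R),
    1 <= p -> (0 < k)%N -> 0 < eps < 1 -> 0 < delta < 1 ->
  forall P : seq 'rV[R]_d, uniq P ->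
  forall D : nat,
    C * (p ^+ 2 * ln (k%:R / delta) ^+ 3 + p ^+ 5 * ln (eps^-1) ^+ 3 + p ^+ 8)
      / eps ^+ 2 <= D%:R ->
  forall (dT : measure_display) (T : measurableType dT) (Pr : probability T R)
         (om : 'I_D -> T -> Rd R d),
    iid_with_density Pr om lam pK ->
    exists A : set T, [/\ measurable A,
      A `<=` [set t | forall sigma : 'rV[R]_d -> 'I_k,
                 (1 - eps) * cost (hdist ip) phi P sigma p
                 <= cost (@l2dist2D R D) (rff (fun j => (om j t : 'rV[R]_d))) P sigma p
                 <= (1 + eps) * cost (hdist ip) phi P sigma p]
    & ((1 - delta)%:E <= Pr A)%E].
Proof.
move=> K0 [r [r0 aK]] lamP mpK pK0 KE _.
have U0 : [set x : 'rV[R]_d | l1norm x < r] 0.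
  by rewrite /= /l1norm big1// => i _; rewrite mxE normr0.
have [B B1 mom] := kernel_moments lamP mpK pK0 K0 KE aK U0.
have ex1 : 1 <= expR 1 :> R by rewrite -[leLHS]expR0 ler_expR.
(* The tolerance is [e = eps / (100 * p)], so [1 / e ^+ 2] contributes
   [10000 * p ^+ 2 / eps ^+ 2]. *)
have [|C C0 CP] := @parameter_choice R (128 * 10000 * expR 1 ^+ 5 * B ^+ 2).
  have h1 : 1 <= expR 1 ^+ 5 :> R by exact: exprn_ege1.
  have h2 : 1 <= B ^+ 2 by exact: exprn_ege1.
  by have := mulr_ege1 h1 h2; lra.
exists C; split=> // H ip phi ipP _ phiP p k eps delta p1 k0 /andP[e0 e1] /andP[d0 d1] P _ D.
pose e := eps / (100 * p).
have [e'0 ep G1] := tolerance_bounds p1 e0 e1; rewrite -/e in e'0 ep G1.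
pose G := e^-1 `^ p.
have G0 : 0 < G by exact: lt_le_trans ltr01 G1.
have p0 : 0 < p := lt_le_trans ltr01 p1.
move=> CD dT T Pr om iid.
have costH sigma := @cost_partition_cost R d H (hdist ip) phi H ip id id
  (fun=> erefl) (fun _ _ => erefl) k P sigma p.
have costD t sigma := cost_partition_cost (rff (fun j => (om j t : 'rV[R]_d)))
  (@mx_pairsK R D) (@hdist_pairs_mx R D) P sigma p (k := k).
(* Without data there is no candidate for a medoid, but all costs are 0. *)
have [P0|P0] := posnP (size P).
  exists setT; split=> // [t _ sigma|]; last by rewrite probability_setT lee_fin gerBl ltW.
  by rewrite costH costD !partition_cost_void ?card_ord// !mulr0 lexx.
have [m [m0 pm mD mD2 mdelta]] := CP p eps delta k D p1 k0 e0 e1 d0 d1 CD.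
pose X (i : 'I_(size P)) := phi (nth 0 P i).
have [s [a [near opt]]] := medoids ipP X (le_trans ler01 p1) (Ordinal P0) (Ordinal k0).
pose v t x y := distortion (hdist ip (X x) (X y)) (rff_dist om t (nth 0 P x) (nth 0 P y)) e m.
pose N : R := #|'I_k|%:R.
have N1 : 1 <= N by rewrite /N card_ord ler1n.
have v_ge0 t x y : 0 <= v t x y by exact: distortion_ge0.
have eD : 128 * expR 1 ^+ 5 * B ^+ 2 * m%:R / e ^+ 2 <= D%:R.
  apply: le_trans mD2; rewrite /e le_eqVlt; apply/orP; left; apply/eqP.
  by field; rewrite !gt_eqF.
have v_eta x y : expect_bounded Pr (fun t => v t x y) (expR (- m%:R)).
  exact: (expect_distortion mpK pK0 K0 KE iid ipP phiP B1 mom (nth 0 P x) (nth 0 P y) m0 e'0 mD eD).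
pose beta := G ^- 32 / N.
have beta0 : 0 < beta by rewrite divr_gt0 ?invr_gt0 ?exprn_gt0// (lt_le_trans ltr01 N1).
have eta_le : (N ^+ 2 + G ^+ 4 * (N + 3 * N / beta)) * expR (- m%:R) <= delta.
  apply: le_trans mdelta; rewrite ler_wpM2r ?expR_ge0// -/e -/G.
  have -> : k%:R = N by rewrite /N card_ord.
  exact: defect_budget.
have [A [mA PA AP]] := good_sample ip X s a p e beta0 (expR_ge0 _) G0 v_ge0 v_eta eta_le.
exists A; split=> // t /AP[vs dl] sigma.
rewrite costH costD.
pose Y (x : 'I_(size P)) := pairs_mx (rff (fun j => (om j t : 'rV[R]_d)) (nth 0 P x)).
have hY x y : hdist (@mx_ip R D) (Y x) (Y y) = rff_dist om t (nth 0 P x) (nth 0 P y).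
  by rewrite hdist_pairs_mx.
have z x y : hdist ip (X x) (X y) = 0 -> rff_dist om t (nth 0 P x) (nth 0 P y) = 0.
  exact: (rff_dist_eq0 lamP mpK pK0 K0 KE om ipP phiP).
have h x y : 0 <= rff_dist om t (nth 0 P x) (nth 0 P y) by exact: sqrtr_ge0.
apply: (partition_cost_relative_error ipP (mx_ipP R D) (X := X) (X' := Y) (s := s) (a := a)
  (v := v t) (Ordinal k0) p1 e0 e1) => //.
- move=> x y; rewrite hY => vxy; apply: (distortion_ok (p := p)) vxy => //; [exact: hdist_ge0|exact: z].
- move=> x y; rewrite hY; apply: distortion_pow => //; [exact: hdist_ge0|exact: z].
Qed.
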